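(* Assume $W$ is not $H$-stable, and for $m>1$ let $\beta_c^m$ be a transition point of $\mathcal F_\beta^m$. If $m\in[2,3]$, then $\beta_c^m$ is a discontinuous transition point. Specifically, for the case $m=2$ we have: (1) $\beta_c^2=\beta_\sharp^2$; (2) there exists a one-parameter family of minimisers $\{\rho_\alpha\}_{\alpha\in[0,\,|\Omega|^{-1/2}\Theta(k^\sharp)^{-1}]}$ of $\mathcal F^2_{\beta_\sharp^2}$ with $\rho_0=\rho_\infty$. Here $k^\sharp\in\mathbb N^d\setminus\{0\}$ is a minimiser of $k\mapsto\hat W(k)/\Theta(k)$ over $\mathbb N^d\setminus\{0\}$ (any one of them if it is not unique), and $$\beta_\sharp^m:=-\frac{m\,\rho_\infty^{m-3/2}}{\displaystyle\min_{k\in\mathbb N^d,\,k\ne0}\frac{\hat W(k)}{\Theta(k)}}.$$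
   Context: $\Omega=\mathbb T^d$ is the torus of side length $L>0$, $\rho_\infty:=L^{-d}=|\Omega|^{-1}$; $\mathcal P(\Omega)$ is the set of Borel probability measures on $\Omega$, identified with their densities when these exist. $W\in C^2(\Omega)$ is even along every coordinate and has mean zero. For $m>1$, $$\mathcal F_\beta^m(\rho)=\frac{\beta^{-1}}{m-1}\int_\Omega\rho^m\,dx-\frac{\beta^{-1}}{m-1}+\frac12\iint_{\Omega\times\Omega}W(x-y)\rho(x)\rho(y)\,dx\,dy$$ whenever these quantities are finite, and $+\infty$ otherwise; ''minimiser'' means minimiser over $\mathcal P(\Omega)$. Fourier conventions ($\mathbb N\ni0$): for $k\in\mathbb Z^d$, $e_k(x)=N_k\prod_{i=1}^d e_{k_i}(x_i)$ with $e_{k_i}(x_i)=\cos(2\pi k_ix_i/L)$ if $k_i>0$, $1$ if $k_i=0$, $\sin(2\pi k_ix_i/L)$ if $k_i<0$; $N_k=L^{-d/2}\Theta(k)$, $\Theta(k)=\prod_{i=1}^d(2-\delta_{k_i,0})^{1/2}$; $\hat W(k)=\langle W,e_k\rangle_{L^2(\Omega)}$. $W$ is $H$-stable if $\hat W(k)\ge0$ for all $k\in\mathbb Z^d\setminus\{0\}$. Transition point: $\beta_c>0$ is a transition point of $\mathcal F_\beta^m$ if (i) for $\beta<\beta_c$, $\rho_\infty$ is the unique minimiser of $\mathcal F_\beta^m$; (ii) at $\beta=\beta_c$, $\rho_\infty$ is a minimiser; (iii) for every $\beta>\beta_c$ there exists a minimiser $\rho_\beta\neq\rho_\infty$ of $\mathcal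 F_\beta^m$. It is continuous if $\rho_\infty$ is the unique minimiser of $\mathcal F_{\beta_c}^m$ and, for any family $\{\rho_\beta\}_{\beta>\beta_c}$ of minimisers, $\limsup_{\beta\to\beta_c^+}\|\rho_\beta-\rho_\infty\|_{L^\infty(\Omega)}=0$; it is discontinuous if it is not continuous. *)

(* Defs.v *)
From HB Require Import structures.
From mathcomp Require Import all_boot all_order all_algebra.
From mathcomp Require Import all_classical all_reals all_analysis.

Set Implicit Arguments.
Unset Strict Implicit.
Unset Printing Implicit Defensive.

Import Order.TTheory GRing.Theory Num.Theory.
Import numFieldNormedType.Exports.

Local Open Scope classical_set_scope.
Local Open Scope charge_scope.
Local Open Scope ring_scope.

(* The torus of side L is represented by its fundamental domain [0, L[^d,
   Borel subset of the measurable space [d.-tuple R].  A function on the torus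
   is an L-periodic function of ['rV[R]_d] (the type carrying the topology and
   the derivatives); [vec] goes from the former type to the latter. *)
Definition vec (R : realType) d (x : d.-tuple R) : 'rV[R]_d :=
  \row_i tnth x i.

Definition torus (R : realType) (L : R) d : set (d.-tuple R) :=
  [set x | forall i, 0 <= tnth x i < L].

Arguments torus {R} L d.

Section torus_measure.
Context (R : realType).

Definition side_measure (L : R) : set R -> \bar R :=
  mrestr lebesgue_measure (measurable_itv `[0, L[).

Let side_measure0 L : side_measure L set0 = 0%E.
Proof. exact: (measure0 (mrestr lebesgue_measure (measurable_itv `[0, L[))). Qed.

Let side_measure_ge0 L A : (0 <= side_measure L A)%E.
Proof. exact: (measure_ge0 (mrestr lebesgue_measure (measurable_itv `[0, L[))). Qed.

Let side_measure_sigma_additive L : semi_sigma_additive (side_measure L).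
Proof.
exact: (@measure_semi_sigma_additive _ _ _
  (mrestr lebesgue_measure (measurable_itv `[0, L[))).
Qed.

HB.instance Definition _ L := isMeasure.Build _ _ _ (side_measure L)
  (side_measure0 L) (side_measure_ge0 L) (@side_measure_sigma_additive L).

Let side_measure_finite L : fin_num_fun (side_measure L).
Proof.
move=> A mA; rewrite ge0_fin_numE//.
apply: (@le_lt_trans _ _ (lebesgue_measure `[0, L[)).
  by apply: le_measure; rewrite ?inE//; exact: measurableI.
by rewrite /= lebesgue_measure_itv/=; case: ifPn => // _; rewrite ltry.
Qed.

HB.instance Definition _ L :=
  Measure_isFinite.Build _ _ _ (side_measure L) (side_measure_finite L).

Section cons_measure.
Variables (mu : {finite_measure set R -> \bar R}) (n : nat).
Variable nu : {finite_measure set (n.-tuple R) -> \bar R}.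

Definition tuple_cons (z : R * n.-tuple R) : n.+1.-tuple R :=
  [tuple of z.1 :: z.2].

Lemma measurable_tuple_cons : measurable_fun setT tuple_cons.
Proof. exact: measurable_cons. Qed.

Definition cons_measure : set (n.+1.-tuple R) -> \bar R :=
  pushforward (mu \x nu)%E tuple_cons.

Let cons_measure0 : cons_measure set0 = 0%E.
Proof. by rewrite /cons_measure /pushforward preimage_set0 measure0. Qed.

Let cons_measure_ge0 A : (0 <= cons_measure A)%E.
Proof. exact: (measure_ge0 (mu \x nu)%E). Qed.

Let cons_measure_sigma_additive : semi_sigma_additive cons_measure.
Proof.
move=> F mF tF mUF; rewrite /cons_measure /pushforward preimage_bigcup.
have mf := measurable_tuple_cons.
apply: measure_semi_sigma_additive.
- by move=> k; rewrite -[X in measurable X]setTI; exact: mf.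
- apply/trivIsetP => /= i j _ _ ij; rewrite -preimage_setI.
  by move/trivIsetP : tF => /(_ _ _ _ _ ij) ->//; rewrite preimage_set0.
- by rewrite -preimage_bigcup -[X in measurable X]setTI; exact: mf.
Qed.

HB.instance Definition _ := isMeasure.Build _ _ _ cons_measure
  cons_measure0 cons_measure_ge0 cons_measure_sigma_additive.

Lemma cons_measureT : cons_measure setT = (mu setT * nu setT)%E.
Proof.
by rewrite /cons_measure /pushforward preimage_setT -setXTT product_measure1E.
Qed.

Let cons_measure_finite : fin_num_fun cons_measure.
Proof.
move=> A mA; rewrite ge0_fin_numE//.
apply: (@le_lt_trans _ _ (cons_measure setT)).
  by apply: le_measure; rewrite ?inE.
by rewrite cons_measureT -ge0_fin_numE ?mule_ge0// fin_numM// fin_num_measure.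
Qed.

HB.instance Definition _ :=
  Measure_isFinite.Build _ _ _ cons_measure cons_measure_finite.

End cons_measure.

(* dx on the torus, as a measure on the ambient R^d which does not charge the
   complement of [torus L d] *)
Fixpoint torus_measure (L : R) d : {finite_measure set (d.-tuple R) -> \bar R} :=
  if d is n.+1 then cons_measure (side_measure L) (torus_measure L n)
  else dirac [tuple].

Lemma torus_measureT (L : R) d : 0 < L -> torus_measure L d setT = (L ^+ d)%:E.
Proof.
move=> L0; elim: d => [|d ih] /=; first by rewrite diracT.
rewrite cons_measureT ih exprS EFinM; congr (_ * _)%E.
transitivity (lebesgue_measure `[0, L[); last first.
  by rewrite lebesgue_measure_itv/= lte_fin L0 sube0.
by congr (lebesgue_measure _); exact: setTI.
Qed.

End torus_measure.

Section definitions.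
Context (R : realType) (L : {posnum R}) (d : nat).

Local Notation point := (d.-tuple R).
Local Notation vector := 'rV[R]_d.
Local Notation dx := (torus_measure L%:num d).

Definition basis (i : 'I_d) : vector := delta_mx ord0 i.

Definition periodic_along_axes (f : vector -> R) : Prop :=
  forall i x, f (x + L%:num *: basis i) = f x.

Definition flip (i : 'I_d) (x : vector) : vector :=
  \row_j (if j == i then - x ord0 j else x ord0 j).

Definition even_along_axes (f : vector -> R) : Prop :=
  forall i x, f (flip i x) = f x.

Definition of_class_C2 (f : vector -> R) : Prop :=
  [/\ continuous f,
      forall i, (forall x, derivable f x (basis i)) /\
                continuous (fun x => 'D_(basis i) f x)
    & forall i j,
        (forall x, derivable (fun y => 'D_(basis i) f y) x (basis j)) /\
        continuous (fun x => 'D_(basis j) (fun y => 'D_(basis i) f y) x)].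

Definition mean_zero (f : vector -> R) : Prop := \int[dx]_x f (vec x) = 0.

Definition wave (k : int) (t : R) : R :=
  let a := 2 * pi * k%:~R * t / L%:num in
  if 0 < k then cos a else if k == 0 then 1 else sin a.

Definition Theta (k : 'rV[int]_d) : R :=
  \prod_(i < d) Num.sqrt (2 - (k ord0 i == 0)%:R).

Definition fourier_mode (k : 'rV[int]_d) (x : point) : R :=
  L%:num `^ (- (d%:R / 2)) * Theta k *
  \prod_(i < d) wave (k ord0 i) (tnth x i).

Definition fourier_coef (f : vector -> R) (k : 'rV[int]_d) : R :=
  \int[dx]_x (f (vec x) * fourier_mode k x).

Definition H_stable (W : vector -> R) : Prop :=
  forall k : 'rV[int]_d, k != 0 -> 0 <= fourier_coef W k.

Definition natural_modes : set 'rV[int]_d :=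
  [set k | (forall i, 0 <= k ord0 i) /\ k != 0].

Definition coef_ratio (W : vector -> R) (k : 'rV[int]_d) : R :=
  fourier_coef W k / Theta k.

Definition minimising_mode (W : vector -> R) (k : 'rV[int]_d) : Prop :=
  natural_modes k /\
  forall l, natural_modes l -> coef_ratio W k <= coef_ratio W l.

Definition is_torus_probability (rho : probability point R) : Prop :=
  rho (torus L%:num d) = 1%E.

(* Leibniz equality of measures also compares their irrelevant values on
   non-measurable sets *)
Definition same_measure (rho mu : probability point R) : Prop :=
  forall A, measurable A -> rho A = mu A.

Definition rho_infty : R := L%:num ^- d.

Definition uniform_measure : set point -> \bar R :=
  mscale (L%:num ^- d)%:nng dx.

HB.instance Definition _ := Measure.on uniform_measure.

Let uniform_measureT : uniform_measure setT = 1%E.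
Proof.
by rewrite /uniform_measure /mscale/= torus_measureT// -EFinM mulVf.
Qed.

HB.instance Definition _ := Measure_isProbability.Build _ _ _ uniform_measure
  uniform_measureT.

Definition uniform : probability point R := uniform_measure.

(* only meaningful when rho is absolutely continuous; as such it is determined
   almost everywhere *)
Definition density (rho : probability point R) (x : point) : R :=
  fine (('d (charge_of_finite_measure rho) '/d dx) x).

Definition Linfty_dist (rho mu : probability point R) : \bar R :=
  Lnorm dx +oo%E (fun x => (density rho x - density mu x)%:E).

Definition interaction (W : vector -> R) (rho : probability point R)
    (z : point * point) : R :=
  W (vec z.1 - vec z.2) * density rho z.1 * density rho z.2.

(* the energies use densities, as a singular measure has infinite energy *)
Definition free_energy (W : vector -> R) (m beta : R)
    (rho : probability point R) : \bar R :=
  if `[< [/\ rho `<< dx,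
             dx.-integrable setT (fun x => (density rho x `^ m)%:E)
           & (dx \x dx)%E.-integrable setT (EFin \o interaction W rho)] >]
  then (beta^-1 / (m - 1) * (\int[dx]_x (density rho x `^ m))
        - beta^-1 / (m - 1)
        + 2^-1 * \int[(dx \x dx)%E]_z interaction W rho z)%:E
  else +oo%E.

Definition is_minimiser (W : vector -> R) (m beta : R)
    (rho : probability point R) : Prop :=
  is_torus_probability rho /\
  forall mu, is_torus_probability mu ->
    (free_energy W m beta rho <= free_energy W m beta mu)%E.

Definition is_unique_minimiser (W : vector -> R) (m beta : R)
    (rho : probability point R) : Prop :=
  is_minimiser W m beta rho /\
  forall mu, is_minimiser W m beta mu -> same_measure mu rho.

Definition transition_point (W : vector -> R) (m beta_c : R) : Prop :=
  [/\ 0 < beta_c,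
      forall beta, 0 < beta < beta_c -> is_unique_minimiser W m beta uniform,
      is_minimiser W m beta_c uniform
    & forall beta, beta_c < beta ->
        exists2 rho, is_minimiser W m beta rho & ~ same_measure rho uniform].

Definition continuous_transition_point (W : vector -> R) (m beta_c : R) : Prop :=
  [/\ transition_point W m beta_c,
      is_unique_minimiser W m beta_c uniform
    & forall rho : R -> probability point R,
        (forall beta, beta_c < beta -> is_minimiser W m beta (rho beta)) ->
        limf_esup (fun beta => Linfty_dist (rho beta) uniform) beta_c^'+ = 0%E].

Definition discontinuous_transition_point (W : vector -> R) (m beta_c : R) :
    Prop :=
  transition_point W m beta_c /\ ~ continuous_transition_point W m beta_c.

(* the infimum is a minimum as soon as a minimising mode exists *)
Definition beta_sharp (W : vector -> R) (m : R) : R :=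
  - (m * rho_infty `^ (m - 3 / 2) / inf (coef_ratio W @` natural_modes)).

(* |Omega|^(-1/2) Theta(k)^-1 *)
Definition max_amplitude (k : 'rV[int]_d) : R :=
  (L%:num ^+ d) `^ (- 2^-1) * (Theta k)^-1.

(* an honest one-parameter family, i.e. an injective curve, continuous for the
   L^oo distance of the densities *)
Definition one_parameter_family (I : set R) (rho : R -> probability point R) :
    Prop :=
  (forall a b, I a -> I b -> same_measure (rho a) (rho b) -> a = b) /\
  (forall a, I a ->
    Linfty_dist (rho b) (rho a) @[b --> within I (nbhs a)] --> 0%E).

End definitions.

(* Main.v *)
Require Import Defs.
From HB Require Import structures.
From mathcomp Require Import all_boot all_order all_algebra.
From mathcomp Require Import all_classical all_reals all_analysis.
From mathcomp Require Import measurable_realfun ess_sup_inf ring lra zify.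

Import Order.TTheory GRing.Theory Num.Theory.
Import numFieldNormedType.Exports.

Local Open Scope classical_set_scope.
Local Open Scope ring_scope.

Set Implicit Arguments.
Unset Strict Implicit.
Unset Printing Implicit Defensive.

(** Write [eta] for the fluctuation [rho - rho_infty] of a density.  As [W] has
    mean zero, the energy of [rho] differs from that of the uniform state by an
    entropic part, whose second variation is [m rho_infty^(m-2) / (2 beta)] times
    the squared norm of [eta], plus half the quadratic form with kernel
    [W (x - y)] evaluated at [eta].  On zero mean functions this form is at least
    [w] times the squared norm ([kform_Wsub_ge]), where [w < 0] is the integral of
    [W] against the product of cosines of a minimising mode [k], and it equals [w]
    on that mode ([kform_mode]).  Hence the second variation of the energy is
    positive exactly when [beta < beta_sharp] ([lt_beta_sharp]).

    Everything about [W] follows from its uniform approximation by Fejér means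
    ([fejer_mean_approx]), which are the finite sums of its cosine expansion with
    nonnegative weights.  The lower bound of the form is proved for a Fejér
    mean: there it is a combination of the forms attached to the single modes,
    which are sums of squares ([kform_cmode_ge0]); replacing every coefficient
    of [W] by [w] leaves [w] times the form of the Fejér kernel, and that kernel
    is a contraction by the Schur test ([kform_schur]).
    The same approximation shows that modes are
    eigenfunctions of the convolution with [W] ([conv_cmode]), that sine modes
    have zero coefficient ([fourier_coef_sine]) and that coefficients tend to
    zero, so that a minimising mode exists ([exists_minimising_mode]).

    For [2 <= m <= 3] the perturbation [rho_infty + a e_k] has, for small [a], an
    energy which exceeds the uniform one by at most its second variation, because
    the cubic term integrates to zero and the fourth derivative of the power is
    nonpositive ([energy_perturbed_le]).  So the uniform state is not a minimiser
    above [beta_sharp], and at [beta_sharp] it is not the only one.  A transition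
    point [beta_c] is therefore at most [beta_sharp].  If they are equal,
    uniqueness fails at [beta_c].  If [beta_c < beta_sharp], the other minimisers,
    which exist for every [beta > beta_c], cannot converge to the uniform state:
    the positive second variation isolates that state in the uniform norm
    ([minimiser_near_uniform]).  Either way the transition is discontinuous.

    For [m = 2] the energy is exactly its second order expansion.  Below
    [beta_sharp] the uniform state is then the only minimiser, so that
    [beta_c = beta_sharp], and at [beta_sharp] the energy is constant along
    [rho_infty + a e_k] as long as this is a nonnegative function. *)

(** * Bounded measurable functions and bilinear forms *)

Section bounded_measurable.
Context d (T : measurableType d) (R : realType).
Implicit Types f g : T -> R.

Definition bmeas f := measurable_fun setT f /\ exists M : R, forall x, `|f x| <= M.

Lemma bmeas_cst (c : R) : bmeas (fun=> c).
Proof. by split; [exact: measurable_cst|exists `|c|]. Qed.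

Lemma bmeasD f g : bmeas f -> bmeas g -> bmeas (fun x => f x + g x).
Proof.
move=> [mf [M fM]] [mg [N gN]]; split; first exact: measurable_funD.
by exists (M + N) => x; rewrite (le_trans (ler_normD _ _))// lerD.
Qed.

Lemma bmeasM f g : bmeas f -> bmeas g -> bmeas (fun x => f x * g x).
Proof.
move=> [mf [M fM]] [mg [N gN]]; split; first exact: measurable_funM.
by exists (M * N) => x; rewrite normrM ler_pM.
Qed.

Lemma bmeasN f : bmeas f -> bmeas (fun x => - f x).
Proof.
move=> [mf [M fM]]; split; first exact: measurableT_comp.
by exists M => x; rewrite normrN.
Qed.

Lemma bmeasB f g : bmeas f -> bmeas g -> bmeas (fun x => f x - g x).
Proof. by move=> bf bg; apply: bmeasD => //; exact: bmeasN. Qed.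

Lemma bmeasX f n : bmeas f -> bmeas (fun x => f x ^+ n).
Proof.
move=> bf; elim: n => [|n IH]; first exact: bmeas_cst.
by under eq_fun do rewrite exprS; exact: bmeasM.
Qed.

Lemma bmeas_sum (I : Type) (s : seq I) (P : pred I) (F : I -> T -> R) :
  (forall i, bmeas (F i)) -> bmeas (fun x => \sum_(i <- s | P i) F i x).
Proof.
move=> bF; elim: s => [|i s IH].
  by under eq_fun do rewrite big_nil; exact: bmeas_cst.
under eq_fun do rewrite big_cons.
by case: (P i) => //; exact: bmeasD.
Qed.

Lemma bmeas_prod (I : Type) (s : seq I) (P : pred I) (F : I -> T -> R) :
  (forall i, bmeas (F i)) -> bmeas (fun x => \prod_(i <- s | P i) F i x).
Proof.
move=> bF; elim: s => [|i s IH].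
  by under eq_fun do rewrite big_nil; exact: bmeas_cst.
under eq_fun do rewrite big_cons.
by case: (P i) => //; exact: bmeasM.
Qed.

Lemma bmeas_integrable_fin (mu : {measure set T -> \bar R}) f :
  (mu setT < +oo)%E -> bmeas f -> mu.-integrable setT (EFin \o f).
Proof.
move=> muT [mf [M fM]]; apply: measurable_bounded_integrable => //.
exists M; split; [exact: num_real|] => y My x _ /=.
exact: le_trans (fM x) (ltW My).
Qed.

Lemma Rintegral_sum (mu : {measure set T -> \bar R}) (I : Type) (s : seq I) (F : I -> T -> R) :
  (forall i, mu.-integrable setT (EFin \o F i)) ->
  \int[mu]_x (\sum_(i <- s) F i x) = \sum_(i <- s) \int[mu]_x F i x.
Proof.
move=> iF.
suff [] : mu.-integrable setT (EFin \o (fun x => \sum_(i <- s) F i x)) /\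
  \int[mu]_x (\sum_(i <- s) F i x) = \sum_(i <- s) \int[mu]_x F i x by [].
elim: s => [|i s [IHi IHs]].
  rewrite big_nil; under [X in EFin \o X]eq_fun do rewrite big_nil.
  under eq_Rintegral do rewrite big_nil.
  split; first exact: integrable0.
  by rewrite Rintegral_cst// mul0r.
rewrite big_cons; under [X in EFin \o X]eq_fun do rewrite big_cons.
under eq_Rintegral do rewrite big_cons.
split; last by rewrite RintegralD// IHs.
exact: (integrableD measurableT (iF i) IHi).
Qed.

Section finite_measure.
Variable mu : {finite_measure set T -> \bar R}.

Lemma bmeas_integrable f : bmeas f -> mu.-integrable setT (EFin \o f).
Proof.
by apply: bmeas_integrable_fin; rewrite -ge0_fin_numE// fin_num_measure.
Qed.

Lemma bmeas_integrableM f u : bmeas f -> mu.-integrable setT (EFin \o u) ->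
  mu.-integrable setT (EFin \o (fun x => f x * u x)).
Proof.
move=> [mf [M fM]] iu.
have mu' : measurable_fun setT u by apply/measurable_EFinP; exact: measurable_int iu.
apply: (@le_integrable _ _ _ _ _ _ _ (EFin \o (fun x => M * u x))) => //.
- exact/measurable_EFinP/measurable_funM.
- move=> x _ /=; rewrite lee_fin !normrM ler_wpM2r//.
  exact: le_trans (fM x) (ler_norm _).
- exact: (integrableZl measurableT M iu).
Qed.

End finite_measure.
End bounded_measurable.

Lemma bmeas_comp d1 d2 (T1 : measurableType d1) (T2 : measurableType d2)
    (R : realType) (f : T2 -> R) (phi : T1 -> T2) :
  bmeas f -> measurable_fun setT phi -> bmeas (fun x => f (phi x)).
Proof.
move=> [mf [M fM]] mphi; split; first exact: (measurableT_comp mf mphi).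
by exists M.
Qed.

Section bilinear_form.
Context d (T : measurableType d) (R : realType).
Variable mu : {finite_measure set T -> \bar R}.
Implicit Types (B : T * T -> R) (u v : T -> R).

Local Notation "u \in_L1" := (mu.-integrable setT (EFin \o u)) (at level 10).

Definition kform B u v := \int[(mu \x mu)%E]_z (B z * u z.1 * v z.2).

Lemma integrable_measurable u : u \in_L1 -> measurable_fun setT u.
Proof. by move=> iu; apply/measurable_EFinP; exact: measurable_int iu. Qed.

Lemma kform_measurable B u v : bmeas B -> u \in_L1 -> v \in_L1 ->
  measurable_fun setT (fun z => B z * u z.1 * v z.2).
Proof.
move=> [mB _] /integrable_measurable iu /integrable_measurable iv.
apply: measurable_funM; first apply: measurable_funM => //.
  exact: (measurableT_comp iu).
exact: (measurableT_comp iv).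
Qed.

(** By Tonelli, as the integrand is dominated by a multiple of [|u x| * |v y|]. *)
Lemma kform_integrable B u v : bmeas B -> u \in_L1 -> v \in_L1 ->
  (mu \x mu)%E.-integrable setT (EFin \o (fun z => B z * u z.1 * v z.2)).
Proof.
move=> bB iu iv; have mBuv := kform_measurable bB iu iv.
have [mB [M BM]] := bB.
apply/integrable12ltyP; first exact/measurable_EFinP.
have M0 : 0 <= M by apply: le_trans (BM point); exact: normr_ge0.
have := iv => /integrableP[mv vfin]; have := iu => /integrableP[mu' ufin].
have mnv : measurable_fun setT (fun y => `|v y|%:E).
  apply/measurable_EFinP; apply: measurableT_comp => //.
  exact: integrable_measurable iv.
have mnu : measurable_fun setT (fun y => `|u y|%:E).
  apply/measurable_EFinP; apply: measurableT_comp => //.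
  exact: integrable_measurable iu.
apply: (@le_lt_trans _ _ (\int[mu]_x ((M * `|u x|)%:E *
    \int[mu]_y `|(v y)%:E|))%E).
  apply: ge0_le_integral => //=.
  - by move=> x _; exact: integral_ge0.
  - apply: (measurable_fun_fubini_tonelli_F
      (fun z => `|(B z * u z.1 * v z.2)%:E|)%E) => //=.
    by do 2 apply: measurableT_comp => //.
  - apply: emeasurable_funM => //; apply/measurable_EFinP.
    apply: measurable_funM => //; apply: measurableT_comp => //.
    exact: integrable_measurable iu.
  - move=> x _; rewrite -ge0_integralZl//; last by rewrite lee_fin mulr_ge0.
    apply: ge0_le_integral => //=.
    + do 2 apply: measurableT_comp => //; apply: measurable_funM => //.
        apply: measurable_funM => //.
        by apply: (measurableT_comp mB); exact: measurable_pair1.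
      exact: integrable_measurable iv.
    + exact: measurable_funeM.
    + move=> y _; rewrite lee_fin !normrM ler_wpM2r// ler_wpM2r//.
rewrite ge0_integralZr//; last 3 first.
  apply/measurable_EFinP; apply: measurable_funM => //.
  by apply: measurableT_comp => //; exact: integrable_measurable iu.
  by move=> x _; rewrite lee_fin mulr_ge0.
  exact: integral_ge0.
under eq_integral do rewrite EFinM.
rewrite ge0_integralZl//; apply: lte_mul_pinfty => //.
- by rewrite mule_ge0//; exact: integral_ge0.
- by rewrite fin_numM// ge0_fin_numE//; exact: integral_ge0.
Qed.

Lemma section1_integrable B v x : bmeas B -> v \in_L1 ->
  (fun y => B (x, y) * v y) \in_L1.
Proof.
move=> bB iv; apply: (bmeas_integrableM (f := fun y => B (x, y))) => //.
by apply: (bmeas_comp bB); exact: measurable_pair1.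
Qed.

Lemma section2_integrable B u y : bmeas B -> u \in_L1 ->
  (fun x => B (x, y) * u x) \in_L1.
Proof.
move=> bB iu; apply: (bmeas_integrableM (f := fun x => B (x, y))) => //.
by apply: (bmeas_comp bB); exact: measurable_pair2.
Qed.

Lemma kform_Fubini1 B u v : bmeas B -> u \in_L1 -> v \in_L1 ->
  kform B u v = \int[mu]_x (u x * \int[mu]_y (B (x, y) * v y)).
Proof.
move=> bB iu iv; rewrite /kform /Rintegral; congr fine.
rewrite -(integral12_prod_meas1 (kform_integrable bB iu iv)).
apply: eq_integral => x _; rewrite EFinM fineK; last first.
  exact: (integrable_fin_num measurableT (section1_integrable x bB iv)).
rewrite -(integralZl measurableT (section1_integrable x bB iv)).
by apply: eq_integral => y _ /=; rewrite -EFinM; congr EFin; ring.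
Qed.

Lemma kform_Fubini2 B u v : bmeas B -> u \in_L1 -> v \in_L1 ->
  kform B u v = \int[mu]_y (v y * \int[mu]_x (B (x, y) * u x)).
Proof.
move=> bB iu iv; rewrite /kform /Rintegral; congr fine.
rewrite -(integral21_prod_meas1 (kform_integrable bB iu iv)).
apply: eq_integral => y _; rewrite EFinM fineK; last first.
  exact: (integrable_fin_num measurableT (section2_integrable y bB iu)).
rewrite -(integralZl measurableT (section2_integrable y bB iu)).
by apply: eq_integral => x _ /=; rewrite -EFinM; congr EFin; ring.
Qed.

End bilinear_form.

(** * Bilinear forms with a bounded kernel *)

Section kform_theory.
Context d (T : measurableType d) (R : realType).
Variable mu : {finite_measure set T -> \bar R}.
Implicit Types (B : T * T -> R) (u v : T -> R).

Local Notation "u \in_L1" := (mu.-integrable setT (EFin \o u)) (at level 10).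
Local Notation kform := (kform mu).

Lemma kform_sum (I : Type) (s : seq I) (c : I -> R) (B : I -> T * T -> R) u v :
  (forall i, bmeas (B i)) -> u \in_L1 -> v \in_L1 ->
  kform (fun z => \sum_(i <- s) c i * B i z) u v =
  \sum_(i <- s) c i * kform (B i) u v.
Proof.
move=> bB iu iv.
have bcB i : bmeas (fun z => c i * B i z) by apply: bmeasM => //; exact: bmeas_cst.
rewrite /kform; under eq_Rintegral do rewrite !big_distrl/=.
rewrite Rintegral_sum; last first.
  by move=> i; exact: kform_integrable.
apply: eq_bigr => i _; rewrite -RintegralZl//; last exact: kform_integrable.
by apply: eq_Rintegral => z _; ring.
Qed.

Lemma kform_tensor (p q : T -> R) u v :
  bmeas p -> bmeas q -> u \in_L1 -> v \in_L1 ->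
  kform (fun z => p z.1 * q z.2) u v =
  (\int[mu]_x (p x * u x)) * (\int[mu]_x (q x * v x)).
Proof.
move=> bp bq iu iv.
have bpq : bmeas (fun z : T * T => p z.1 * q z.2).
  by apply: bmeasM; [apply: (bmeas_comp bp)|apply: (bmeas_comp bq)].
rewrite kform_Fubini1//= -RintegralZr//; last exact: bmeas_integrableM.
apply: eq_Rintegral => x _.
rewrite [p x * _]mulrC -mulrA; congr (_ * _).
rewrite -RintegralZl//; last exact: bmeas_integrableM.
by apply: eq_Rintegral => y _; ring.
Qed.

Lemma integrable_normL1 u : u \in_L1 -> (fun x => `|u x|) \in_L1.
Proof. exact: integrable_norm. Qed.

Lemma kform_dist B B' u e : bmeas B -> bmeas B' -> u \in_L1 ->
  (forall z, `|B z - B' z| <= e) ->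
  `|kform B u u - kform B' u u| <= e * (\int[mu]_x `|u x|) ^+ 2.
Proof.
move=> bB bB' iu BB'.
have bBB : bmeas (fun z => B z - B' z) by exact: bmeasB.
have -> : kform B u u - kform B' u u = kform (fun z => B z - B' z) u u.
  rewrite /kform -RintegralB//; try exact: kform_integrable.
  by apply: eq_Rintegral => z _; ring.
have inu := integrable_normL1 iu.
have -> : e * (\int[mu]_x `|u x|) ^+ 2 = kform (fun z => e * 1) (fun x => `|u x|) (fun x => `|u x|).
  rewrite (kform_tensor (p := fun=> e) (q := fun=> 1))//; try exact: bmeas_cst.
  rewrite RintegralZl//.
  have -> : \int[mu]_x (1 * `|u x|) = \int[mu]_x `|u x|.
    by apply: eq_Rintegral => x _; rewrite mul1r.
  by rewrite expr2 mulrA.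
apply: (le_trans (le_normr_Rintegral measurableT (kform_integrable bBB iu iu))).
apply: le_Rintegral => //.
- exact: (integrable_norm (kform_integrable bBB iu iu)).
- exact: (kform_integrable (B := fun=> e * 1) (bmeas_cst _ _) inu inu).
- move=> z _; rewrite !normrM mulr1 -!mulrA ler_wpM2r// mulr_ge0//.
Qed.

(** Schur test: [2 u(x) u(y) <= u(x)^2 + u(y)^2], and both squares integrate to the
    squared norm because the marginals of [B] are equal to one. *)
Lemma kform_schur B u : bmeas B -> (forall z, 0 <= B z) ->
  (forall x, \int[mu]_y B (x, y) = 1) -> (forall y, \int[mu]_x B (x, y) = 1) ->
  u \in_L1 -> (fun x => u x ^+ 2) \in_L1 ->
  kform B u u <= \int[mu]_x u x ^+ 2.
Proof.
move=> bB B0 B1 B2 iu iuu.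
have i1 : (fun=> 1) \in_L1 by apply: bmeas_integrable; exact: bmeas_cst.
have -> : \int[mu]_x u x ^+ 2 =
    2^-1 * (kform B (fun x => u x ^+ 2) (fun=> 1) + kform B (fun=> 1) (fun x => u x ^+ 2)).
  rewrite kform_Fubini1// kform_Fubini2//.
  have -> : \int[mu]_x (u x ^+ 2 * \int[mu]_y (B (x, y) * 1)) = \int[mu]_x (u x ^+ 2).
    apply: eq_Rintegral => x _; under eq_Rintegral do rewrite mulr1.
    by rewrite B1 mulr1.
  have -> : \int[mu]_x (u x ^+ 2 * \int[mu]_y (B (y, x) * 1)) = \int[mu]_x (u x ^+ 2).
    apply: eq_Rintegral => x _; under eq_Rintegral do rewrite mulr1.
    by rewrite B2 mulr1.
  by field.
rewrite /kform -(RintegralD measurableT (kform_integrable bB iuu i1)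
  (kform_integrable bB i1 iuu)).
have iBD := integrableD measurableT (kform_integrable bB iuu i1)
  (kform_integrable bB i1 iuu).
rewrite -RintegralZl//.
apply: le_Rintegral => //; first exact: kform_integrable.
  exact: (integrableZl measurableT _ iBD).
move=> [x y] _ /=; rewrite -subr_ge0.
have -> : 2^-1 * (B (x, y) * u x ^+ 2 * 1 + B (x, y) * 1 * u y ^+ 2) -
  B (x, y) * u x * u y = 2^-1 * B (x, y) * (u x - u y) ^+ 2 by field.
by apply: mulr_ge0; [rewrite mulr_ge0|exact: sqr_ge0].
Qed.

(** Constants are in the kernel of the form on both sides. *)
Lemma kform_shift B u (c : R) : bmeas B -> u \in_L1 ->
  (forall x, \int[mu]_y B (x, y) = 0) -> (forall y, \int[mu]_x B (x, y) = 0) ->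
  kform B (fun x => c + u x) (fun x => c + u x) = kform B u u.
Proof.
move=> bB iu B1 B2.
have ic : (fun=> c) \in_L1 by apply: bmeas_integrable; exact: bmeas_cst.
have bc : bmeas (fun _ : T => c) by exact: bmeas_cst.
have icu : (fun x => c + u x) \in_L1 by exact: (integrableD measurableT ic iu).
have -> : kform B (fun x => c + u x) (fun x => c + u x) =
    kform B (fun=> c) (fun x => c + u x) + kform B u (fun=> c) + kform B u u.
  have i1 := kform_integrable bB ic icu; have i2 := kform_integrable bB iu ic.
  have i3 := kform_integrable bB iu iu; have i12 := integrableD measurableT i1 i2.
  rewrite /kform -(RintegralD measurableT i1 i2) -(RintegralD measurableT i12 i3).
  by apply: eq_Rintegral => z _; ring.
have -> : kform B (fun=> c) (fun x => c + u x) = 0.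
  rewrite kform_Fubini2// [LHS](_ : _ = \int[mu]_y (0 : R)).
    by rewrite Rintegral_cst// mul0r.
  apply: eq_Rintegral => y _; rewrite RintegralZr ?B2 ?mul0r ?mulr0//.
  by apply: bmeas_integrable; apply: (bmeas_comp bB).
rewrite kform_Fubini1// [X in _ + X + _](_ : _ = \int[mu]_y (0 : R)).
  by rewrite Rintegral_cst// mul0r !add0r.
apply: eq_Rintegral => y _; rewrite RintegralZr ?B1 ?mul0r ?mulr0//.
by apply: bmeas_integrable; apply: (bmeas_comp bB).
Qed.

End kform_theory.

(** * Integration on the torus *)

Section torus_integral.
Context (R : realType) (L : {posnum R}).

Local Notation side := (side_measure L%:num).

Lemma finite_product_measureT d1 d2 (T1 : measurableType d1)
    (T2 : measurableType d2) (mu : {finite_measure set T1 -> \bar R})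
    (nu : {finite_measure set T2 -> \bar R}) : ((mu \x nu)%E setT < +oo)%E.
Proof.
rewrite -setXTT product_measure1E//.
by rewrite -ge0_fin_numE ?mule_ge0// fin_numM// fin_num_measure.
Qed.

Lemma Rintegral_cons_measure (mu : {finite_measure set R -> \bar R}) n
    (nu : {finite_measure set (n.-tuple R) -> \bar R})
    (f : n.+1.-tuple R -> R) : bmeas f ->
  \int[cons_measure mu nu]_x f x =
  \int[mu]_t \int[nu]_z f (tuple_cons (t, z)).
Proof.
move=> bf; have mf := bf.1; have mc := @measurable_tuple_cons R n.
have bfc : bmeas (fun z => f (tuple_cons z)) by exact: bmeas_comp.
have ifc := bmeas_integrable_fin (finite_product_measureT mu nu) bfc.
rewrite /Rintegral; congr fine.
rewrite integral_pushforward//; last exact/measurable_EFinP.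
rewrite -(integral12_prod_meas1 ifc)//.
apply: eq_integral => t _; rewrite fineK//.
apply: (integrable_fin_num measurableT); apply: bmeas_integrable.
by apply: (bmeas_comp bfc); exact: measurable_pair1.
Qed.

Lemma Rintegral_torus_cst d (c : R) :
  \int[torus_measure L%:num d]_x c = c * L%:num ^+ d.
Proof.
rewrite Rintegral_cst//; congr (_ * _).
have E : torus_measure L%:num d setT = (L%:num ^+ d)%:E by exact: torus_measureT.
exact: (congr1 fine E).
Qed.

(** Integrals of trigonometric modes reduce to dimension one by this factorisation. *)
Lemma Rintegral_torus_prod d (g : 'I_d -> R -> R) :
  (forall i, bmeas (g i)) ->
  \int[torus_measure L%:num d]_x (\prod_i g i (tnth x i)) =
  \prod_i \int[side]_t g i t.
Proof.
elim: d g => [|d IH] g bg.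
  rewrite big_ord0; under eq_Rintegral do rewrite big_ord0.
  by rewrite Rintegral_torus_cst expr0 mulr1.
have bgt n (j : 'I_n -> 'I_d.+1) : bmeas (fun x : n.-tuple R => \prod_i g (j i) (tnth x i)).
  by apply: bmeas_prod => i; apply: (bmeas_comp (bg _)); exact: measurable_tnth.
rewrite big_ord_recl -IH//= Rintegral_cons_measure; last exact: (bgt _ id).
rewrite -RintegralZr//; last exact: bmeas_integrable.
apply: eq_Rintegral => t _.
rewrite -RintegralZl//; last exact: (bmeas_integrable _ (bgt _ (lift ord0))).
apply: eq_Rintegral => z _; rewrite big_ord_recl; congr (_ * _).
by apply: eq_bigr => i _; rewrite /tuple_cons/= tnthS.
Qed.

(** The identity, from the measurable type that carries [lebesgue_measure] to the
    canonical one on [R], along which integrals are transported. *)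
Definition side_incl (t : measurableTypeR R) : R := t.

Lemma measurable_side_incl : measurable_fun setT side_incl.
Proof. by move=> _ A mA; rewrite setTI. Qed.

Lemma Rintegral_side (f : R -> R) : bmeas f ->
  \int[side]_t f t = \int[lebesgue_measure]_(t in `[0, L%:num]) f t.
Proof.
move=> bf.
have mf : measurable_fun setT (f \o side_incl).
  exact: (measurableT_comp bf.1 measurable_side_incl).
have ibL : lebesgue_measure.-integrable `[0, L%:num[ (EFin \o (f \o side_incl)).
  apply: measurable_bounded_integrable => //.
  - by rewrite /= lebesgue_measure_itv/=; case: ifPn => // _; rewrite ltry.
  - exact: measurable_funTS.
  - have [_ [M fM]] := bf; exists M; split; [exact: num_real|] => y My x _ /=.
    exact: le_trans (fM x) (ltW My).
rewrite -Rintegral_itv_bndo_bndc//.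
rewrite /Rintegral; congr fine.
have mI : measurable (`[0, L%:num[%classic : set R) by exact: measurable_itv.
rewrite (negligible_integral (N := ~` `[0, L%:num[%classic))//=; last 3 first.
- exact: measurableC.
- exact: bmeas_integrable.
- by rewrite /side_measure /mrestr setICl measure0.
rewrite setTD setCK.
transitivity (\int[pushforward lebesgue_measure side_incl]_(x in `[0%R, L%:num[) (f x)%:E)%E.
  apply: eq_measure_integral; first exact: measurable_side_incl.
  move=> mphi A mA AI.
  transitivity (lebesgue_measure (A `&` `[0, L%:num[)); first by [].
  by rewrite setIidl.
rewrite integral_pushforward//; first exact: measurable_side_incl.
by apply/measurable_EFinP; exact: bf.1.
Qed.

Definition angle (k : int) (t : R) : R := 2 * pi * k%:~R * t / L%:num.

Lemma angle0 t : angle 0 t = 0.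
Proof. by rewrite /angle mulr0 !mul0r. Qed.

Lemma angleDl k l t : angle (k + l) t = angle k t + angle l t.
Proof. by rewrite /angle intrD; ring. Qed.

Lemma angleNl k t : angle (- k) t = - angle k t.
Proof. by rewrite /angle intrN; ring. Qed.

Lemma angleBl k l t : angle (k - l) t = angle k t - angle l t.
Proof. by rewrite angleDl angleNl. Qed.

Lemma angleDr k s t : angle k (s + t) = angle k s + angle k t.
Proof. by rewrite /angle; ring. Qed.

Lemma angleNr k t : angle k (- t) = - angle k t.
Proof. by rewrite /angle; ring. Qed.

Lemma angleBr k s t : angle k (s - t) = angle k s - angle k t.
Proof. by rewrite angleDr angleNr. Qed.

Lemma cosDint (x : R) (k : int) : cos (x + 2 * pi * k%:~R) = cos x.
Proof.
have E n (y : R) : cos (y + 2 * pi * n%:R) = cos y.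
  elim: n => [|n IH]; first by rewrite mulr0 addr0.
  rewrite -[RHS]IH -[RHS]cosD2pi; congr cos.
  by rewrite -(mulr_natr pi 2) -(natr1 n); ring.
case: k => n; first exact: E.
by rewrite NegzE intrN -(E n.+1); congr cos; rewrite -pmulrn; ring.
Qed.

Lemma sinDint (x : R) (k : int) : sin (x + 2 * pi * k%:~R) = sin x.
Proof. by rewrite -!cosBpihalf addrAC cosDint. Qed.

Lemma bmeas_cos (h : R -> R) : continuous h -> bmeas (fun t => cos (h t)).
Proof.
move=> ch; split; last by exists 1 => t; exact: cos_max.
apply: continuous_measurable_fun => t.
by apply: continuous_comp; [exact: ch|exact: continuous_cos].
Qed.

Lemma bmeas_sin (h : R -> R) : continuous h -> bmeas (fun t => sin (h t)).
Proof.
move=> ch; split; last by exists 1 => t; exact: sin_max.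
apply: continuous_measurable_fun => t.
by apply: continuous_comp; [exact: ch|exact: continuous_sin].
Qed.

Lemma continuous_angle k : continuous (angle k).
Proof. by move=> t; apply: cvgM; [apply: cvgM; [exact: cvg_cst|exact: cvg_id]|exact: cvg_cst]. Qed.

Lemma is_derive_sin_affine (a phi t : R) : a != 0 ->
  is_derive t 1 (fun t => a^-1 * sin (phi + a * t)) (cos (phi + a * t)).
Proof.
move=> a0.
have h1 : is_derive t 1 (fun s => phi + a * s) a.
  have -> : (fun s => phi + a * s) = cst phi + a *: (id : R -> R) by apply/funext.
  apply: (is_derive_eq (is_deriveD (is_derive_cst phi t 1) (is_deriveZ a (is_derive_id t 1)))).
  by rewrite add0r [LHS]mulr1.
have h2 := @is_derive1_comp R sin (fun s => phi + a * s) t (cos (phi + a * t)) a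
  (is_derive_sin _) h1.
have -> : (fun t => a^-1 * sin (phi + a * t)) =
    a^-1 *: (sin \o (fun s => phi + a * s)) by apply/funext.
apply: (is_derive_eq (is_deriveZ _ h2)).
by rewrite /GRing.scale/= mulrCA mulVf// mulr1.
Qed.

Lemma Rintegral_cos (k : int) (phi : R) :
  \int[side]_t cos (phi + angle k t) = if k == 0 then L%:num * cos phi else 0.
Proof.
have ch : continuous (fun t => phi + angle k t).
  by move=> t; apply: cvgD; [exact: cvg_cst|exact: continuous_angle].
rewrite Rintegral_side; last exact: bmeas_cos.
case: eqVneq => [->|k0].
  under eq_Rintegral do rewrite angle0 addr0.
  rewrite Rintegral_cst// mulrC /=; congr (_ * _).
  by rewrite lebesgue_measure_itv/= lte_fin gt0 sube0.
pose a : R := 2 * pi * k%:~R / L%:num.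
have a0 : a != 0.
  have k0R : (k%:~R : R) != 0 by rewrite intr_eq0.
  have p0 : (pi : R) != 0 by rewrite gt_eqF// pi_gt0.
  have L0 : L%:num != 0 by [].
  by rewrite /a !mulf_neq0// invr_neq0.
have aE t : angle k t = a * t by rewrite /angle/a; ring.
have dF t := is_derive_sin_affine phi t a0.
set F := fun t => a^-1 * sin (phi + a * t) in dF.
have cF : continuous F.
  move=> t; apply/differentiable_continuous/derivable1_diffP.
  by have [] := dF t.
rewrite /Rintegral (@continuous_FTC2 _ _ F)//=; last 3 first.
- apply: continuous_subspaceT => t.
  by apply: continuous_comp; [exact: ch|exact: continuous_cos].
- split => [t _| |]; first by have [] := dF t.
  + by apply: cvg_at_right_filter; exact: cF.
  + by apply: cvg_at_left_filter; exact: cF.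
- by move=> t _; rewrite derive1E aE; have [_ ->] := dF t.
rewrite /F mulr0 addr0 (_ : a * L%:num = 2 * pi * k%:~R); last by rewrite /a; field.
by rewrite sinDint subrr.
Qed.

End torus_integral.

(** * The Fejér kernel *)

Section fejer.
Context (R : realType) (L : {posnum R}).
Local Notation side := (side_measure L%:num).
Local Notation angle := (angle L).

Lemma angleM k e t : angle k (e%:~R * t) = angle (k * e) t.
Proof. by rewrite /angle intrM; ring. Qed.

Lemma Rintegral_cos_affine (k e : int) (a : R) : e != 0 ->
  \int[side]_t cos (angle k (a + e%:~R * t)) = if k == 0 then L%:num else 0.
Proof.
move=> e0; under eq_Rintegral do rewrite angleDr angleM.
rewrite Rintegral_cos mulf_eq0 (negbTE e0) orbF.
by case: eqVneq => // ->; rewrite angle0 cos0 mulr1.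
Qed.

Lemma bmeas_cos_affine k (a e : R) : bmeas (fun t => cos (angle k (a + e * t))).
Proof.
apply: bmeas_cos => t; apply: (@continuous_comp _ _ _ (fun t => a + e * t)).
  by apply: cvgD; [exact: cvg_cst|apply: cvgM; [exact: cvg_cst|exact: cvg_id]].
exact: continuous_angle.
Qed.

Section kernel.
Variable N : nat.
Implicit Types p : 'I_N.+1 * 'I_N.+1.

Definition freq p : int := p.1%:Z - p.2%:Z.

Definition fejer_scale : R := (L%:num * N.+1%:R)^-1.

Lemma fejer_scale_gt0 : 0 < fejer_scale.
Proof. by rewrite invr_gt0 mulr_gt0. Qed.

(** The Fejér kernel [|sum_(j <= N) exp (2 i pi j v / L)|^2 / (L (N + 1))], with the
    square expanded: in this form its cosine coefficients are visibly nonnegative. *)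
Definition fejer (v : R) : R := fejer_scale * \sum_p cos (angle (freq p) v).

(** The double sum is a squared modulus, the sum of the squares of its real and
    imaginary parts. *)
Lemma fejer_ge0 v : 0 <= fejer v.
Proof.
rewrite mulr_ge0 ?(ltW fejer_scale_gt0)//.
have -> : \sum_p cos (angle (freq p) v) =
    (\sum_(j < N.+1) cos (angle j%:Z v)) ^+ 2 + (\sum_(j < N.+1) sin (angle j%:Z v)) ^+ 2.
  rewrite !expr2 !big_distrlr/= -big_split/=.
  under [RHS]eq_bigr do rewrite -big_split/=.
  rewrite pair_bigA/=; apply: eq_bigr => p _.
  by rewrite /freq angleBl cosB.
by rewrite addr_ge0 ?sqr_ge0.
Qed.

Lemma sum_ord_eq n m (c : R) :
  \sum_(l < n) (if (l == m :> nat)%N then c else 0) = if (m < n)%N then c else 0.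
Proof.
rewrite -big_mkcond/=; case: ltnP => mn.
  by rewrite (big_pred1 (Ordinal mn))// => i; apply/eqP/eqP => [/val_inj|->//]; exact.
by rewrite big_pred0// => i; apply/negbTE; rewrite neq_ltn (leq_trans (ltn_ord i) mn).
Qed.

Lemma sum_freq_eq0 (c : R) : \sum_p (if freq p == 0 then c else 0) = c *+ N.+1.
Proof.
rewrite -(pair_bigA _ (fun j l => if freq (j, l) == 0 then c else 0))/=.
under eq_bigr => j _.
  rewrite (eq_bigr (fun l : 'I_N.+1 => if (l == j :> nat)%N then c else 0)); last first.
    by move=> l _; rewrite /freq/= subr_eq0 eq_sym eqz_nat.
  rewrite sum_ord_eq ltn_ord; over.
by rewrite sumr_const card_ord.
Qed.

Lemma sum_ord_succ (c : R) :
  \sum_(j < N.+1) (if (j.+1 < N.+1)%N then c else 0) = c *+ N.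
Proof.
rewrite big_ord_recr/= ltnn addr0.
under eq_bigr => j _ do rewrite ltnS ltn_ord.
by rewrite sumr_const card_ord.
Qed.

Lemma sum_freq_eq1 (c : R) : \sum_p (if freq p - 1 == 0 then c else 0) = c *+ N.
Proof.
rewrite -(pair_bigA _ (fun j l => if freq (j, l) - 1 == 0 then c else 0))/=.
rewrite exchange_big/=.
under eq_bigr => l _.
  rewrite (eq_bigr (fun j : 'I_N.+1 => if (j == l.+1 :> nat)%N then c else 0)); last first.
    move=> j _; rewrite /freq/= -addrA -opprD subr_eq0.
    by rewrite addrC -intS eqz_nat.
  rewrite sum_ord_eq; over.
exact: sum_ord_succ.
Qed.

Lemma sum_freq_eqN1 (c : R) : \sum_p (if freq p + 1 == 0 then c else 0) = c *+ N.
Proof.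
rewrite -(pair_bigA _ (fun j l => if freq (j, l) + 1 == 0 then c else 0))/=.
under eq_bigr => j _.
  rewrite (eq_bigr (fun l : 'I_N.+1 => if (l == j.+1 :> nat)%N then c else 0)); last first.
    by move=> l _; rewrite /freq/= addrAC subr_eq0 addrC -intS eq_sym eqz_nat.
  rewrite sum_ord_eq; over.
exact: sum_ord_succ.
Qed.

Lemma bmeas_fejer_affine (a e : R) : bmeas (fun t => fejer (a + e * t)).
Proof.
apply: bmeasM; first exact: bmeas_cst.
by apply: bmeas_sum => p; exact: bmeas_cos_affine.
Qed.

Lemma Rintegral_fejer (a : R) (e : int) : e != 0 ->
  \int[side]_t fejer (a + e%:~R * t) = 1.
Proof.
move=> e0; rewrite /fejer RintegralZl//; last first.
  by apply: bmeas_integrable; apply: bmeas_sum => p; exact: bmeas_cos_affine.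
rewrite Rintegral_sum; last first.
  by move=> p; apply: bmeas_integrable; exact: bmeas_cos_affine.
under eq_bigr do rewrite Rintegral_cos_affine//.
by rewrite sum_freq_eq0 -mulr_natr mulVf// mulf_neq0.
Qed.

(** Of the pairs of frequencies, [N + 1] have difference zero and [N] have
    difference one, so that the first cosine coefficient is [N / (N + 1)]. *)
Lemma Rintegral_fejer_moment (a : R) (e : int) : e != 0 ->
  \int[side]_t (fejer (a + e%:~R * t) * (1 - cos (angle 1 (a + e%:~R * t)))) =
  N.+1%:R^-1.
Proof.
move=> e0.
have bf := bmeas_fejer_affine a e%:~R.
have bc k := bmeas_cos_affine k a e%:~R.
under eq_Rintegral do rewrite mulrBr mulr1.
rewrite RintegralB//; last 2 first.
- exact: bmeas_integrable.
- by apply: bmeas_integrable; exact: bmeasM.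
rewrite Rintegral_fejer//.
have -> : \int[side]_x (fejer (a + e%:~R * x) * cos (angle 1 (a + e%:~R * x))) =
  \int[side]_x ((fejer_scale / 2) * (\sum_p cos (angle (freq p + 1) (a + e%:~R * x))
    + \sum_p cos (angle (freq p - 1) (a + e%:~R * x)))).
  apply: eq_Rintegral => x _; rewrite -big_split/= /fejer -!mulrA; congr (_ * _).
  rewrite big_distrl big_distrr/=; apply: eq_bigr => p _.
  by rewrite (angleDl L (freq p) 1) (angleBl L (freq p) 1) cosD cosB; field.
have bs m : bmeas (fun x : R => \sum_p cos (angle (freq p + m) (a + e%:~R * x))).
  by apply: bmeas_sum => p; exact: bc.
rewrite RintegralZl//; last by apply: bmeas_integrable; exact: bmeasD.
rewrite RintegralD//; try exact: bmeas_integrable.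
rewrite !Rintegral_sum; try by move=> p; exact: bmeas_integrable.
have E m : \sum_p \int[side]_t cos (angle (freq p + m) (a + e%:~R * t)) =
    \sum_p (if freq p + m == 0 then L%:num else 0).
  by apply: eq_bigr => p _; rewrite Rintegral_cos_affine.
rewrite !E sum_freq_eq1 sum_freq_eqN1 -(mulr_natr _ N) /fejer_scale.
have L0 : L%:num != 0 by [].
have N0 : N%:R + 1 != 0 :> R by rewrite natr1.
by rewrite -(natr1 N); field; rewrite L0 N0.
Qed.

(** The mean of [fejer (u - t)] and [fejer (u + t)]: the symmetrisation leaves
    products of cosines only. *)
Definition fejer_even (u t : R) : R :=
  fejer_scale * \sum_p cos (angle (freq p) u) * cos (angle (freq p) t).

Lemma fejer_evenE u t :
  fejer_even u t = 2^-1 * (fejer (u + (-1)%:~R * t) + fejer (u + 1%:~R * t)).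
Proof.
rewrite /fejer -mulrDr mulrCA; congr (_ * _).
rewrite -big_split big_distrr/=; apply: eq_bigr => p _.
rewrite !angleDr !angleM mulrN mulr1 angleNl cosB cosD; by field.
Qed.

Lemma fejer_even_ge0 u t : 0 <= fejer_even u t.
Proof. by rewrite fejer_evenE mulr_ge0// addr_ge0// fejer_ge0. Qed.

Lemma bmeas_cosk k : bmeas (fun t => cos (angle k t)).
Proof. by apply: bmeas_cos; exact: continuous_angle. Qed.

Lemma bmeas_fejer_even u : bmeas (fejer_even u).
Proof.
apply: bmeasM; first exact: bmeas_cst.
by apply: bmeas_sum => p; apply: bmeasM; [exact: bmeas_cst|exact: bmeas_cosk].
Qed.

Lemma Rintegral_fejer_even u : \int[side]_t fejer_even u t = 1.
Proof.
under eq_Rintegral do rewrite fejer_evenE.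
have b e := bmeas_fejer_affine u e.
rewrite RintegralZl//; last by apply: bmeas_integrable; exact: bmeasD.
rewrite RintegralD//; try exact: bmeas_integrable.
by rewrite !Rintegral_fejer//; field.
Qed.

(** By [(cos t - cos u)^2 <= 2 (1 - cos (u -+ t))] this reduces to the first moments of
    the Fejér kernel around [u] and [- u]. *)
Lemma Rintegral_fejer_even_moment u :
  \int[side]_t ((cos (angle 1 t) - cos (angle 1 u)) ^+ 2 * fejer_even u t) <=
  2 * N.+1%:R^-1.
Proof.
have b e := bmeas_fejer_affine u e.
have bc e := bmeas_cos_affine 1 u e.
have b1 (e : R) : bmeas (fun t : R => fejer (u + e * t) * (1 - cos (angle 1 (u + e * t)))).
  by apply: bmeasM => //; apply: bmeasB => //; exact: bmeas_cst.
rewrite mulr2n mulrDl mul1r.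
rewrite -{1}(Rintegral_fejer_moment u (e := -1))// -(Rintegral_fejer_moment u (e := 1))//.
rewrite -RintegralD//; try exact: bmeas_integrable.
apply: le_Rintegral => //.
- apply: bmeas_integrable; apply: bmeasM; last exact: bmeas_fejer_even.
  by apply: bmeasX; apply: bmeasB; [exact: bmeas_cosk|exact: bmeas_cst].
- by apply: bmeas_integrable; exact: bmeasD.
move=> t _; rewrite fejer_evenE.
have H (x y : R) : (cos y - cos x) ^+ 2 <= 2 * (1 - cos (x - y)).
  rewrite -subr_ge0 cosB.
  have -> : 2 * (1 - (cos x * cos y + sin x * sin y)) - (cos y - cos x) ^+ 2 =
     (sin x - sin y) ^+ 2 + (1 - (cos x ^+ 2 + sin x ^+ 2)) + (1 - (cos y ^+ 2 + sin y ^+ 2)) by ring.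
  by rewrite !cos2Dsin2 !subrr !addr0 sqr_ge0.
have h1 : (cos (angle 1 t) - cos (angle 1 u)) ^+ 2 <=
    2 * (1 - cos (angle 1 (u + (-1)%:~R * t))).
  by rewrite angleDr angleM mulrN mulr1 angleNl; exact: H.
have h2 : (cos (angle 1 t) - cos (angle 1 u)) ^+ 2 <=
    2 * (1 - cos (angle 1 (u + 1%:~R * t))).
  have := H (angle 1 u) (- angle 1 t).
  by rewrite cosN opprK angleDr angleM mulr1.
have := ler_wpM2r (fejer_ge0 (u + (-1)%:~R * t)) h1.
have := ler_wpM2r (fejer_ge0 (u + 1%:~R * t)) h2.
lra.
Qed.

End kernel.
End fejer.

(** * Even periodic continuous functions *)

Section continuous_on_tuples.
Context (R : realType) (d : nat).
Implicit Types (W : 'rV[R]_d -> R) (x : d.-tuple R).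

Definition grid_point (n : nat) (k : 'rV[int]_d) : 'rV[R]_d :=
  \row_i ((k ord0 i)%:~R / n.+1%:R).

Definition grid_index (n : nat) x : 'rV[int]_d :=
  \row_i Num.floor (n.+1%:R * tnth x i).

Lemma measurable_grid_cell n k : measurable [set x | grid_index n x = k].
Proof.
pose B i : set (d.-tuple R) := (@tnth d R)^~ i @^-1`
  `[(k ord0 i)%:~R / n.+1%:R, (k ord0 i + 1)%:~R / n.+1%:R[%classic.
have mB i : measurable (B i).
  by rewrite /B -[X in measurable X]setTI; exact: measurable_tnth.
rewrite (_ : [set x | _] = \bigcap_(i in [set: 'I_d]) B i).
  by apply: fin_bigcap_measurable => // i _; exact: mB.
apply/seteqP; split => x /=.
  move=> xk i _; rewrite /B/= in_itv/= -xk mxE.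
  by rewrite ler_pdivrMr// ltr_pdivlMr// mulrC floor_itv.
move=> xB; apply/rowP => i; rewrite mxE; apply/eqP; rewrite floor_eq.
have /= := xB i I; rewrite /B/= in_itv/=.
by rewrite ler_pdivrMr// ltr_pdivlMr// mulrC.
Qed.

(** Rounding down to the grid of mesh [1 / (n + 1)] turns a continuous function into
    a function with countably many values, on measurable cells. *)
Lemma measurable_continuous_vec W : continuous W ->
  measurable_fun setT (fun x : d.-tuple R => W (vec x)).
Proof.
move=> cW.
apply: (measurable_fun_cvg (h := fun n x => W (grid_point n (grid_index n x)))).
  move=> n _ A mA; rewrite setTI.
  rewrite (_ : _ @^-1` _ = \bigcup_(k in [set: 'rV[int]_d])
    (if `[< A (W (grid_point n k)) >] then [set x | grid_index n x = k] else set0)).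
    apply: countable_bigcupT_measurable => [|k]; first exact: countableP.
    by case: ifP => _; [exact: measurable_grid_cell|exact: measurable0].
  apply/seteqP; split => x /=.
    by move=> AW; exists (grid_index n x) => //; rewrite asboolT.
  by move=> [k _]; case: ifPn => // /asboolP Ak /= ->.
move=> x _; apply: cvg_comp; last exact: cW.
apply/cvg_ballP => e e0; near=> n; split => // i j.
rewrite (ord1 i) /ball/= !mxE.
have n0 : 0 < n.+1%:R :> R by [].
have /andP[] := floor_itv (n.+1%:R * tnth x j); rewrite intrD => k1 k2.
have k3 : 0 <= tnth x j - (Num.floor (n.+1%:R * tnth x j))%:~R / n.+1%:R.
  by rewrite subr_ge0 ler_pdivrMr// [leRHS]mulrC.
rewrite ger0_norm// (@le_lt_trans _ _ n.+1%:R^-1)//; last first.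
  by near: n; exact: (near_infty_natSinv_lt (PosNum e0)).
by rewrite lerBlDr -[X in X + _]mul1r -mulrDl ler_pdivlMr// [leLHS]mulrC addrC ltW.
Unshelve. all: by end_near. Qed.

Lemma measurable_tuple_sub :
  measurable_fun setT (fun z : d.-tuple R * d.-tuple R =>
    [tuple tnth z.1 i - tnth z.2 i | i < d]).
Proof.
apply/measurable_fun_tnthP => i.
rewrite (_ : _ \o _ = fun z => tnth z.1 i - tnth z.2 i); last first.
  by apply/funext => z /=; rewrite tnth_mktuple.
apply: measurable_funB.
  exact: (measurableT_comp (measurable_tnth i)).
exact: (measurableT_comp (measurable_tnth i)).
Qed.

Lemma vec_sub (x y : d.-tuple R) :
  vec [tuple tnth x i - tnth y i | i < d] = vec x - vec y.
Proof. by apply/rowP => i; rewrite !mxE tnth_mktuple. Qed.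

End continuous_on_tuples.

Section periodic_even.
Context (R : realType) (L : {posnum R}) (d : nat) (W : 'rV[R]_d -> R).
Hypothesis W_per : periodic_along_axes L W.
Hypothesis W_even : even_along_axes W.
Hypothesis W_cont : continuous W.

Lemma periodic_int (k : int) i x : W (x + (k%:~R * L%:num) *: Defs.basis R i) = W x.
Proof.
have E n y : W (y + (n%:R * L%:num) *: Defs.basis R i) = W y.
  elim: n => [|n IH]; first by rewrite mul0r scale0r addr0.
  by rewrite -natr1 mulrDl mul1r scalerDl addrA W_per.
case: k => n; first exact: E.
rewrite NegzE intrN -(E n.+1); congr W.
by rewrite -pmulrn mulNr scaleNr subrK.
Qed.

(** The coordinates are changed one at a time. *)
Lemma even_periodic_eq (x y : 'rV[R]_d) :
  (forall i, exists (s : bool) (k : int),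
     y ord0 i = (-1) ^+ s * x ord0 i + k%:~R * L%:num) -> W y = W x.
Proof.
move=> xy; (* h n takes its first n coordinates from y and the other ones from x *)
pose h (n : nat) : 'rV[R]_d := \row_(i < d) if (i < n)%N then y ord0 i else x ord0 i.
have h0 : h 0%N = x by apply/rowP => i; rewrite mxE.
have hd : h d = y by apply/rowP => i; rewrite mxE ltn_ord.
rewrite -hd -[in RHS]h0.
suff : forall n, (n <= d)%N -> W (h n) = W (h 0%N) by exact.
elim=> // n IH nd; rewrite -IH ?(ltnW nd)//.
pose i := Ordinal nd; have [s [k yi]] := xy i.
pose v := if s then flip i (h n) else h n.
have -> : h n.+1 = v + (k%:~R * L%:num) *: Defs.basis R i.
  apply/rowP => j; rewrite !mxE eqxx/= /v.
  have [->|ji] := eqVneq j i.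
    rewrite ltnSn mulr1 yi; congr (_ + _).
    by case: (s); rewrite !mxE ?eqxx ltnn ?expr1 ?mulN1r ?expr0 ?mul1r.
  have jn : (j < n.+1)%N = (j < n)%N.
    by rewrite ltnS leq_eqVlt; case: eqVneq => // jn; case/eqP: ji; exact/val_inj.
  by rewrite jn mulr0 addr0; case: (s); rewrite !mxE// (negbTE ji).
by rewrite periodic_int /v; case: (s) => //; exact: W_even.
Qed.

(** The point of [[0, L / 2]] equal to [t] up to sign and period. *)
Definition fold_angle (t : R) : R :=
  let f := t - (Num.floor (t / L%:num))%:~R * L%:num in
  if f <= L%:num / 2 then f else L%:num - f.

Lemma fold_angleP t : 0 <= fold_angle t <= L%:num / 2 /\
  exists (s : bool) (k : int), fold_angle t = (-1) ^+ s * t + k%:~R * L%:num.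
Proof.
have L0 : 0 < L%:num by [].
rewrite /fold_angle; set k := Num.floor _.
have /andP[] := floor_itv (t / L%:num); rewrite -/k intrD => k1 k2.
have f0 : 0 <= t - k%:~R * L%:num by rewrite subr_ge0 -ler_pdivlMr.
have f1 : t - k%:~R * L%:num < L%:num.
  by move: k2; rewrite ltr_pdivrMr// mulrDl mul1r ltrBlDl.
case: ifPn => [h|]; last rewrite -ltNge => h.
  by split; [rewrite f0|exists false, (- k); rewrite expr0 mul1r intrN mulNr].
split; first by apply/andP; split; lra.
by exists true, (k + 1); rewrite expr1 intrD; ring.
Qed.

Definition fold_point (x : 'rV[R]_d) : 'rV[R]_d := \row_i fold_angle (x ord0 i).

Lemma fold_pointE x : W (fold_point x) = W x.
Proof.
apply: even_periodic_eq => i; rewrite mxE.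
exact: (fold_angleP _).2.
Qed.

Lemma cos_fold_angle t : cos (angle L 1 (fold_angle t)) = cos (angle L 1 t).
Proof.
have [_ [s [k ->]]] := fold_angleP t.
rewrite angleDr.
have -> : angle L 1 (k%:~R * L%:num) = 2 * pi * k%:~R.
  have L0 : L%:num != 0 by [].
  by rewrite /angle; field.
rewrite cosDint; case: s; last by rewrite expr0 mul1r.
by rewrite expr1 mulN1r angleNr cosN.
Qed.

Let H : set 'rV[R]_d := [set v | forall i, `[0, L%:num / 2]%classic (v ord0 i)].

Let compactH : compact H.
Proof.
apply: (@rV_compact _ _ (fun=> `[0, L%:num / 2]%classic)) => i.
exact: segment_compact.
Qed.

Let fold_pointH x : H (fold_point x).
Proof. by move=> i /=; rewrite mxE in_itv/=; have [] := fold_angleP (x ord0 i). Qed.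

Lemma even_periodic_bounded : exists M : R, forall x, `|W x| <= M.
Proof.
have : compact (W @` H).
  by apply: continuous_compact => //; exact: continuous_subspaceT.
move/compact_bounded => [M [_ HM]]; exists (M + 1) => x.
rewrite -fold_pointE; apply: (HM (M + 1)); first by rewrite ltrDl.
by exists (fold_point x).
Qed.

Lemma bmeas_W : bmeas (fun x : d.-tuple R => W (vec x)).
Proof.
split; first exact: measurable_continuous_vec.
by have [M HM] := even_periodic_bounded; exists M.
Qed.

Definition cos_dist (x y : 'rV[R]_d) : R :=
  \sum_i (cos (angle L 1 (x ord0 i)) - cos (angle L 1 (y ord0 i))) ^+ 2.

Lemma cos_dist_ge0 x y : 0 <= cos_dist x y.
Proof. by apply: sumr_ge0 => i _; exact: sqr_ge0. Qed.

(** An even periodic function depends on each coordinate through its cosine only.  On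
    the half period the cosine is injective, so that by compactness the squared
    distance of cosines controls the oscillation of the function. *)
Lemma cos_modulus (e : R) : 0 < e -> exists2 C, 0 <= C &
  forall x y, `|W x - W y| <= e + C * cos_dist x y.
Proof.
move=> e0; have [M WM] := even_periodic_bounded.
have M0 : 0 <= M by apply: le_trans (WM 0); exact: normr_ge0.
suff [C C0 HC] : exists2 C, 0 <= C &
    forall x y, H x -> H y -> `|W x - W y| <= e + C * cos_dist x y.
  exists C => // x y; rewrite -(fold_pointE x) -(fold_pointE y).
  apply: (le_trans (HC _ _ (fold_pointH x) (fold_pointH y))).
  rewrite lerD2l ler_wpM2l//; apply: ler_sum => i _.
  by rewrite !mxE !cos_fold_angle.
pose P : topologicalType := ('rV[R]_d * 'rV[R]_d)%type.
have cW (p : P -> 'rV[R]_d) : continuous p -> continuous (W \o p).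
  by move=> cp z; apply: continuous_comp; [exact: cp|exact: W_cont].
have ccos (p : P -> 'rV[R]_d) i : continuous p ->
    continuous (fun z : P => cos (angle L 1 (p z ord0 i))).
  move=> cp z.
  apply: (@continuous_comp _ _ _ (fun z : P => angle L 1 (p z ord0 i)) cos);
    last exact: continuous_cos.
  apply: (@continuous_comp _ _ _ (fun z : P => p z ord0 i) (angle L 1));
    last exact: continuous_angle.
  apply: (@continuous_comp _ _ _ p (fun v : 'rV[R]_d => v ord0 i)); first exact: cp.
  exact: coord_continuous.
have c1 : continuous (fst : P -> 'rV[R]_d) by move=> z; exact: cvg_fst.
have c2 : continuous (snd : P -> 'rV[R]_d) by move=> z; exact: cvg_snd.
have cdiff : continuous (fun z : P => `|W z.1 - W z.2|).
  by move=> z; apply: cvg_norm; apply: cvgB; [exact: (cW fst)|exact: (cW snd)].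
have cdist : continuous (fun z : P => cos_dist z.1 z.2).
  pose F (i : 'I_d) (z : P) : R := (cos (angle L 1 (z.1 ord0 i)) - cos (angle L 1 (z.2 ord0 i))) ^+ 2.
  have cF i : true -> continuous (F i).
    move=> _ z; apply: cvgM; apply: cvgB; [exact: (ccos fst)|exact: (ccos snd)|exact: (ccos fst)|exact: (ccos snd)].
  have C := @continuous_big R 'I_d +%R 0 xpredT (@add_continuous R) P (index_enum _) F cF.
  exact: C.
(* where the oscillation is at least e, a compact set avoiding the diagonal *)
pose K : set P := (H `*` H) `&` (fun z : P => `|W z.1 - W z.2|) @^-1` [set t | e <= t].
have cK : compact K.
  apply: compact_closedI; first exact: compact_setX.
  by apply: preimage_closed; [move=> z _; exact: cdiff|exact: closed_ge].
have [[z0 Kz0]|noK] := pselect (K !=set0); last first.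
  exists 0 => // x y Hx Hy; rewrite mul0r addr0 leNgt; apply/negP => xy.
  by apply: noK; exists (x, y); split => //=; exact: ltW.
have [c cinK minc] : exists2 c, c \in K & forall t, t \in K -> cos_dist c.1 c.2 <= cos_dist t.1 t.2.
  apply: (@compact_EVT_min P R (fun z => cos_dist z.1 z.2)) => //; first by exists z0.
  exact: continuous_subspaceT.
have D0 : 0 < cos_dist c.1 c.2.
  rewrite lt_neqAle cos_dist_ge0 andbT eq_sym; apply/negP => /eqP.
  move/eqP; rewrite psumr_eq0; last by move=> i _; exact: sqr_ge0.
  move/allP => eq0; move: cinK; rewrite inE => -[[Hc1 Hc2]] /=.
  suff -> : c.1 = c.2 by rewrite subrr normr0 leNgt e0.
  apply/rowP => i; have := eq0 i; rewrite mem_index_enum => /(_ isT)/=.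
  rewrite sqrf_eq0 subr_eq0 => /eqP/cos_inj cc.
  have hI (v : 'rV[R]_d) : H v -> angle L 1 (v ord0 i) \in `[0, pi]%R.
    move=> /(_ i)/=; rewrite !in_itv/= => /andP[v0 v1].
    rewrite /angle mulr1 divr_ge0 ?mulr_ge0 ?pi_ge0//=.
    by rewrite ler_pdivrMr//; have := pi_gt0 R; nra.
  have := cc (hI _ Hc1) (hI _ Hc2); rewrite /angle mulr1 => /divIf L0.
  have : 2 * pi != 0 :> R by rewrite mulf_neq0// gt_eqF// pi_gt0.
  by move/mulfI; apply; apply: L0.
exists (2 * M / cos_dist c.1 c.2); first by rewrite divr_ge0 ?mulr_ge0// ltW.
move=> x y Hx Hy.
have [xy|xy] := leP e `|W x - W y|; last first.
  rewrite (le_trans (ltW xy))// lerDl mulr_ge0 ?cos_dist_ge0//.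
  by rewrite divr_ge0 ?mulr_ge0// ltW.
have cxy : cos_dist c.1 c.2 <= cos_dist x y.
  by apply: (minc (x, y)); rewrite inE; split.
apply: (@le_trans _ _ (2 * M)).
  by rewrite mulr2n mulrDl mul1r (le_trans (ler_normB _ _))// lerD.
have q1 : 1 <= (cos_dist c.1 c.2)^-1 * cos_dist x y by rewrite ler_pdivlMl// mulr1.
rewrite -[leLHS]add0r lerD ?(ltW e0)// -(mulrA (2 * M)).
by rewrite ler_peMr// mulr_ge0.
Qed.

End periodic_even.

(** * Convolution and orthogonality of cosine modes *)

Section cosine_modes.
Context (R : realType) (L : {posnum R}) (d : nat).
Local Notation side := (side_measure L%:num).
Local Notation dx := (torus_measure L%:num d).
Local Notation angle := (angle L).
Local Notation point := (d.-tuple R).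
Implicit Types (k l : 'rV[int]_d) (v : 'rV[R]_d) (x y : point).

Definition cmode k v : R := \prod_(i < d) cos (angle (k ord0 i) (v ord0 i)).

Lemma bmeas_coord (h : 'I_d -> R -> R) : (forall i, bmeas (h i)) ->
  bmeas (fun x : point => \prod_(i < d) h i (tnth x i)).
Proof.
move=> bh; apply: bmeas_prod => i; apply: (bmeas_comp (bh i)).
exact: measurable_tnth.
Qed.

Lemma cmode_vec k x : cmode k (vec x) = \prod_(i < d) cos (angle (k ord0 i) (tnth x i)).
Proof. by apply: eq_bigr => i _; rewrite mxE. Qed.

Lemma cmode_sub k x y : cmode k (vec x - vec y) =
  \prod_(i < d) cos (angle (k ord0 i) (tnth x i - tnth y i)).
Proof. by apply: eq_bigr => i _; rewrite !mxE. Qed.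

Lemma cmode_le1 k v : `|cmode k v| <= 1.
Proof.
rewrite normr_prod; apply: prodr_ile1 => i _; rewrite normr_ge0/=; exact: cos_max.
Qed.

Lemma bmeas_cmode k : bmeas (fun x : point => cmode k (vec x)).
Proof.
under eq_fun do rewrite cmode_vec.
by apply: (bmeas_coord (h := fun i t => cos (angle (k ord0 i) t))) => i; exact: bmeas_cosk.
Qed.

Lemma bmeas_cmode_sub k : bmeas (fun z : point * point => cmode k (vec z.1 - vec z.2)).
Proof.
under eq_fun do rewrite -vec_sub.
by apply: (bmeas_comp (bmeas_cmode k)); exact: measurable_tuple_sub.
Qed.

Lemma Rintegral_cos_cos (k l : int) :
  \int[side]_t (cos (angle l t) * cos (angle k t)) =
  L%:num / 2 * ((l + k == 0)%:R + (l - k == 0)%:R).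
Proof.
have b m : bmeas (fun t => cos (angle m t)) by exact: bmeas_cosk.
have -> : \int[side]_t (cos (angle l t) * cos (angle k t)) =
    \int[side]_t (2^-1 * (cos (angle (l + k) t) + cos (angle (l - k) t))).
  by apply: eq_Rintegral => t _; rewrite angleDl angleBl cosD cosB; field.
have E m : \int[side]_t cos (angle m t) = L%:num * (m == 0)%:R.
  have := Rintegral_cos L m 0; under eq_Rintegral do rewrite add0r.
  by move=> ->; rewrite cos0; case: eqP => _; rewrite ?mulr1 ?mulr0.
rewrite RintegralZl//; last by apply: bmeas_integrable; exact: bmeasD.
rewrite RintegralD//; try exact: bmeas_integrable.
by rewrite !E; field.
Qed.

(** Only [l = k] and [l = - k] contribute, where the factor [cos (l s)] left by the
    product formula is [cos (k s)]. *)
Lemma Rintegral_cos_conv (k l : int) (s : R) :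
  \int[side]_t (cos (angle l (s - t)) * cos (angle k t)) =
  cos (angle k s) * \int[side]_t (cos (angle l t) * cos (angle k t)).
Proof.
rewrite Rintegral_cos_cos.
have -> : \int[side]_t (cos (angle l (s - t)) * cos (angle k t)) =
    \int[side]_t (2^-1 * (cos (angle l s + angle (- (l + k)) t) +
                          cos (angle l s + angle (- (l - k)) t))).
  apply: eq_Rintegral => t _; rewrite !angleNl angleBr angleDl angleBl.
  set a := angle l s - angle l t.
  have -> : angle l s - (angle l t - angle k t) = a + angle k t by rewrite /a; ring.
  have -> : angle l s - (angle l t + angle k t) = a - angle k t by rewrite /a; ring.
  by rewrite cosB cosD; field.
have b m : bmeas (fun t => cos (angle l s + angle m t)).
  apply: bmeas_cos => t; apply: cvgD; [exact: cvg_cst|exact: continuous_angle].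
rewrite RintegralZl//; last by apply: bmeas_integrable; exact: bmeasD.
rewrite RintegralD//; try exact: bmeas_integrable.
rewrite !Rintegral_cos !oppr_eq0.
case: (eqVneq (l + k) 0) => [lk|_]; case: (eqVneq (l - k) 0) => [lk'|_].
- have -> : l = k by apply/eqP; rewrite -subr_eq0 lk'.
  by rewrite /= ?mulr0n; field.
- have -> : l = - k by apply/eqP; rewrite -addr_eq0 lk.
  by rewrite angleNl cosN /= ?mulr0n; field.
- have -> : l = k by apply/eqP; rewrite -subr_eq0 lk'.
  by rewrite /= ?mulr0n; field.
- by rewrite /= !addr0 !mulr0.
Qed.

Lemma Rintegral_cos_sin (k l : int) :
  \int[side]_t (cos (angle l t) * sin (angle k t)) = 0.
Proof.
have -> : \int[side]_t (cos (angle l t) * sin (angle k t)) =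
    \int[side]_t (2^-1 * (cos (- (pi / 2) + angle (l + k) t) + cos (pi / 2 + angle (l - k) t))).
  apply: eq_Rintegral => t _.
  rewrite [_ + angle (l + k) t]addrC cosBpihalf [pi / 2 + _]addrC cosDpihalf.
  by rewrite angleDl angleBl sinD sinB; field.
have b m (a : R) : bmeas (fun t => cos (a + angle m t)).
  apply: bmeas_cos => t; apply: cvgD; [exact: cvg_cst|exact: continuous_angle].
rewrite RintegralZl//; last by apply: bmeas_integrable; exact: bmeasD.
rewrite RintegralD//; try exact: bmeas_integrable.
rewrite !Rintegral_cos cosN cos_pihalf mulr0.
by do 2 case: ifP => _; rewrite addr0 mulr0.
Qed.

Lemma Rintegral_cmode_conv k l x :
  \int[dx]_y (cmode l (vec x - vec y) * cmode k (vec y)) =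
  cmode k (vec x) * \int[dx]_y (cmode l (vec y) * cmode k (vec y)).
Proof.
under eq_Rintegral do rewrite cmode_sub cmode_vec -big_split/=.
under [in RHS]eq_Rintegral do rewrite !cmode_vec -big_split/=.
have b (c : R) (e : R) m : bmeas (fun t => cos (angle m (c + e * t))) by exact: bmeas_cos_affine.
rewrite (Rintegral_torus_prod L (g := fun i t =>
  cos (angle (l ord0 i) (tnth x i - t)) * cos (angle (k ord0 i) t))); last first.
  move=> i; apply: bmeasM; last exact: bmeas_cosk.
  by under eq_fun do rewrite -mulN1r; exact: b.
rewrite (Rintegral_torus_prod L (g := fun i t =>
  cos (angle (l ord0 i) t) * cos (angle (k ord0 i) t))); last first.
  by move=> i; apply: bmeasM; exact: bmeas_cosk.
rewrite cmode_vec -big_split/=; apply: eq_bigr => i _.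
exact: Rintegral_cos_conv.
Qed.

Lemma cmode_orthogonal k l i :
  `|k ord0 i| != `|l ord0 i| ->
  \int[dx]_y (cmode l (vec y) * cmode k (vec y)) = 0.
Proof.
move=> kl; under eq_Rintegral do rewrite !cmode_vec -big_split/=.
rewrite (Rintegral_torus_prod L (g := fun i t =>
  cos (angle (l ord0 i) t) * cos (angle (k ord0 i) t))); last first.
  by move=> j; apply: bmeasM; exact: bmeas_cosk.
rewrite (bigD1 i)//= Rintegral_cos_cos.
have /negbTE -> : l ord0 i + k ord0 i != 0.
  by apply: contra kl; rewrite addr_eq0 => /eqP ->; rewrite normrN.
have /negbTE -> : l ord0 i - k ord0 i != 0.
  by apply: contra kl; rewrite subr_eq0 => /eqP ->.
by rewrite addr0 mulr0 mul0r.
Qed.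

End cosine_modes.

(** * Uniform approximation by Fejér means *)

Section approximation.
Context (R : realType) (L : {posnum R}) (d : nat) (W : 'rV[R]_d -> R).
Hypothesis W_per : periodic_along_axes L W.
Hypothesis W_even : even_along_axes W.
Hypothesis W_cont : continuous W.
Local Notation side := (side_measure L%:num).
Local Notation dx := (torus_measure L%:num d).
Local Notation angle := (angle L).
Local Notation point := (d.-tuple R).
Local Notation cmode := (cmode L).
Implicit Types (k l : 'rV[int]_d) (u v : 'rV[R]_d) (x y z : point).

Definition cos_coef k : R := \int[dx]_z (W (vec z) * cmode k (vec z)).

Section order.
Variable N : nat.

Definition mode_index := {ffun 'I_d -> 'I_N.+1 * 'I_N.+1}.

(** Absolute values make the mode natural, without changing its cosines. *)
Definition index_mode (f : mode_index) : 'rV[int]_d :=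
  \row_i `|freq (f i)|.

Definition fejer_weight : R := fejer_scale L N ^+ d.

Lemma fejer_weight_gt0 : 0 < fejer_weight.
Proof. by rewrite exprn_gt0// fejer_scale_gt0. Qed.

(** The average of [W] against the product of even Fejér kernels ([fejer_meanE]),
    expanded in cosine modes. *)
Definition fejer_mean u : R :=
  \sum_(f : mode_index) fejer_weight * cos_coef (index_mode f) * cmode (index_mode f) u.

Lemma cos_angle_abs (k : int) t : cos (angle `|k| t) = cos (angle k t).
Proof. by case: (intP k) => [|n|n]//; rewrite ?normr0// normrN angleNl cosN. Qed.

Lemma prod_fejer_even u v :
  \prod_(i < d) fejer_even L N (u ord0 i) (v ord0 i) =
  \sum_(f : mode_index) fejer_weight * cmode (index_mode f) u * cmode (index_mode f) v.
Proof.
rewrite /fejer_even big_split/= prodr_const card_ord -/fejer_weight.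
rewrite bigA_distr_bigA big_distrr/=; apply: eq_bigr => f _.
rewrite big_split/= mulrA; congr (_ * _ * _).
  by apply: eq_bigr => i _; rewrite mxE cos_angle_abs.
by apply: eq_bigr => i _; rewrite mxE cos_angle_abs.
Qed.

Lemma prod_fejer v :
  \prod_(i < d) fejer L N (v ord0 i) =
  \sum_(f : mode_index) fejer_weight * cmode (index_mode f) v.
Proof.
rewrite /fejer big_split/= prodr_const card_ord -/fejer_weight.
rewrite bigA_distr_bigA big_distrr/=; apply: eq_bigr => f _; congr (_ * _).
by apply: eq_bigr => i _; rewrite mxE cos_angle_abs.
Qed.

Let bW := bmeas_W W_per W_even W_cont.

Lemma fejer_meanE u : fejer_mean u =
  \int[dx]_z (W (vec z) * \prod_(i < d) fejer_even L N (u ord0 i) (tnth z i)).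
Proof.
have E z : W (vec z) * \prod_(i < d) fejer_even L N (u ord0 i) (tnth z i) =
    \sum_(f : mode_index) fejer_weight * cmode (index_mode f) u *
      (W (vec z) * cmode (index_mode f) (vec z)).
  have -> : \prod_(i < d) fejer_even L N (u ord0 i) (tnth z i) =
    \prod_(i < d) fejer_even L N (u ord0 i) (vec z ord0 i).
    by apply: eq_bigr => i _; rewrite mxE.
  by rewrite prod_fejer_even big_distrr/=; apply: eq_bigr => f _; ring.
under eq_Rintegral do rewrite E.
have b f : bmeas (fun z => W (vec z) * cmode (index_mode f) (vec z)).
  by apply: bmeasM => //; exact: bmeas_cmode.
rewrite Rintegral_sum; last first.
  by move=> f; apply: bmeas_integrable; apply: bmeasM => //; exact: bmeas_cst.
apply: eq_bigr => f _; rewrite RintegralZl//; last exact: bmeas_integrable.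
by rewrite mulrAC.
Qed.

Lemma bmeas_fejer_prod u :
  bmeas (fun z => \prod_(i < d) fejer_even L N (u ord0 i) (tnth z i)).
Proof.
apply: (bmeas_coord (h := fun i t => fejer_even L N (u ord0 i) t)) => i.
exact: bmeas_fejer_even.
Qed.

Lemma Rintegral_fejer_prod u :
  \int[dx]_z (\prod_(i < d) fejer_even L N (u ord0 i) (tnth z i)) = 1.
Proof.
rewrite (Rintegral_torus_prod L (g := fun i t => fejer_even L N (u ord0 i) t)).
  by rewrite big1// => i _; exact: Rintegral_fejer_even.
by move=> i; exact: bmeas_fejer_even.
Qed.

Lemma Rintegral_cos_dist_fejer_prod u :
  \int[dx]_z (cos_dist L (vec z) u * \prod_(i < d) fejer_even L N (u ord0 i) (tnth z i)) <=
  d%:R * (2 * N.+1%:R^-1).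
Proof.
(* the factor of index j carries the squared distance, the others integrate to one *)
pose q j (t : R) := (cos (angle 1 t) - cos (angle 1 (u ord0 j))) ^+ 2.
have bq j : bmeas (q j).
  by apply: bmeasX; apply: bmeasB; [exact: bmeas_cosk|exact: bmeas_cst].
pose g j i (t : R) := (if i == j then q j t else 1) * fejer_even L N (u ord0 i) t.
have bg j i : bmeas (g j i).
  apply: bmeasM; last exact: bmeas_fejer_even.
  by case: (i == j) => //; exact: bmeas_cst.
have -> : \int[dx]_z (cos_dist L (vec z) u *
      \prod_(i < d) fejer_even L N (u ord0 i) (tnth z i)) =
    \int[dx]_z (\sum_j \prod_(i < d) g j i (tnth z i)).
  apply: eq_Rintegral => z _; rewrite big_distrl/=; apply: eq_bigr => j _.
  rewrite /g [RHS]big_split/= mxE; congr (_ * _).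
  by rewrite (bigD1 j)//= eqxx big1 ?mulr1// => i /negbTE ->.
rewrite Rintegral_sum; last by move=> j; apply: bmeas_integrable; exact: bmeas_coord.
rewrite [leRHS](_ : _ = \sum_(j < d) 2 * N.+1%:R^-1); last first.
  by rewrite sumr_const card_ord mulr_natl.
apply: ler_sum => j _.
rewrite (Rintegral_torus_prod L (bg j)) (bigD1 j)//=.
rewrite [X in _ * X]big1 ?mulr1; last first.
  move=> i /negbTE ij; rewrite /g ij.
  by under eq_Rintegral do rewrite mul1r; exact: Rintegral_fejer_even.
by rewrite /g eqxx; exact: Rintegral_fejer_even_moment.
Qed.

End order.

(** Korovkin's argument: the means are averages against positive kernels of mass one,
    and the oscillation of [W] is controlled, by [cos_modulus], by functions of which
    these averages tend to zero. *)
Lemma fejer_mean_approx (e : R) : 0 < e ->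
  exists N, forall u, `|W u - fejer_mean N u| <= e.
Proof.
move=> e0; have e20 : 0 < e / 2 by rewrite divr_gt0.
have [C C0 HC] := cos_modulus W_per W_even W_cont e20.
have [N HN] : exists N : nat, C * (d%:R * (2 * N.+1%:R^-1)) <= e / 2.
  pose A := C * (d%:R * 2) / (e / 2).
  have A0 : 0 <= A by rewrite divr_ge0 ?mulr_ge0// ltW.
  exists (Num.truncn A).
  have AN : A < (Num.truncn A).+1%:R by rewrite truncnS_gt.
  have -> : C * (d%:R * (2 * (Num.truncn A).+1%:R^-1)) =
      C * (d%:R * 2) / (Num.truncn A).+1%:R by rewrite !mulrA.
  by move: (ltW AN); rewrite ler_pdivrMr// ler_pdivrMr// [_ * (e / 2)]mulrC.
exists N => u.
set K := fun z => \prod_(i < d) fejer_even L N (u ord0 i) (tnth z i).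
have bK : bmeas K by exact: bmeas_fejer_prod.
have K0 z : 0 <= K z by apply: prodr_ge0 => i _; exact: fejer_even_ge0.
have bW := bmeas_W W_per W_even W_cont.
have bD : bmeas (fun z => cos_dist L (vec z) u).
  apply: bmeas_sum => i; apply: bmeasX; apply: bmeasB; last exact: bmeas_cst.
  apply: (bmeas_comp (f := fun t => cos (angle 1 t)) (phi := fun z => vec z ord0 i)).
    exact: bmeas_cosk.
  by under eq_fun do rewrite mxE; exact: measurable_tnth.
have ->  : W u - fejer_mean N u = \int[dx]_z ((W u - W (vec z)) * K z).
  have bWK : bmeas (fun z => W (vec z) * K z) by exact: bmeasM.
  have bcK : bmeas (fun z => W u * K z) by apply: bmeasM => //; exact: bmeas_cst.
  have -> : W u = \int[dx]_z (W u * K z).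
    rewrite RintegralZl//; last exact: bmeas_integrable.
    by rewrite /K Rintegral_fejer_prod mulr1.
  rewrite fejer_meanE -RintegralB//; try exact: bmeas_integrable.
  apply: eq_Rintegral => z _; rewrite -mulrBl; congr ((_ - _) * _).
  rewrite RintegralZl//; last exact: bmeas_integrable.
  by rewrite /K Rintegral_fejer_prod mulr1.
have bWW : bmeas (fun z => (W u - W (vec z)) * K z).
  by apply: bmeasM => //; apply: bmeasB => //; exact: bmeas_cst.
apply: (le_trans (le_normr_Rintegral measurableT (bmeas_integrable dx bWW))).
apply: (@le_trans _ _ (\int[dx]_z (e / 2 * K z + C * (cos_dist L (vec z) u * K z)))).
  apply: le_Rintegral => //.
  - exact: (integrable_norm (bmeas_integrable dx bWW)).
  - apply: bmeas_integrable; apply: bmeasD; apply: bmeasM => //; first exact: bmeas_cst.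
      exact: bmeas_cst.
    exact: bmeasM.
  - move=> z _; rewrite normrM [`|K z|]ger0_norm// mulrA -mulrDl ler_wpM2r//.
    by rewrite distrC; exact: HC.
have bDK : bmeas (fun z => cos_dist L (vec z) u * K z) by exact: bmeasM.
rewrite RintegralD//; last 2 first.
- by apply: bmeas_integrable; apply: bmeasM => //; exact: bmeas_cst.
- by apply: bmeas_integrable; apply: bmeasM => //; exact: bmeas_cst.
rewrite !RintegralZl//; try exact: bmeas_integrable.
rewrite Rintegral_fejer_prod mulr1 [leRHS](splitr e) lerD2l.
apply: le_trans HN; rewrite ler_wpM2l//.
exact: Rintegral_cos_dist_fejer_prod.
Qed.

End approximation.

(** * The interaction as a quadratic form *)

Section spectral.
Context (R : realType) (L : {posnum R}) (d : nat) (W : 'rV[R]_d -> R).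
Hypothesis W_per : periodic_along_axes L W.
Hypothesis W_even : even_along_axes W.
Hypothesis W_cont : continuous W.
Local Notation side := (side_measure L%:num).
Local Notation dx := (torus_measure L%:num d).
Local Notation angle := (angle L).
Local Notation point := (d.-tuple R).
Local Notation cmode := (cmode L).
Local Notation cos_coef := (cos_coef L W).
Local Notation fejer_mean := (fejer_mean L W).
Implicit Types (k l : 'rV[int]_d) (u v : 'rV[R]_d) (x y z : point).

Let bW := bmeas_W W_per W_even W_cont.

Definition Wsub (z : point * point) : R := W (vec z.1 - vec z.2).

Lemma bmeas_Wsub : bmeas Wsub.
Proof.
rewrite /Wsub; under eq_fun do rewrite -vec_sub.
by apply: (bmeas_comp bW); exact: measurable_tuple_sub.
Qed.

Lemma bmeas_fejer_mean N : bmeas (fun x : point => fejer_mean N (vec x)).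
Proof.
by apply: bmeas_sum => f; apply: bmeasM; [exact: bmeas_cst|exact: bmeas_cmode].
Qed.

Lemma bmeas_fejer_mean_sub N :
  bmeas (fun z : point * point => fejer_mean N (vec z.1 - vec z.2)).
Proof.
by apply: bmeas_sum => f; apply: bmeasM; [exact: bmeas_cst|exact: bmeas_cmode_sub].
Qed.

Lemma normr_le_eps (a c : R) : (forall e, 0 < e -> `|a| <= e * c) -> a = 0.
Proof.
move=> H; apply/eqP; rewrite -normr_le0; apply/ler_addgt0Pr => e e0.
rewrite add0r; have [c0|c0] := leP c 0.
  by apply: (le_trans (H 1 ltr01)); rewrite mul1r (le_trans c0)// ltW.
by have := H (e / c) (divr_gt0 e0 c0); rewrite divfK// gt_eqF.
Qed.

Lemma Rintegral_norm_le (f : point -> R) (e : R) : bmeas f ->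
  (forall x, `|f x| <= e) -> `|\int[dx]_x f x| <= e * L%:num ^+ d.
Proof.
move=> bf fe; have if_ := bmeas_integrable dx bf.
apply: (le_trans (le_normr_Rintegral measurableT if_)).
rewrite -Rintegral_torus_cst; apply: le_Rintegral => //.
- exact: (integrable_norm if_).
- exact: bmeas_integrable (bmeas_cst _ e).
Qed.

Lemma Rintegral_fejer_mean N (phi : point -> 'rV[R]_d) (h : point -> R) :
  (forall k, bmeas (fun y => cmode k (phi y))) -> bmeas h ->
  \int[dx]_y (fejer_mean N (phi y) * h y) =
  \sum_(f : mode_index d N) fejer_weight L d N * cos_coef (index_mode f) *
    \int[dx]_y (cmode (index_mode f) (phi y) * h y).
Proof.
move=> bphi bh; rewrite /fejer_mean.
have b (f : mode_index d N) : bmeas (fun y => cmode (index_mode f) (phi y) * h y).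
  exact: bmeasM.
under eq_Rintegral do rewrite big_distrl/=.
rewrite Rintegral_sum => [|f]; last first.
  under [X in EFin \o X]eq_fun do rewrite -mulrA.
  by apply: bmeas_integrable; apply: bmeasM => //; exact: bmeas_cst.
apply: eq_bigr => f _; rewrite -RintegralZl//; last exact: bmeas_integrable.
by apply: eq_Rintegral => y _; rewrite mulrA.
Qed.

Lemma fejer_mean_coef N k (e : R) : (forall u, `|W u - fejer_mean N u| <= e) ->
  `|cos_coef k - \int[dx]_x (fejer_mean N (vec x) * cmode k (vec x))| <= e * L%:num ^+ d.
Proof.
move=> HN; have bk := bmeas_cmode L k; have bT := bmeas_fejer_mean N.
rewrite /cos_coef -RintegralB//; try by apply: bmeas_integrable; exact: bmeasM.
apply: Rintegral_norm_le => [|x].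
  by apply: bmeasB; exact: bmeasM.
rewrite -mulrBl normrM -[leRHS]mulr1 ler_pM// cmode_le1//.
Qed.

(** This holds for every cosine mode in place of [W], hence for its Fejér means, and
    passes to the uniform limit. *)
Lemma conv_cmode k x :
  \int[dx]_y (Wsub (x, y) * cmode k (vec y)) = cos_coef k * cmode k (vec x).
Proof.
apply/eqP; rewrite -subr_eq0; apply/eqP.
apply: (@normr_le_eps _ (2 * L%:num ^+ d)) => e e0.
have [N HN] := fejer_mean_approx W_per W_even W_cont e0.
have bk := bmeas_cmode L k; have bT := bmeas_fejer_mean N.
have bWx : bmeas (fun y => Wsub (x, y)).
  by apply: (bmeas_comp bmeas_Wsub); exact: measurable_pair1.
have bTx : bmeas (fun y => fejer_mean N (vec x - vec y)).
  apply: (bmeas_comp (f := fun z : point * point => fejer_mean N (vec z.1 - vec z.2))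
    (phi := fun y => (x, y))); first exact: bmeas_fejer_mean_sub.
  exact: measurable_pair1.
have ET : \int[dx]_y (fejer_mean N (vec x - vec y) * cmode k (vec y)) =
    cmode k (vec x) * \int[dx]_y (fejer_mean N (vec y) * cmode k (vec y)).
  rewrite !Rintegral_fejer_mean//; last 2 first.
  - by move=> l; exact: bmeas_cmode.
  - move=> l; apply: (bmeas_comp (bmeas_cmode_sub L l) (phi := fun y => (x, y))).
    exact: measurable_pair1.
  rewrite big_distrr/=; apply: eq_bigr => f _.
  by rewrite Rintegral_cmode_conv mulrCA.
have E1 : `|\int[dx]_y (Wsub (x, y) * cmode k (vec y)) -
    \int[dx]_y (fejer_mean N (vec x - vec y) * cmode k (vec y))| <= e * L%:num ^+ d.
  rewrite -RintegralB//; try by apply: bmeas_integrable; exact: bmeasM.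
  apply: Rintegral_norm_le => [|y]; first by apply: bmeasB; exact: bmeasM.
  rewrite -mulrBl normrM -[leRHS]mulr1 ler_pM//; [exact: HN|exact: cmode_le1].
have E2 := fejer_mean_coef k HN.
rewrite ET in E1.
rewrite mulrC; set a := \int[dx]_y _ in E1 *; set b := \int[dx]_y _ in E1 E2.
have -> : a - cmode k (vec x) * cos_coef k =
  (a - cmode k (vec x) * b) - cmode k (vec x) * (cos_coef k - b) by ring.
have -> : e * (2 * L%:num ^+ d) = e * L%:num ^+ d + e * L%:num ^+ d by ring.
apply: (le_trans (ler_normB _ _)); apply: lerD => //; rewrite normrM.
by rewrite -[leRHS]mul1r ler_pM// cmode_le1.
Qed.

Lemma WsubC x y : Wsub (x, y) = Wsub (y, x).
Proof.
rewrite /Wsub/=; apply: (even_periodic_eq W_per W_even) => i.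
by exists true, 0; rewrite !mxE expr1 mulN1r mul0r addr0 opprB.
Qed.

Lemma cos_coef_0 : mean_zero L W -> cos_coef 0 = 0.
Proof.
move=> W0; rewrite /cos_coef -[RHS]W0; apply: eq_Rintegral => x _.
by rewrite cmode_vec big1 ?mulr1// => i _; rewrite mxE angle0 cos0.
Qed.

Lemma cmode0 v : cmode 0 v = 1.
Proof. by rewrite /cmode big1// => i _; rewrite mxE angle0 cos0. Qed.

Lemma Wsub_mean1 x : mean_zero L W -> \int[dx]_y Wsub (x, y) = 0.
Proof.
move=> W0; have := conv_cmode 0 x.
rewrite (cos_coef_0 W0) mul0r => <-; apply: eq_Rintegral => y _.
by rewrite cmode0 mulr1.
Qed.

Lemma Wsub_mean2 y : mean_zero L W -> \int[dx]_x Wsub (x, y) = 0.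
Proof.
by move=> W0; under eq_Rintegral do rewrite WsubC; exact: Wsub_mean1.
Qed.

(** A sum of squares: expand [cos (a - b) = cos a cos b + sin a sin b] in every
    coordinate. *)
Lemma kform_cmode_ge0 k (f : point -> R) : dx.-integrable setT (EFin \o f) ->
  0 <= kform dx (fun z : point * point => cmode k (vec z.1 - vec z.2)) f f.
Proof.
move=> if_.
pose trig (b : bool) (t : R) := if b then sin t else cos t.
pose e (s : {ffun 'I_d -> bool}) (x : point) : R :=
  \prod_(i < d) trig (s i) (angle (k ord0 i) (tnth x i)).
have be s : bmeas (e s).
  apply: (bmeas_coord (h := fun i t => trig (s i) (angle (k ord0 i) t))) => i.
  rewrite /trig; case: (s i); last exact: bmeas_cosk.
  by apply: bmeas_sin; exact: continuous_angle.
have E (z : point * point) : cmode k (vec z.1 - vec z.2) = \sum_s 1 * (e s z.1 * e s z.2).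
  rewrite cmode_sub.
  under eq_bigr => i _.
    rewrite (_ : cos _ = \sum_(b : bool) trig b (angle (k ord0 i) (tnth z.1 i)) *
      trig b (angle (k ord0 i) (tnth z.2 i))); last first.
      by rewrite big_bool/= angleBr cosB addrC.
    over.
  rewrite bigA_distr_bigA/=; apply: eq_bigr => s _.
  by rewrite big_split/= mul1r.
rewrite [X in kform _ X](_ : _ = fun z : point * point => \sum_s 1 * (e s z.1 * e s z.2)); last exact/funext.
rewrite (@kform_sum _ _ _ dx _ _ (fun=> 1) (fun s (z : point * point) => e s z.1 * e s z.2) f f)//; last first.
  move=> s; apply: bmeasM.
    exact: (bmeas_comp (be s)).
  exact: (bmeas_comp (be s)).
apply: sumr_ge0 => s _; rewrite mul1r kform_tensor//.
by rewrite -expr2 sqr_ge0.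
Qed.

(** The nullity of [k] is tested in [natural_modes] on the underlying function, here
    on the matrix. *)
Lemma natural_modesP k :
  natural_modes k <-> (forall i, 0 <= k ord0 i) /\ k != 0.
Proof.
split=> -[k0 kN0]; split=> //; apply: contra kN0 => /eqP kE; apply/eqP.
  by rewrite kE; apply/funext => i; apply/funext => j; rewrite mxE.
by apply/matrixP => i j; rewrite mxE -[LHS]/(fun_of_matrix k i j) kE.
Qed.

Lemma natural_index_mode N (f : mode_index d N) : index_mode f != 0 ->
  natural_modes (index_mode f).
Proof.
by move=> f0; apply/natural_modesP; split=> // i; rewrite mxE normr_ge0.
Qed.

(** For a Fejér mean, every coefficient may be replaced by [w] as the weights and the
    single mode forms are nonnegative; the zero mode vanishes on zero mean
    functions.  What remains is [w] times the form of a Fejér kernel, to which the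
    Schur test applies. *)
Lemma kform_Wsub_ge (w : R) (f : point -> R) : w <= 0 ->
  (forall k, natural_modes k -> w <= cos_coef k) ->
  dx.-integrable setT (EFin \o f) ->
  dx.-integrable setT (EFin \o (fun x => f x ^+ 2)) ->
  \int[dx]_x f x = 0 ->
  w * \int[dx]_x f x ^+ 2 <= kform dx Wsub f f.
Proof.
move=> w0 wk if_ iff f0; apply/ler_addgt0Pr => e e0.
set A := (\int[dx]_x `|f x|) ^+ 2.
have A0 : 0 <= A by exact: sqr_ge0.
have e10 : 0 < e / (A + 1) by rewrite divr_gt0// ltr_wpDl.
have [N HN] := fejer_mean_approx W_per W_even W_cont e10.
have HT : `|kform dx Wsub f f -
    kform dx (fun z : point * point => fejer_mean N (vec z.1 - vec z.2)) f f| <= e.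
  apply: (le_trans (kform_dist bmeas_Wsub (bmeas_fejer_mean_sub N) if_ (e := e / (A + 1)) _)).
    by move=> z; exact: HN.
  have q : (A + 1)^-1 * A <= 1 by rewrite ler_pdivrMl ?ltr_wpDl// mulr1 lerDl.
  by rewrite -/A -mulrA ler_piMr// ltW.
have c0 := ltW (fejer_weight_gt0 L d N).
have ET : kform dx (fun z : point * point => fejer_mean N (vec z.1 - vec z.2)) f f =
  \sum_(g : mode_index d N) (fejer_weight L d N * cos_coef (index_mode g)) *
    kform dx (fun z : point * point => cmode (index_mode g) (vec z.1 - vec z.2)) f f.
  rewrite -kform_sum// => g; exact: bmeas_cmode_sub.
pose B (z : point * point) : R := \prod_(i < d) fejer L N (tnth z.1 i - tnth z.2 i).
have BE (z : point * point) : B z = \sum_(g : mode_index d N) fejer_weight L d N * cmode (index_mode g) (vec z.1 - vec z.2).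
  by rewrite -prod_fejer; apply: eq_bigr => i _; rewrite !mxE.
have EB : kform dx B f f = \sum_(g : mode_index d N) fejer_weight L d N *
    kform dx (fun z : point * point => cmode (index_mode g) (vec z.1 - vec z.2)) f f.
  rewrite [X in kform _ X](_ : _ = fun z : point * point => \sum_(g : mode_index d N)
    fejer_weight L d N * cmode (index_mode g) (vec z.1 - vec z.2)); last exact/funext.
  by rewrite -kform_sum// => g; exact: bmeas_cmode_sub.
have TB : w * kform dx B f f <= kform dx (fun z : point * point => fejer_mean N (vec z.1 - vec z.2)) f f.
  rewrite ET EB big_distrr/=; apply: ler_sum => g _.
  have [g0|g0] := eqVneq (index_mode g) 0.
    rewrite g0 [kform _ _ _ _](_ : _ = 0) ?mulr0//.
    rewrite [X in kform _ X](_ : _ = fun z : point * point => 1 * 1); last first.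
      by apply/funext => z; rewrite cmode0 mulr1.
    rewrite (kform_tensor (p := fun=> 1) (q := fun=> 1))//; try exact: bmeas_cst.
    by under eq_Rintegral do rewrite mul1r; rewrite f0 mul0r.
  rewrite mulrA [w * _]mulrC ler_wpM2r ?kform_cmode_ge0// ler_wpM2l//.
  exact: wk (natural_index_mode g0).
have bB : bmeas B.
  rewrite (_ : B = fun z : point * point => \sum_(g : mode_index d N)
    fejer_weight L d N * cmode (index_mode g) (vec z.1 - vec z.2)); last exact/funext.
  apply: bmeas_sum => g; apply: bmeasM; [exact: bmeas_cst|exact: bmeas_cmode_sub].
have BS : kform dx B f f <= \int[dx]_x f x ^+ 2.
  apply: kform_schur => //.
  - by move=> z; apply: prodr_ge0 => i _; exact: fejer_ge0.
  - move=> x; have -> : \int[dx]_y B (x, y) =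
        \int[dx]_y (\prod_(i < d) fejer L N (tnth x i + (-1)%:~R * tnth y i)).
      by apply: eq_Rintegral => y _; apply: eq_bigr => i _; rewrite mulN1r.
    rewrite (Rintegral_torus_prod L (g := fun i t => fejer L N (tnth x i + (-1)%:~R * t))).
      by rewrite big1// => i _; exact: Rintegral_fejer.
    by move=> i; exact: bmeas_fejer_affine.
  - move=> y; have -> : \int[dx]_x B (x, y) =
        \int[dx]_x (\prod_(i < d) fejer L N (- tnth y i + 1%:~R * tnth x i)).
      by apply: eq_Rintegral => x _; apply: eq_bigr => i _; rewrite mul1r addrC.
    rewrite (Rintegral_torus_prod L (g := fun i t => fejer L N (- tnth y i + 1%:~R * t))).
      by rewrite big1// => i _; exact: Rintegral_fejer.
    by move=> i; exact: bmeas_fejer_affine.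
have := ler_wnM2l w0 BS; move: HT; rewrite ler_norml => /andP[HT1 HT2].
move=> wBS; lra.
Qed.

End spectral.

(** * Fourier coefficients and minimising modes *)

Section modes.
Context (R : realType) (L : {posnum R}) (d : nat).
Local Notation side := (side_measure L%:num).
Local Notation dx := (torus_measure L%:num d).
Local Notation angle := (angle L).
Local Notation point := (d.-tuple R).
Local Notation cmode := (cmode L).
Local Notation mode := (fourier_mode L).
Implicit Types (k l : 'rV[int]_d) (u v : 'rV[R]_d) (x y z : point).

Definition mode_scale k : R := L%:num `^ (- (d%:R / 2)) * Theta R k.

Lemma Theta_gt0 k : 0 < Theta R k.
Proof.
apply: prodr_gt0 => i _; rewrite sqrtr_gt0; case: eqP => _ /=; lra.
Qed.

Lemma sqr_Theta k : Theta R k ^+ 2 = \prod_(i < d) (2 - (k ord0 i == 0)%:R).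
Proof.
rewrite /Theta expr2 -big_split/=; apply: eq_bigr => i _.
by rewrite -expr2 sqr_sqrtr//; case: eqP => _ /=; lra.
Qed.

Lemma mode_scale_gt0 k : 0 < mode_scale k.
Proof. by rewrite mulr_gt0 ?powR_gt0 ?Theta_gt0. Qed.

Lemma wave_ge0 (n : int) t : 0 <= n -> wave L n t = cos (angle n t).
Proof.
rewrite le_eqVlt => /predU1P[<-|n0]; first by rewrite /wave ltxx eqxx angle0 cos0.
by rewrite /wave n0.
Qed.

Lemma wave_lt0 (n : int) t : n < 0 -> wave L n t = sin (angle n t).
Proof. by move=> n0; rewrite /wave ltNge (ltW n0) lt_eqF. Qed.

Lemma bmeas_wave n : bmeas (wave L n).
Proof.
have [n0|n0] := leP 0 n.
  rewrite (_ : wave L n = fun t => cos (angle n t)); first exact: bmeas_cosk.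
  by apply/funext => t; exact: wave_ge0.
rewrite (_ : wave L n = fun t => sin (angle n t)).
  by apply: bmeas_sin; exact: continuous_angle.
by apply/funext => t; exact: wave_lt0.
Qed.

Lemma bmeas_mode k : bmeas (mode k).
Proof.
rewrite /fourier_mode; apply: bmeasM; first exact: bmeas_cst.
by apply: (bmeas_coord (h := fun i => wave L (k ord0 i))) => i; exact: bmeas_wave.
Qed.

Lemma mode_natural k x : (forall i, 0 <= k ord0 i) ->
  mode k x = mode_scale k * cmode k (vec x).
Proof.
move=> k0; rewrite /fourier_mode cmode_vec; congr (_ * _).
by apply: eq_bigr => i _; exact: wave_ge0.
Qed.

Lemma natural_nonzero k : natural_modes k -> exists i, k ord0 i != 0.
Proof.
move=> /natural_modesP[_ kN0]; apply/existsP; apply: contraNT kN0.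
rewrite negb_exists => /forallP k0; apply/eqP/rowP => i; rewrite mxE.
by apply/eqP; rewrite -[_ == _]negbK k0.
Qed.

Lemma mode_le k x : natural_modes k -> `|mode k x| <= mode_scale k.
Proof.
move=> /natural_modesP[k0 _]; rewrite mode_natural// normrM.
by rewrite ger0_norm ?ler_piMr ?cmode_le1// ltW// mode_scale_gt0.
Qed.

Lemma Rintegral_mode k : natural_modes k -> \int[dx]_x mode k x = 0.
Proof.
move=> nk; have /natural_modesP[k0 _] := nk; have [i ki] := natural_nonzero nk.
under eq_Rintegral do rewrite mode_natural//.
rewrite RintegralZl//; last by apply: bmeas_integrable; exact: bmeas_cmode.
have := @cmode_orthogonal R L d 0 k i; rewrite mxE normr0 eq_sym normr_eq0 => /(_ ki).
under eq_Rintegral do rewrite cmode0 mulr1.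
by move=> ->; rewrite mulr0.
Qed.

Lemma Rintegral_mode2 k : natural_modes k -> \int[dx]_x (mode k x ^+ 2) = 1.
Proof.
move=> /natural_modesP[k0 _].
under eq_Rintegral do rewrite mode_natural// exprMn.
have b : bmeas (fun x => cmode k (vec x) ^+ 2) by apply: bmeasX; exact: bmeas_cmode.
rewrite RintegralZl//; last exact: bmeas_integrable.
have -> : \int[dx]_x (cmode k (vec x) ^+ 2) =
    \int[dx]_x (\prod_(i < d) (cos (angle (k ord0 i) (tnth x i)) * cos (angle (k ord0 i) (tnth x i)))).
  by apply: eq_Rintegral => x _; rewrite cmode_vec expr2 -big_split.
rewrite (Rintegral_torus_prod L (g := fun i t => cos (angle (k ord0 i) t) * cos (angle (k ord0 i) t))); last first.
  by move=> i; apply: bmeasM; exact: bmeas_cosk.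
rewrite /mode_scale exprMn sqr_Theta -mulrA -big_split/=.
have -> : L%:num `^ (- (d%:R / 2)) ^+ 2 = \prod_(i < d) L%:num^-1.
  rewrite prodr_const card_ord expr2 -powRD; last by rewrite (gt_eqF (gt0 L)) implybT.
  by rewrite -opprD -splitr powRN powR_mulrn// exprVn.
rewrite -big_split big1// => i _ /=.
rewrite Rintegral_cos_cos subrr eqxx.
have -> : (k ord0 i + k ord0 i == 0) = (k ord0 i == 0).
  by rewrite -mulr2n mulrn_eq0.
have L0 : L%:num != 0 by [].
by case: eqP => _ /=; field.
Qed.

Lemma Rintegral_cos3 (n : int) : n != 0 -> \int[side]_t (cos (angle n t) ^+ 3) = 0.
Proof.
move=> n0; have b m : bmeas (fun t => cos (angle m t)) by exact: bmeas_cosk.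
have -> : \int[side]_t (cos (angle n t) ^+ 3) =
    \int[side]_t (2^-1 * (cos (angle (n + n) t) * cos (angle n t) + cos (angle 0 t) * cos (angle n t))).
  apply: eq_Rintegral => t _; rewrite angleDl cosD angle0 cos0.
  have S := cos2Dsin2 (angle n t); have -> : sin (angle n t) * sin (angle n t) = 1 - cos (angle n t) ^+ 2.
    by rewrite -S; ring.
  by field.
rewrite RintegralZl//; last by apply: bmeas_integrable; apply: bmeasD; exact: bmeasM.
rewrite RintegralD//; try by apply: bmeas_integrable; exact: bmeasM.
rewrite !Rintegral_cos_cos addrK add0r sub0r oppr_eq0.
have -> : (n + n + n == 0) = false.
  by rewrite -mulr2n -mulrSr mulrn_eq0/= (negbTE n0).
by rewrite (negbTE n0) /= !addr0 !mulr0 ?addr0 ?mulr0.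
Qed.

Lemma Rintegral_mode3 k : natural_modes k -> \int[dx]_x (mode k x ^+ 3) = 0.
Proof.
move=> nk; have /natural_modesP[k0 _] := nk; have [i ki] := natural_nonzero nk.
under eq_Rintegral do rewrite mode_natural// exprMn.
have b : bmeas (fun x => cmode k (vec x) ^+ 3) by apply: bmeasX; exact: bmeas_cmode.
rewrite RintegralZl//; last exact: bmeas_integrable.
have -> : \int[dx]_x (cmode k (vec x) ^+ 3) =
    \int[dx]_x (\prod_(i < d) (cos (angle (k ord0 i) (tnth x i)) ^+ 3)).
  by apply: eq_Rintegral => x _; rewrite cmode_vec prodrXl.
rewrite (Rintegral_torus_prod L (g := fun i t => cos (angle (k ord0 i) t) ^+ 3)); last first.
  by move=> j; apply: bmeasX; exact: bmeas_cosk.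
by rewrite (bigD1 i)//= Rintegral_cos3// mul0r mulr0.
Qed.

Section potential.
Variable W : 'rV[R]_d -> R.
Hypothesis W_per : periodic_along_axes L W.
Hypothesis W_even : even_along_axes W.
Hypothesis W_cont : continuous W.
Local Notation cos_coef := (cos_coef L W).
Local Notation fejer_mean := (fejer_mean L W).

Let bW := bmeas_W W_per W_even W_cont.

Lemma fourier_coef_natural k : (forall i, 0 <= k ord0 i) ->
  fourier_coef L W k = mode_scale k * cos_coef k.
Proof.
move=> k0; rewrite /fourier_coef /cos_coef -RintegralZl//; last first.
  by apply: bmeas_integrable; apply: bmeasM => //; exact: bmeas_cmode.
by apply: eq_Rintegral => x _; rewrite mode_natural// mulrCA.
Qed.

Lemma coef_ratioE k : (forall i, 0 <= k ord0 i) ->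
  coef_ratio L W k = L%:num `^ (- (d%:R / 2)) * cos_coef k.
Proof.
move=> k0; rewrite /coef_ratio fourier_coef_natural// /mode_scale.
by have := lt0r_neq0 (Theta_gt0 k) => T0; field.
Qed.

(** Fejér means contain cosines only, which are orthogonal to a sine in any
    coordinate. *)
Lemma fourier_coef_sine k i : k ord0 i < 0 -> fourier_coef L W k = 0.
Proof.
move=> ki; pose M := mode_scale k.
have [_ [B HB]] := bmeas_mode k.
apply: (@normr_le_eps _ _ (B * L%:num ^+ d)) => e e0.
have [N HN] := fejer_mean_approx W_per W_even W_cont e0.
have bk := bmeas_mode k; have bT := bmeas_fejer_mean L W N.
have T0 : \int[dx]_x (fejer_mean N (vec x) * mode k x) = 0.
  rewrite Rintegral_fejer_mean//; last first.
    by move=> l; exact: bmeas_cmode.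
  apply: big1 => f _.
  have -> : \int[dx]_x (cmode (index_mode f) (vec x) * mode k x) =
      \int[dx]_x (M * \prod_(j < d) (cos (angle (index_mode f ord0 j) (tnth x j)) * wave L (k ord0 j) (tnth x j))).
    by apply: eq_Rintegral => x _; rewrite big_split/= -cmode_vec /fourier_mode /M /mode_scale mulrCA.
  have bg j : bmeas (fun t => cos (angle (index_mode f ord0 j) t) * wave L (k ord0 j) t).
    by apply: bmeasM; [exact: bmeas_cosk|exact: bmeas_wave].
  rewrite RintegralZl//; last by apply: bmeas_integrable; exact: (bmeas_coord bg).
  rewrite (Rintegral_torus_prod L bg) (bigD1 i)//=.
  under eq_Rintegral do rewrite wave_lt0//.
  by rewrite Rintegral_cos_sin mul0r !mulr0.
rewrite -[fourier_coef _ _ _]subr0 -T0 /fourier_coef -RintegralB//; try by apply: bmeas_integrable; exact: bmeasM.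
rewrite mulrA; apply: Rintegral_norm_le => [|x]; first by apply: bmeasB; exact: bmeasM.
by rewrite -mulrBl normrM ler_pM//; exact: HN.
Qed.

Lemma exists_negative_mode : ~ H_stable L W ->
  exists2 k, natural_modes k & cos_coef k < 0.
Proof.
move=> nH; apply: contra_notP nH => nk k k0.
have [[i ki]|kn] := pselect (exists i, k ord0 i < 0).
  by rewrite (fourier_coef_sine ki).
have kp i : 0 <= k ord0 i by rewrite leNgt; apply/negP => ki; apply: kn; exists i.
have nat_k : natural_modes k by apply/natural_modesP.
rewrite fourier_coef_natural// mulr_ge0 ?(ltW (mode_scale_gt0 k))//.
by rewrite leNgt; apply/negP => ck; apply: nk; exists k.
Qed.

(** A mode beyond the degree of a Fejér mean is orthogonal to it. *)
Lemma cos_coef_small (e : R) : 0 < e -> exists N : nat, forall k i,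
  (forall j, 0 <= k ord0 j) -> N%:Z < k ord0 i -> `|cos_coef k| <= e * L%:num ^+ d.
Proof.
move=> e0; have [N HN] := fejer_mean_approx W_per W_even W_cont e0.
exists N => k i k0 ki.
have bk := bmeas_cmode L k; have bT := bmeas_fejer_mean L W N.
have T0 : \int[dx]_x (fejer_mean N (vec x) * cmode k (vec x)) = 0.
  rewrite Rintegral_fejer_mean//; last first.
    by move=> l; exact: bmeas_cmode.
  apply: big1 => f _.
  rewrite (@cmode_orthogonal _ _ _ _ _ i) ?mulr0// mxE normr_id gt_eqF//.
  rewrite (ger0_norm (k0 i)) (le_lt_trans _ ki)// /freq.
  have := ltn_ord (f i).1; have := ltn_ord (f i).2.
  by move: (nat_of_ord _) (nat_of_ord _) => a b'; lia.
have := fejer_mean_coef W_per W_even W_cont k HN.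
by rewrite T0 subr0.
Qed.

Definition box_mode N (g : {ffun 'I_d -> 'I_N.+1}) : 'rV[int]_d := \row_i (g i)%:Z.

(** As the coefficients tend to zero, those below a given negative one have their mode
    in a finite box. *)
Lemma exists_minimising_mode : ~ H_stable L W -> exists k, minimising_mode L W k.
Proof.
move=> /exists_negative_mode[k0 nk0 ck0].
have Ld : 0 < L%:num ^+ d by rewrite exprn_gt0.
have e0 : 0 < - cos_coef k0 / 2 / L%:num ^+ d by rewrite !divr_gt0// oppr_gt0.
have [N HN] := cos_coef_small e0.
have far k i : (forall j, 0 <= k ord0 j) -> N%:Z < k ord0 i -> cos_coef k0 < cos_coef k.
  move=> kp /(HN k i kp); rewrite divfK ?gt_eqF// ler_norml => /andP[+ _].
  by move=> h; lra.
have box k : natural_modes k -> (forall i, k ord0 i <= N%:Z) ->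
    exists g : {ffun 'I_d -> 'I_N.+1}, box_mode g = k.
  move=> /natural_modesP[kp _] kN; exists [ffun i => inord `|k ord0 i|%N].
  apply/rowP => i; rewrite mxE ffunE inordK.
    by rewrite gez0_abs.
  by have := kN i; have := kp i; lia.
have nearE k : natural_modes k -> cos_coef k <= cos_coef k0 -> forall i, k ord0 i <= N%:Z.
  move=> /natural_modesP[kp _] ck i; rewrite leNgt; apply/negP => /(far k i kp).
  by rewrite ltNge ck.
have [g0 g0E] := box _ nk0 (nearE _ nk0 (lexx _)).
pose P g := `[< natural_modes (@box_mode N g) >].
have Pg0 : P g0 by apply/asboolP; rewrite g0E.
have [g /asboolP ng gmin] := @arg_minP _ R _ g0 P (fun g => cos_coef (box_mode g)) Pg0.
exists (box_mode g); split => // l nl.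
have [gp _] := (natural_modesP _).1 ng; have [lp _] := (natural_modesP _).1 nl.
rewrite !coef_ratioE// ler_wpM2l ?powR_ge0//.
have gk0 : cos_coef (box_mode g) <= cos_coef k0 by rewrite -g0E; exact: gmin.
have [lk0|/ltW] := leP (cos_coef l) (cos_coef k0); last exact: le_trans.
have [gl glE] := box _ nl (nearE _ nl lk0).
by rewrite -glE; apply: gmin; apply/asboolP; rewrite glE.
Qed.

Lemma inf_coef_ratio k : minimising_mode L W k ->
  inf (coef_ratio L W @` natural_modes (d := d)) = coef_ratio L W k.
Proof.
move=> [nk kmin]; apply/eqP; rewrite eq_le; apply/andP; split.
  apply: ge_inf; last by exists k.
  by exists (coef_ratio L W k) => _ [l nl <-]; exact: kmin.
apply: lb_le_inf; first by exists (coef_ratio L W k), k.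
by move=> _ [l nl <-]; exact: kmin.
Qed.

Lemma minimising_mode_cos_coef k l : minimising_mode L W k -> natural_modes l ->
  cos_coef k <= cos_coef l.
Proof.
move=> [nk kmin] nl; have := kmin l nl.
have [kp _] := (natural_modesP _).1 nk; have [lp _] := (natural_modesP _).1 nl.
by rewrite !coef_ratioE// ler_pM2l// powR_gt0.
Qed.

Lemma minimising_mode_lt0 k : ~ H_stable L W -> minimising_mode L W k ->
  cos_coef k < 0.
Proof.
move=> /exists_negative_mode[l nl cl] mk.
exact: le_lt_trans (minimising_mode_cos_coef mk nl) cl.
Qed.

End potential.
End modes.

(** * Second order bounds for real powers *)

Section powR_taylor.
Context (R : realType).
Implicit Types (p : {poly R}) (c q r x : R).

Lemma is_derive_powR1 q x : -1 < x ->
  is_derive x 1 (fun t => (1 + t) `^ q) (q * (1 + x) `^ (q - 1)).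
Proof.
move=> x1.
have x0 : 0 < 1 + x by lra.
have h1 : is_derive x 1 (fun t : R => 1 + t) 1.
  have -> : (fun t : R => 1 + t) = cst 1 + (id : R -> R) by apply/funext.
  by apply: is_derive_eq; rewrite add0r.
have h2 := is_derive1_powR q x0.
have := @is_derive1_comp R (@powR R ^~ q) (fun t => 1 + t) x _ _ h2 h1.
by move=> h; apply: (is_derive_eq h); rewrite mulr1.
Qed.

Lemma MVT_from0 (f df : R -> R) r : f 0 = 0 ->
  (forall x, `|x| < r -> is_derive x 1 f (df x)) ->
  forall x, `|x| < r -> exists c, [/\ `|c| < r, 0 <= c * x & f x = df c * x].
Proof.
move=> f0 fdf x xr.
have cf y : `|y| < r -> {for y, continuous f}.
  move=> /fdf[dfy _]; exact/differentiable_continuous/derivable1_diffP.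
have [x0|x0|->] := ltgtP x 0.
- have [||c] := @MVT R f df x 0 x0.
  + move=> y /[!in_itv]/= /andP[xy y0]; apply: fdf.
    by rewrite ltr0_norm// in xr; rewrite ltr0_norm//; lra.
  + apply: continuous_in_subspaceT => y /[!inE]/= /[!in_itv]/= /andP[xy y0].
    apply: cf; rewrite ltr0_norm// in xr; rewrite ler0_norm//; lra.
  + move=> /[!in_itv]/= /andP[xc c0]; rewrite f0 => E; exists c; split.
    * by rewrite ltr0_norm// in xr; rewrite ltr0_norm//; lra.
    * nra.
    * lra.
- have [||c] := @MVT R f df 0 x x0.
  + move=> y /[!in_itv]/= /andP[y0 xy]; apply: fdf.
    by rewrite gtr0_norm// in xr; rewrite gtr0_norm//; lra.
  + apply: continuous_in_subspaceT => y /[!inE]/= /[!in_itv]/= /andP[y0 xy].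
    apply: cf; rewrite gtr0_norm// in xr; rewrite ger0_norm//; lra.
  + move=> /[!in_itv]/= /andP[c0 xc]; rewrite f0 => E; exists c; split.
    * by rewrite gtr0_norm// in xr; rewrite gtr0_norm//; lra.
    * nra.
    * lra.
- by exists 0; rewrite normr0 mulr0 f0 mulr0 lexx; split=> //; rewrite -(normr0 R) (le_lt_trans _ xr)// normr0.
Qed.

(** Two applications of the mean value theorem reduce the comparison of functions with
    the same first order jet at the origin to that of their second derivatives. *)
Lemma powR_le_poly p c q r : r <= 1 ->
  p.[0] = c -> p^`().[0] = c * q ->
  (forall x, `|x| < r -> c * (q * ((q - 1) * (1 + x) `^ (q - 2))) <= p^`()^`().[x]) ->
  forall x, `|x| < r -> c * (1 + x) `^ q <= p.[x].
Proof.
move=> r1 p0 p1 p2 x xr.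
have xN1 (y : R) : `|y| < r -> -1 < y.
  by move=> yr; have := lt_le_trans yr r1; rewrite ltr_norml => /andP[].
pose f q' c' (p' : {poly R}) y := p'.[y] - c' * (1 + y) `^ q'.
have df q' c' p' (y : R) : `|y| < r ->
    is_derive y 1 (f q' c' p') (f (q' - 1) (c' * q') p'^`() y).
  move=> /xN1 yN1.
  have -> : f q' c' p' = horner p' - c' *: (fun t => (1 + t) `^ q') by apply/funext.
  apply: (is_derive_eq (is_deriveB (is_derive_poly p' y) (is_deriveZ c' (is_derive_powR1 q' yN1)))).
  by rewrite /f -mulrA.
have f0 : f q c p 0 = 0 by rewrite /f p0 addr0 powR1 mulr1 subrr.
have f1 : f (q - 1) (c * q) p^`() 0 = 0 by rewrite /f p1 addr0 powR1 mulr1 subrr.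
have [y [yr xy fx]] := MVT_from0 f0 (df q c p) xr.
have [z [zr yz fy]] := MVT_from0 f1 (df _ _ _) yr.
rewrite -subr_ge0 -/(f q c p x) fx fy -mulrA mulr_ge0// /f subr_ge0.
apply: le_trans (p2 z zr); rewrite -!mulrA.
by have -> : q - 1 - 1 = q - 2 by ring.
Qed.

Lemma deriv_one : (1 : {poly R})^`() = 0.
Proof. by rewrite -polyC1 derivC. Qed.

Lemma horner_one x : (1 : {poly R}).[x] = 1.
Proof. by rewrite -polyC1 hornerC. Qed.

Let evalE := (hornerM, hornerD, hornerN, hornerZ, hornerMn, hornerXn, hornerX, horner_one,
  hornerC, horner0).

Lemma bernoulli_concave q x : 0 <= q <= 1 -> `|x| < 1 -> (1 + x) `^ q <= 1 + q * x.
Proof.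
move=> /andP[q0 q1] x1.
have H := @powR_le_poly (1 + q *: 'X) 1 q 1 (lexx _) _ _ _ x x1.
suff : 1 * (1 + x) `^ q <= (1 + q *: 'X).[x] by rewrite !evalE mul1r.
apply: H.
- by rewrite !evalE; ring.
- by rewrite !(deriv_one, poly.derivE) !evalE; ring.
- move=> y _; rewrite !(deriv_one, poly.derivE) !evalE mul1r mulrA ?mulr0 ?addr0.
  have q01 : q * (q - 1) <= 0 by nra.
  exact: (mulr_le0_ge0 q01 (powR_ge0 _ _)).
Qed.

(** After two derivatives this is the concave Bernoulli inequality with exponent
    [m - 2]. *)
Lemma powR_le_taylor3 m x : 2 <= m <= 3 -> `|x| < 1 ->
  (1 + x) `^ m <= 1 + m * x + m * (m - 1) / 2 * x ^+ 2
                  + m * (m - 1) * (m - 2) / 6 * x ^+ 3.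
Proof.
move=> /andP[m2 m3] x1.
pose p : {poly R} := 1 + m *: 'X + (m * (m - 1) / 2) *: 'X^2 + (m * (m - 1) * (m - 2) / 6) *: 'X^3.
have pE : p.[x] = 1 + m * x + m * (m - 1) / 2 * x ^+ 2
    + m * (m - 1) * (m - 2) / 6 * x ^+ 3 by rewrite /p !evalE /=; field.
rewrite -pE -[leLHS]mul1r.
apply: (@powR_le_poly p 1 m 1 (lexx _) _ _ _ x x1).
- by rewrite /p !evalE; field.
- by rewrite /p !(deriv_one, poly.derivE) !evalE /=; field.
- move=> y y1; have := @bernoulli_concave (m - 2) y _ y1.
  have -> : (p^`())^`().[y] = m * (m - 1) * (1 + (m - 2) * y).
    by rewrite /p !(deriv_one, poly.derivE) !evalE /=; field.
  have m02 : 0 <= m - 2 <= 1 by apply/andP; split; lra.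
  by move=> /(_ m02) h; rewrite mul1r mulrA ler_wpM2l//; nra.
Qed.

(** After two derivatives this is [q <= (1 + x)^(m - 2)], which holds near the origin. *)
Lemma powR_ge_taylor2 m q : 2 <= m -> 0 < q < 1 -> exists2 r, 0 < r < 1 &
  forall x, `|x| < r -> 1 + m * x + q * (m * (m - 1) / 2) * x ^+ 2 <= (1 + x) `^ m.
Proof.
move=> m2 /andP[q0 q1].
have [r /andP[r0 r1] qr] : exists2 r, 0 < r < 1 & forall y, `|y| < r -> q <= (1 + y) `^ (m - 2).
  have [->|mN2] := eqVneq m 2.
    by exists 2^-1 => [|y _]; [apply/andP; split; lra|rewrite subrr powRr0 ltW].
  have m20 : 0 < m - 2 by rewrite lt_neqAle subr_ge0 m2 andbT eq_sym subr_eq0.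
  have s1 : q `^ (m - 2)^-1 < 1.
    have e1 : (1 : R) `^ (m - 2)^-1 = 1 by rewrite powR1.
    by rewrite -[ltRHS]e1 gt0_ltr_powR ?invr_gt0// ?nnegrE// ltW.
  have s0 : 0 < q `^ (m - 2)^-1 by rewrite powR_gt0.
  (* the radius for which (1 - r)^(m - 2) = q *)
  exists (1 - q `^ (m - 2)^-1); first by apply/andP; split; lra.
  move=> y; rewrite ltr_norml => /andP[y1 y2].
  have -> : q = (q `^ (m - 2)^-1) `^ (m - 2).
    by rewrite -powRrM mulVf ?gt_eqF// powRr1// ltW.
  by rewrite ge0_ler_powR// ?nnegrE; lra.
exists r; first by rewrite r0.
move=> x xr.
pose p : {poly R} := - (1 + m *: 'X + (q * (m * (m - 1) / 2)) *: 'X^2).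
have pE : p.[x] = - (1 + m * x + q * (m * (m - 1) / 2) * x ^+ 2).
  by rewrite /p !evalE /=; field.
suff : -1 * (1 + x) `^ m <= p.[x] by rewrite pE; lra.
apply: (@powR_le_poly p (-1) m r (ltW r1) _ _ _ x xr).
- by rewrite /p !evalE; ring.
- by rewrite /p !(deriv_one, poly.derivE) !evalE /=; field.
- move=> y yr; have h := qr y yr.
  have -> : (p^`())^`().[y] = - (m * (m - 1) * q).
    by rewrite /p !(deriv_one, poly.derivE) !evalE /=; field.
  rewrite mulN1r lerN2 mulrA ler_wpM2l//; nra.
Qed.

End powR_taylor.

(** * Probability measures with a density *)

Section almost_everywhere.
Context d (T : measurableType d) (R : realType).
Variable mu : {finite_measure set T -> \bar R}.
Implicit Types f g : T -> R.

Lemma ae_eq_EFin f g : ae_eq mu setT f g -> ae_eq mu setT (EFin \o f) (EFin \o g).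
Proof. exact: ae_eq_comp. Qed.

Lemma Rintegral_ae f g : measurable_fun setT f -> measurable_fun setT g ->
  ae_eq mu setT f g -> \int[mu]_x f x = \int[mu]_x g x.
Proof.
move=> mf mg /ae_eq_EFin fg; rewrite /Rintegral; congr fine.
by apply: (@ae_eq_integral _ _ _ mu setT (EFin \o g) (EFin \o f)) => //; exact/measurable_EFinP.
Qed.

Lemma integrable_ae_eq f g : mu.-integrable setT (EFin \o f) ->
  measurable_fun setT g -> ae_eq mu setT f g -> mu.-integrable setT (EFin \o g).
Proof.
move=> /integrableP[mf fy] mg /ae_eq_EFin fg; apply/integrableP.
have mg' : measurable_fun setT (EFin \o g) by exact/measurable_EFinP.
split => //; apply: le_lt_trans fy; rewrite le_eqVlt; apply/orP; left; apply/eqP.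
apply: ae_eq_integral => //.
- exact: measurableT_comp.
- exact: measurableT_comp.
- by apply: ae_eq_sym; exact: ae_eq_abse.
Qed.

Lemma Rintegral_eq0_ae f : mu.-integrable setT (EFin \o f) ->
  (forall x, 0 <= f x) -> \int[mu]_x f x = 0 -> ae_eq mu setT f (fun=> 0).
Proof.
move=> if_ f0 intf0.
have mf := measurable_int _ if_.
have : (\int[mu]_x `|(EFin \o f) x| = 0)%E.
  under eq_integral do rewrite /= ger0_norm//.
  have fin := integrable_fin_num measurableT if_.
  by rewrite -(fineK fin) -[fine _]/(\int[mu]_x f x) intf0.
move/(ae_eq_integral_abs mu measurableT mf).
by apply: filterS => x /= H Tx; have [] := H Tx.
Qed.

Lemma kform_ae B f g : bmeas B -> mu.-integrable setT (EFin \o f) ->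
  mu.-integrable setT (EFin \o g) -> ae_eq mu setT f g ->
  kform mu B f f = kform mu B g g.
Proof.
move=> bB if_ ig fg.
have mf := integrable_measurable if_; have mg := integrable_measurable ig.
have mB1 x : measurable_fun setT (fun y => B (x, y)).
  by apply: (measurableT_comp bB.1); exact: measurable_pair1.
have mB2 y : measurable_fun setT (fun x => B (x, y)).
  by apply: (measurableT_comp bB.1); exact: measurable_pair2.
transitivity (kform mu B f g).
  rewrite !kform_Fubini1//; apply: eq_Rintegral => x _; congr (_ * _).
  apply: Rintegral_ae; try exact: measurable_funM.
  by apply: filterS fg => y /= H Ty; rewrite H.
rewrite !kform_Fubini2//; apply: eq_Rintegral => y _; congr (_ * _).
apply: Rintegral_ae; try exact: measurable_funM.
by apply: filterS fg => x /= H Tx; rewrite H.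
Qed.

Section density_measure.
Variable g : T -> R.
Hypothesis ig : mu.-integrable setT (EFin \o g).
Hypothesis g0 : forall x, 0 <= g x.
Hypothesis g1 : \int[mu]_x g x = 1.

Definition density_measure (A : set T) : \bar R := (\int[mu]_(x in A) (g x)%:E)%E.

Let density_measure0 : density_measure set0 = 0%E.
Proof. by rewrite /density_measure integral_set0. Qed.

Let density_measure_ge0 A : (0 <= density_measure A)%E.
Proof. by apply: integral_ge0 => x _; rewrite lee_fin. Qed.

Let density_measure_sigma_additive : semi_sigma_additive density_measure.
Proof.
move=> /= A mA tA mUA; rewrite /density_measure/= integral_bigcup//=; last first.
  exact: (integrableS measurableT).
apply: is_cvg_ereal_nneg_natsum_cond => n _ _.
by apply: integral_ge0 => /= x _; rewrite lee_fin.
Qed.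

HB.instance Definition _ := isMeasure.Build _ _ _ density_measure
  density_measure0 density_measure_ge0 density_measure_sigma_additive.

Let density_measureT : density_measure setT = 1%E.
Proof.
have fin := integrable_fin_num measurableT ig.
by rewrite /density_measure -(fineK fin) -[fine _]/(\int[mu]_x g x) g1.
Qed.

HB.instance Definition _ := Measure_isProbability.Build _ _ _ density_measure
  density_measureT.

Definition density_probability : probability T R := density_measure.

End density_measure.

Lemma exists_probability_density g : mu.-integrable setT (EFin \o g) ->
  (forall x, 0 <= g x) -> \int[mu]_x g x = 1 ->
  exists rho : probability T R,
    forall A, measurable A -> rho A = (\int[mu]_(x in A) (g x)%:E)%E.
Proof. by move=> ig g0 g1; exists (density_probability ig g0 g1). Qed.

End almost_everywhere.

Section densities.
Local Open Scope charge_scope.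
Local Open Scope ring_scope.
Context (R : realType) (L : {posnum R}) (d : nat).
Local Notation dx := (torus_measure L%:num d).
Local Notation point := (d.-tuple R).
Implicit Types (rho mu : probability point R) (g h : point -> R).

Definition has_density rho g :=
  dx.-integrable setT (EFin \o g) /\
  forall A, measurable A -> rho A = (\int[dx]_(x in A) (g x)%:E)%E.

Lemma has_density_density rho : rho `<< dx -> has_density rho (density L rho).
Proof.
move=> rhodx; set nu := charge_of_finite_measure rho.
have E x : ((density L rho x)%:E = ('d nu '/d dx) x)%E.
  by rewrite /density fineK// Radon_Nikodym_fin_num.
split; first by under [X in _.-integrable _ X]eq_fun do rewrite /= E; exact: Radon_Nikodym_integrable.
move=> A mA; under eq_integral do rewrite E.
exact: (Radon_Nikodym_integral (nu := nu)).
Qed.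

Lemma has_density_dominates rho g : has_density rho g -> rho `<< dx.
Proof.
move=> [ig rhoE]; apply/null_content_dominatesP => A mA A0.
rewrite rhoE//; apply: null_set_integral => //.
by apply: measurable_funTS; exact: measurable_int ig.
Qed.

Lemma has_density_ae rho g h : has_density rho g -> has_density rho h ->
  ae_eq dx setT g h.
Proof.
move=> [ig gE] [ih hE].
have := @integral_ae_eq _ _ _ dx setT measurableT (EFin \o h) (EFin \o g) ig
  (measurable_int _ ih).
have H E : E `<=` setT -> measurable E ->
    (\int[dx]_(x in E) (EFin \o g) x = \int[dx]_(x in E) (EFin \o h) x)%E.
  by move=> _ mE; rewrite -gE// -hE.
by move=> /(_ H); apply: filterS => x /= K Tx; have [] := K Tx.
Qed.

Lemma has_density_eq rho g h : has_density rho g -> measurable_fun setT h ->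
  ae_eq dx setT g h -> has_density rho h.
Proof.
move=> [ig gE] mh gh; split; first exact: (integrable_ae_eq ig mh gh).
move=> A mA; rewrite gE//; apply: ae_eq_integral => //.
- by apply: measurable_funTS; exact: measurable_int ig.
- by apply: measurable_funTS; exact/measurable_EFinP.
- by apply: ae_eq_subset (ae_eq_EFin gh).
Qed.

Lemma has_density_same rho mu g : has_density rho g -> has_density mu g ->
  same_measure rho mu.
Proof. by move=> [_ rE] [_ mE] A mA; rewrite rE// mE. Qed.

(** The integral of the negative part is minus the measure of a set. *)
Lemma has_density_ge0 rho g : has_density rho g ->
  ae_eq dx setT g (fun x => Num.max (g x) 0).
Proof.
move=> [ig gE]; have mg := integrable_measurable ig.
pose N := [set x | g x < 0].
have mN : measurable N.
  rewrite (_ : N = g @^-1` `]-oo, 0[%classic); last first.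
    by apply/seteqP; split=> x /=; rewrite in_itv.
  by rewrite -[X in measurable X]setTI; exact: mg.
pose h x := Num.max (- g x) 0.
have mh : measurable_fun setT h.
  by apply: measurable_maxr => //; exact: measurableT_comp.
have hE x : (h x)%:E = ((fun x => (- g x)%:E) \_ N) x.
  rewrite patchE /h; case: ifPn; rewrite ?inE ?notin_setE /N/= => gx.
    by rewrite max_l// oppr_ge0 ltW.
  by rewrite max_r// oppr_le0 leNgt; exact/negP.
have h0 x : 0 <= h x by rewrite /h le_max lexx orbT.
have ih : dx.-integrable setT (EFin \o h).
  apply: (le_integrable measurableT _ _ ig); first exact/measurable_EFinP.
  move=> x _ /=; rewrite lee_fin ger0_norm// /h ge_max normr_ge0 andbT.
  by rewrite -normrN ler_norm.
have inth : \int[dx]_x h x = 0.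
  apply/eqP; rewrite eq_le Rintegral_ge0// andbT -lee_fin.
  rewrite /Rintegral fineK; last exact: integrable_fin_num.
  under eq_integral do rewrite hE.
  rewrite -integral_mkcond.
  have -> : (\int[dx]_(x in N) (- g x)%:E = - \int[dx]_(x in N) (g x)%:E)%E.
    under eq_integral do rewrite EFinN.
    rewrite integralN//; exact/integrable_add_def/(integrableS measurableT _ _ ig).
  by rewrite -gE// leeNl oppe0.
apply: filterS (Rintegral_eq0_ae ih h0 inth) => x /= H Tx.
have := H Tx; rewrite /h => hx.
have : - g x <= 0 by rewrite -hx le_max lexx.
by rewrite oppr_le0 => gx; rewrite max_l.
Qed.

Lemma has_density_int rho g : has_density rho g -> \int[dx]_x g x = 1.
Proof. by move=> [_ gE]; rewrite /Rintegral -gE// probability_setT. Qed.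

End densities.

(** * The free energy of a density *)

Section torus_probability.
Context (R : realType) (L : {posnum R}) (d : nat).
Local Notation dx := (torus_measure L%:num d).
Local Notation side := (side_measure L%:num).
Local Notation point := (d.-tuple R).
Implicit Types (rho mu : probability point R) (g h : point -> R).

Lemma measurable_torus : measurable (torus L%:num d).
Proof.
rewrite (_ : torus _ _ = \bigcap_(i in [set: 'I_d]) (@tnth d R)^~ i @^-1` `[0, L%:num[%classic).
  apply: fin_bigcap_measurable => // i _.
  by rewrite -[X in measurable X]setTI; exact: measurable_tnth.
apply/seteqP; split=> x /=; first by move=> h i _ /=; rewrite in_itv/=.
by move=> h i; have /= := h i I; rewrite in_itv.
Qed.

Lemma torus_measureE : dx (torus L%:num d) = (L%:num ^+ d)%:E.
Proof.
have mI : measurable (`[0, L%:num[%classic : set R) by exact: measurable_itv.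
have sI : side `[0, L%:num[%classic = L%:num%:E.
  transitivity (lebesgue_measure (`[0, L%:num[ `&` `[0, L%:num[)); first by [].
  by rewrite setIid lebesgue_measure_itv/= lte_fin gt0 sube0.
have bI : bmeas (\1_(`[0, L%:num[%classic) : R -> R).
  split; first exact: measurable_indic.
  by exists 1 => x; rewrite indicE; case: (_ \in _); rewrite ?normr1 ?normr0.
have fin : dx (torus L%:num d) \is a fin_num.
  by apply: fin_num_measure; exact: measurable_torus.
rewrite -(fineK fin); congr EFin.
have -> : fine (dx (torus L%:num d)) = \int[dx]_x \1_(torus L%:num d) x.
  by rewrite /Rintegral integral_indic ?setIT//; exact: measurable_torus.
have -> : \int[dx]_x \1_(torus L%:num d) x =
    \int[dx]_x (\prod_(i < d) \1_(`[0, L%:num[%classic) (tnth x i)) :> R.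
  apply: eq_Rintegral => x _; rewrite indicE.
  case: (boolP (x \in torus L%:num d)); rewrite ?inE ?notin_setE => xt.
    rewrite big1// => i _; rewrite indicE mem_set//=.
    by rewrite in_itv/=; exact: xt.
  have [i xi] : exists i, ~ (0 <= tnth x i < L%:num).
    by apply/existsNP; exact: xt.
  by rewrite (bigD1 i)//= indicE memNset ?mul0r//= in_itv/=.
rewrite (Rintegral_torus_prod L (g := fun i => \1_(`[0, L%:num[%classic))); last by [].
rewrite (eq_bigr (fun=> L%:num)) ?prodr_const ?card_ord// => i _.
by rewrite /Rintegral integral_indic// setIT; exact: (congr1 fine sI).
Qed.

Lemma torus_measureC : dx (~` torus L%:num d) = 0%E.
Proof.
have mt := measurable_torus.
have mc : measurable (~` torus L%:num d) by exact: measurableC.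
have E : dx setT = (L%:num ^+ d)%:E by exact: torus_measureT.
have H : ((L%:num ^+ d)%:E = dx (torus L%:num d) + dx (~` torus L%:num d))%E.
  by rewrite -E -(setUv (torus L%:num d)); exact: (measureU dx mt mc (setICr _)).
have fin : dx (~` torus L%:num d) \is a fin_num by exact: fin_num_measure.
move: H fin; rewrite torus_measureE.
case: (dx _) => // r [] /eqP.
by rewrite -subr_eq0 opprD addNKr oppr_eq0 => /eqP ->.
Qed.

Lemma has_density_torus rho g : has_density L rho g -> is_torus_probability L rho.
Proof.
move=> gd; rewrite /is_torus_probability.
have r0 : rho (~` torus L%:num d) = 0%E.
  have /null_content_dominatesP := has_density_dominates gd.
  by apply; [exact: measurableC measurable_torus|exact: torus_measureC].
have := probability_setC rho measurable_torus; rewrite r0.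
have fin : rho (torus L%:num d) \is a fin_num.
  by apply: fin_num_measure; exact: measurable_torus.
by rewrite -(fineK fin) -EFinB => -[] /eqP; rewrite eq_sym subr_eq0 => /eqP <-.
Qed.

Lemma has_density_uniform : has_density L (uniform L d) (fun=> rho_infty L d).
Proof.
split; first exact: bmeas_integrable (bmeas_cst _ _).
by move=> A mA; rewrite integral_cst.
Qed.

Lemma rho_infty_gt0 : 0 < rho_infty L d.
Proof. by rewrite invr_gt0 exprn_gt0. Qed.

Lemma rho_infty_mass : rho_infty L d * L%:num ^+ d = 1.
Proof. by rewrite /rho_infty mulVf// expf_neq0. Qed.

End torus_probability.

Section energy.
Context (R : realType) (L : {posnum R}) (d : nat) (W : 'rV[R]_d -> R).
Hypothesis W_per : periodic_along_axes L W.
Hypothesis W_even : even_along_axes W.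
Hypothesis W_cont : continuous W.
Hypothesis W_mean0 : mean_zero L W.
Local Notation dx := (torus_measure L%:num d).
Local Notation point := (d.-tuple R).
Local Notation ri := (rho_infty L d).
Local Notation Wsub := (Wsub W).
Implicit Types (rho mu : probability point R) (g h : point -> R) (m beta : R).

Let bWs := bmeas_Wsub W_per W_even W_cont.

Definition density_energy m beta g : R :=
  beta^-1 / (m - 1) * (\int[dx]_x (g x `^ m)) - beta^-1 / (m - 1)
  + 2^-1 * kform dx Wsub g g.

Lemma measurable_powR_comp g m : measurable_fun setT g ->
  measurable_fun setT (fun x => g x `^ m).
Proof. by move=> mg; apply: (measurableT_comp (measurable_powR m)). Qed.

Lemma free_energyE m beta rho g : has_density L rho g ->
  dx.-integrable setT (EFin \o (fun x => g x `^ m)) ->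
  free_energy L W m beta rho = (density_energy m beta g)%:E.
Proof.
move=> gd igm; have rdx := has_density_dominates gd.
have fd := has_density_density rdx.
have fg := has_density_ae fd gd.
have mf := integrable_measurable fd.1; have mg := integrable_measurable gd.1.
have fgm : ae_eq dx setT (fun x => density L rho x `^ m) (fun x => g x `^ m).
  by apply: filterS fg => x /= H Tx; rewrite H.
have mfm := measurable_powR_comp m mf.
have mgm := measurable_powR_comp m mg.
rewrite /free_energy; case: asboolP => [_|]; last first.
  case; split => //.
    by apply: (integrable_ae_eq igm) => //; exact: ae_eq_sym.
  exact: (kform_integrable bWs fd.1 fd.1).
rewrite /density_energy (Rintegral_ae mfm mgm fgm).
by rewrite -(kform_ae bWs fd.1 gd.1 fg).
Qed.

Lemma free_energy_lty m beta rho : (free_energy L W m beta rho < +oo)%E ->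
  exists g, [/\ has_density L rho g, forall x, 0 <= g x &
    dx.-integrable setT (EFin \o (fun x => g x `^ m))].
Proof.
rewrite /free_energy; case: asboolP => // -[rdx ifm _] _.
have fd := has_density_density rdx; have mf := integrable_measurable fd.1.
have fge := has_density_ge0 fd.
have mg : measurable_fun setT (fun x => Num.max (density L rho x) 0).
  exact: measurable_maxr.
exists (fun x => Num.max (density L rho x) 0); split.
- exact: has_density_eq fd mg fge.
- by move=> x; rewrite le_max lexx orbT.
- apply: (integrable_ae_eq ifm); first exact: measurable_powR_comp.
  by apply: filterS fge => x /= H Tx; rewrite {1}H.
Qed.

Lemma kform_Wsub_cst_add (c : R) h : dx.-integrable setT (EFin \o h) ->
  kform dx Wsub (fun x => c + h x) (fun x => c + h x) = kform dx Wsub h h.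
Proof.
move=> ih; apply: kform_shift => // x.
  exact: Wsub_mean1.
exact: Wsub_mean2.
Qed.

Lemma density_energy_uniform m beta :
  density_energy m beta (fun=> ri) =
  beta^-1 / (m - 1) * (ri `^ m * L%:num ^+ d) - beta^-1 / (m - 1).
Proof.
rewrite /density_energy Rintegral_torus_cst.
have -> : kform dx Wsub (fun=> ri) (fun=> ri) = 0.
  have := @kform_Wsub_cst_add ri (fun=> 0) (bmeas_integrable dx (bmeas_cst _ _)).
  rewrite addr0 => ->; rewrite kform_Fubini1//; try exact: (bmeas_integrable dx (bmeas_cst _ _)).
  by under eq_Rintegral do rewrite mul0r; rewrite Rintegral_torus_cst mul0r.
by rewrite mulr0 addr0.
Qed.

Lemma free_energy_uniform m beta :
  free_energy L W m beta (uniform L d) = (density_energy m beta (fun=> ri))%:E.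
Proof.
apply: free_energyE; first exact: has_density_uniform.
exact: bmeas_integrable (bmeas_cst _ _).
Qed.

Lemma fluctuation rho g : has_density L rho g ->
  dx.-integrable setT (EFin \o (fun x => g x - ri)) /\ \int[dx]_x (g x - ri) = 0.
Proof.
move=> gd; have ic := bmeas_integrable dx (bmeas_cst _ ri).
split; first exact: (integrableB measurableT gd.1 ic).
by rewrite RintegralB//; [rewrite (has_density_int gd) Rintegral_torus_cst rho_infty_mass subrr|exact: gd.1].
Qed.

Lemma kform_fluctuation rho g : has_density L rho g ->
  kform dx Wsub g g = kform dx Wsub (fun x => g x - ri) (fun x => g x - ri).
Proof.
move=> gd; rewrite -(kform_Wsub_cst_add ri (fluctuation gd).1).
by congr (kform _ _ _ _); apply/funext => x; rewrite addrC subrK.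
Qed.

Lemma same_measure_uniform rho g : has_density L rho g ->
  dx.-integrable setT (EFin \o (fun x => (g x - ri) ^+ 2)) ->
  \int[dx]_x ((g x - ri) ^+ 2) <= 0 -> same_measure rho (uniform L d).
Proof.
move=> gd i2 le0.
have e0 : \int[dx]_x ((g x - ri) ^+ 2) = 0.
  by apply/eqP; rewrite eq_le le0 Rintegral_ge0// => x _; exact: sqr_ge0.
have H := Rintegral_eq0_ae i2 (fun x => sqr_ge0 _) e0.
apply: (has_density_same (g := fun=> ri)); last exact: has_density_uniform.
apply: (has_density_eq gd) => //.
apply: filterS H => x /= K Tx; have /eqP := K Tx.
by rewrite sqrf_eq0 subr_eq0 => /eqP.
Qed.

End energy.

(** * Energy around the uniform state *)

Section estimates.
Context (R : realType) (L : {posnum R}) (d : nat) (W : 'rV[R]_d -> R).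
Hypothesis W_per : periodic_along_axes L W.
Hypothesis W_even : even_along_axes W.
Hypothesis W_cont : continuous W.
Hypothesis W_mean0 : mean_zero L W.
Hypothesis W_nstable : ~ H_stable L W.
Variable k : 'rV[int]_d.
Hypothesis k_min : minimising_mode L W k.
Local Notation dx := (torus_measure L%:num d).
Local Notation point := (d.-tuple R).
Local Notation ri := (rho_infty L d).
Local Notation Wsub := (Wsub W).
Local Notation energy := (@density_energy R L d W).
Local Notation mode := (fourier_mode L k).
Local Notation w := (cos_coef L W k).
Implicit Types (rho mu : probability point R) (g h : point -> R) (m beta a : R).

Let bWs := bmeas_Wsub W_per W_even W_cont.
Let ri0 : 0 < ri := rho_infty_gt0 L d.
Let nat_k : natural_modes k. Proof. by have [] := k_min. Qed.
Let k_ge0 i : 0 <= k ord0 i.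
Proof. by have [k0 _] := (natural_modesP k).1 nat_k; exact: k0. Qed.
Let w_lt0 : w < 0.
Proof. exact: minimising_mode_lt0 W_per W_even W_cont _ W_nstable k_min. Qed.
Let bmode : bmeas mode := bmeas_mode L k.

Lemma Rintegral_scale (c : R) g : bmeas g ->
  \int[dx]_x (c * g x) = c * \int[dx]_x g x.
Proof. by move=> bg; rewrite RintegralZl//; exact: bmeas_integrable. Qed.

Let bmode2 : bmeas (fun x => mode x ^+ 2) := bmeasX 2 bmode.
Let bmode3 : bmeas (fun x => mode x ^+ 3) := bmeasX 3 bmode.

Lemma sqrt_rho_infty : ri `^ 2^-1 = L%:num `^ (- (d%:R / 2)).
Proof.
by rewrite /rho_infty -powR_invn// -powRrM mulNr.
Qed.

Lemma beta_sharpE m : beta_sharp L W m = - (m * ri `^ (m - 2)) / w.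
Proof.
rewrite /beta_sharp (inf_coef_ratio k_min) coef_ratioE// -sqrt_rho_infty.
have -> : m - 3 / 2 = (m - 2) + 2^-1 by field.
rewrite powRD; last by rewrite (gt_eqF ri0) implybT.
have h0 : ri `^ 2^-1 != 0 by rewrite gt_eqF// powR_gt0.
by have wN0 := ltr0_neq0 w_lt0; field; rewrite ?h0 ?wN0.
Qed.

Lemma beta_sharp_gt0 m : 0 < m -> 0 < beta_sharp L W m.
Proof.
by move=> m0; rewrite beta_sharpE mulNr -mulrN -invrN divr_gt0 ?oppr_gt0// mulr_gt0 ?powR_gt0.
Qed.

Lemma lt_beta_sharp m beta : 0 < beta ->
  (beta < beta_sharp L W m) = (0 < m * ri `^ (m - 2) / beta + w).
Proof.
move=> b0; rewrite beta_sharpE mulNr -mulrN -invrN ltr_pdivlMr ?oppr_gt0//.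
rewrite -ltrBlDr sub0r ltr_pdivlMr//; congr (_ < _); ring.
Qed.

Lemma conv_mode x : \int[dx]_y (Wsub (x, y) * mode y) = w * mode x.
Proof.
rewrite mode_natural// [RHS]mulrCA -(conv_cmode W_per W_even W_cont k x).
rewrite -RintegralZl//; last first.
  apply: bmeas_integrable; apply: bmeasM; last exact: bmeas_cmode.
  by apply: (bmeas_comp bWs); exact: measurable_pair1.
by apply: eq_Rintegral => y _; rewrite mode_natural// mulrCA.
Qed.

Lemma kform_mode a : kform dx Wsub (fun x => a * mode x) (fun x => a * mode x) = a ^+ 2 * w.
Proof.
have ba : bmeas (fun x => a * mode x) by apply: bmeasM => //; exact: bmeas_cst.
have ia := bmeas_integrable dx ba.
rewrite kform_Fubini1//.
have -> : \int[dx]_x (a * mode x * \int[dx]_y (Wsub (x, y) * (a * mode y))) =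
    \int[dx]_x (a ^+ 2 * w * (mode x ^+ 2)).
  apply: eq_Rintegral => x _.
  have -> : \int[dx]_y (Wsub (x, y) * (a * mode y)) = a * (w * mode x).
    rewrite -conv_mode -RintegralZl//; last first.
      apply: bmeas_integrable; apply: bmeasM => //.
      by apply: (bmeas_comp bWs); exact: measurable_pair1.
    by apply: eq_Rintegral => y _; rewrite mulrCA.
  by ring.
rewrite RintegralZl//; last by apply: bmeas_integrable; exact: bmeasX.
by rewrite Rintegral_mode2// mulr1.
Qed.

Definition perturbed a (x : point) : R := ri + a * mode x.

Lemma bmeas_perturbed a : bmeas (perturbed a).
Proof.
apply: bmeasD; first exact: bmeas_cst.
by apply: bmeasM => //; exact: bmeas_cst.
Qed.

Lemma perturbed_bound a x : 0 <= a -> `|a * mode x| <= a * mode_scale L k.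
Proof.
by move=> a0; rewrite normrM ger0_norm// ler_wpM2l// mode_le.
Qed.

Lemma perturbed_ge0 a : 0 <= a -> a * mode_scale L k <= ri -> forall x, 0 <= perturbed a x.
Proof.
move=> a0 ar x; have := le_trans (perturbed_bound x a0) ar.
by rewrite ler_norml /perturbed => /andP[h _]; lra.
Qed.

Lemma Rintegral_perturbed a : \int[dx]_x perturbed a x = 1.
Proof.
rewrite RintegralD//; last 2 first.
- exact: bmeas_integrable (bmeas_cst _ _).
- by apply: bmeas_integrable; apply: bmeasM => //; exact: bmeas_cst.
rewrite Rintegral_torus_cst rho_infty_mass RintegralZl//; last exact: bmeas_integrable.
by rewrite Rintegral_mode// mulr0 addr0.
Qed.

Lemma exists_perturbed a : 0 <= a -> a * mode_scale L k <= ri ->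
  exists rho, has_density L rho (perturbed a).
Proof.
move=> a0 ar; have ip := bmeas_integrable dx (bmeas_perturbed a).
have [rho rhoE] := exists_probability_density ip (perturbed_ge0 a0 ar) (Rintegral_perturbed a).
by exists rho; split.
Qed.

Lemma kform_perturbed a : kform dx Wsub (perturbed a) (perturbed a) = a ^+ 2 * w.
Proof.
have ba : bmeas (fun x => a * mode x) by apply: bmeasM => //; exact: bmeas_cst.
rewrite -kform_mode.
exact: (kform_Wsub_cst_add W_per W_even W_cont W_mean0 ri (bmeas_integrable dx ba)).
Qed.

Lemma powR_ri_sqr m : ri `^ m = ri `^ (m - 2) * ri ^+ 2.
Proof.
rewrite -powR_mulrn ?ltW// -powRD; last by rewrite (gt_eqF ri0) implybT.
by rewrite subrK.
Qed.

Lemma bmeas_powR g m : 0 <= m -> bmeas g -> (forall x, 0 <= g x) ->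
  bmeas (fun x => g x `^ m).
Proof.
move=> m0 [mg [M gM]] g0; split; first exact: measurable_powR_comp.
exists (M `^ m) => x; rewrite ger0_norm ?powR_ge0//.
have gMx : g x <= M by rewrite (le_trans _ (gM x))// ler_norm.
by apply: ge0_ler_powR => //; rewrite nnegrE// (le_trans (g0 x)).
Qed.

(** The fourth derivative of the power is nonpositive for [2 <= m <= 3] and the cube of
    the mode integrates to zero, so that the expansion stops at second order. *)
Lemma energy_perturbed_le m beta a : 2 <= m <= 3 -> 0 < beta -> 0 <= a ->
  a * mode_scale L k <= ri / 2 ->
  energy m beta (perturbed a) <=
  energy m beta (fun=> ri) + a ^+ 2 / 2 * (m * ri `^ (m - 2) / beta + w).
Proof.
move=> m23 b0 a0 ar; have /andP[m2 m3] := m23.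
have rp : 0 < ri by exact: ri0.
have ar1 : a * mode_scale L k <= ri by lra.
have p0 := perturbed_ge0 a0 ar1.
have m0 : 0 <= m by lra.
have bp := bmeas_powR m0 (bmeas_perturbed a) p0.
pose t x := (a / ri) * mode x.
have bt : bmeas t by apply: bmeasM => //; exact: bmeas_cst.
have t1 x : `|t x| < 1.
  have -> : t x = (a * mode x) / ri by rewrite /t; ring.
  rewrite normrM [`|ri^-1|]ger0_norm ?invr_ge0 ?ltW// ltr_pdivrMr// mul1r.
  by apply: (le_lt_trans (le_trans (perturbed_bound x a0) ar)); lra.
have pE x : perturbed a x = ri * (1 + t x).
  by rewrite /perturbed /t; have riN0 := lt0r_neq0 ri0; field.
pose A := m * (m - 1) / 2; pose B := m * (m - 1) * (m - 2) / 6.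
have I : \int[dx]_x (perturbed a x `^ m) <=
    ri `^ m * (L%:num ^+ d + A * (a / ri) ^+ 2).
  apply: (@le_trans _ _ (\int[dx]_x (ri `^ m * (1 + m * t x + A * t x ^+ 2 + B * t x ^+ 3)))).
    have bc c n : bmeas (fun x => c * t x ^+ n) by apply: bmeasM; [exact: bmeas_cst|exact: bmeasX].
    apply: le_Rintegral => //; first exact: bmeas_integrable.
      apply: bmeas_integrable; apply: bmeasM; first exact: bmeas_cst.
      do 3 apply: bmeasD => //; first exact: bmeas_cst.
      by apply: bmeasM => //; exact: bmeas_cst.
    move=> x _; have t1x := t1 x; move: (t1x); rewrite ltr_norml => /andP[tN t1'].
    rewrite pE (powRM _ (ltW rp)); last by lra.
    by rewrite ler_wpM2l ?powR_ge0//; exact: powR_le_taylor3.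
  have -> : \int[dx]_x (ri `^ m * (1 + m * t x + A * t x ^+ 2 + B * t x ^+ 3)) =
      \int[dx]_x (ri `^ m * 1 + (ri `^ m * m * (a / ri) * mode x + (ri `^ m * A * (a / ri) ^+ 2 * mode x ^+ 2
         + ri `^ m * B * (a / ri) ^+ 3 * mode x ^+ 3))).
    by apply: eq_Rintegral => x _; rewrite /t; ring.
  have bcm c n : bmeas (fun x => c * mode x ^+ n) by apply: bmeasM; [exact: bmeas_cst|exact: bmeasX].
  have bc1 c : bmeas (fun x => c * mode x) by apply: bmeasM; [exact: bmeas_cst|].
  have i1 c := bmeas_integrable dx (bc1 c).
  have im c n := bmeas_integrable dx (bcm c n).
  rewrite RintegralD//; last 2 first.
  - exact: bmeas_integrable (bmeas_cst _ _).
  - by apply: bmeas_integrable; do 2 apply: bmeasD => //.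
  rewrite RintegralD//; last by apply: bmeas_integrable; apply: bmeasD.
  rewrite RintegralD// Rintegral_torus_cst.
  rewrite (Rintegral_scale _ bmode) (Rintegral_scale _ bmode2) (Rintegral_scale _ bmode3).
  rewrite Rintegral_mode// Rintegral_mode2// Rintegral_mode3//.
  by rewrite !mulr0 addr0 add0r !mulr1 mulrDr mulrA.
rewrite /density_energy kform_perturbed -/(density_energy _ _ _ _).
have := density_energy_uniform W_per W_even W_cont W_mean0 m beta.
rewrite /density_energy => ->.
have m1 : 0 < m - 1 by lra.
have c0 : 0 <= beta^-1 / (m - 1) by rewrite divr_ge0 ?invr_ge0// ltW.
have := ler_wpM2l c0 I.
have -> : beta^-1 / (m - 1) * (ri `^ m * (L%:num ^+ d + A * (a / ri) ^+ 2)) =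
   beta^-1 / (m - 1) * (ri `^ m * L%:num ^+ d) + a ^+ 2 / 2 * (m * ri `^ (m - 2) / beta).
  rewrite powR_ri_sqr /A.
  have riN0 := lt0r_neq0 ri0; have bN0 := lt0r_neq0 b0; have mN0 := lt0r_neq0 m1.
  by field; rewrite ?riN0 ?bN0 ?mN0.
lra.
Qed.

(** The factor [q < 1] absorbs the remainder of the entropic part, uniformly over
    densities close to the uniform one. *)
Lemma energy_near_ge m q : 2 <= m -> 0 < q < 1 -> exists2 r, 0 < r < 1 &
  forall beta rho g, 0 < beta -> has_density L rho g -> bmeas g ->
  (forall x, `|g x - ri| <= r * ri) ->
  energy m beta (fun=> ri) + 2^-1 * (q * (m * ri `^ (m - 2) / beta) + w) *
    \int[dx]_x ((g x - ri) ^+ 2) <= energy m beta g.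
Proof.
move=> m2 q01; have rp : 0 < ri by exact: ri0.
have [r0 /andP[r00 r01] Hr] := powR_ge_taylor2 m2 q01.
exists (r0 / 2); first by apply/andP; split; lra.
move=> beta rho g b0 gd bg gr.
have [ih ih0] := fluctuation gd.
pose h x := g x - ri.
have bh : bmeas h by apply: bmeasB => //; exact: bmeas_cst.
have g0 x : 0 <= g x.
  have := gr x; rewrite ler_norml => /andP[+ _] => gx.
  have : r0 / 2 * ri <= ri by rewrite ger_pMl//; lra.
  by move=> ?; lra.
have m0 : 0 <= m by lra.
have bgm := bmeas_powR m0 bg g0.
pose A := m * (m - 1) / 2.
have I : ri `^ m * L%:num ^+ d + ri `^ (m - 2) * (q * A) * \int[dx]_x (h x ^+ 2) <=
    \int[dx]_x (g x `^ m).
  have -> : ri `^ m * L%:num ^+ d + ri `^ (m - 2) * (q * A) * \int[dx]_x (h x ^+ 2) =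
      \int[dx]_x (ri `^ m * (1 + m * (h x / ri) + q * A * (h x / ri) ^+ 2)).
    have -> : \int[dx]_x (ri `^ m * (1 + m * (h x / ri) + q * A * (h x / ri) ^+ 2)) =
      \int[dx]_x (ri `^ m + ((ri `^ m * m / ri) * h x + (ri `^ (m - 2) * (q * A)) * h x ^+ 2)).
      apply: eq_Rintegral => x _; rewrite (powR_ri_sqr m).
      by have riN0 := lt0r_neq0 ri0; field.
    have ba c : bmeas (fun x => c * h x) by apply: bmeasM => //; exact: bmeas_cst.
    have ba2 c : bmeas (fun x => c * h x ^+ 2).
      by apply: bmeasM; [exact: bmeas_cst|exact: bmeasX].
    rewrite RintegralD//; last 2 first.
    - exact: bmeas_integrable (bmeas_cst _ _).
    - by apply: bmeas_integrable; exact: bmeasD.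
    rewrite RintegralD//; try exact: bmeas_integrable.
    rewrite (Rintegral_scale _ bh) (Rintegral_scale _ (bmeasX 2 bh)).
    by rewrite Rintegral_torus_cst /h ih0 mulr0 add0r.
  apply: le_Rintegral => //; last 2 first.
  - exact: bmeas_integrable.
  - move=> x _.
    have hx : `|h x / ri| < r0.
      rewrite normrM [`|ri^-1|]ger0_norm ?invr_ge0 ?ltW// ltr_pdivrMr//.
      by apply: (le_lt_trans (gr x)); rewrite ltr_pM2r//; lra.
    have gE : g x = ri * (1 + h x / ri) by rewrite /h; have riN0 := lt0r_neq0 ri0; field.
    have : -1 < h x / ri by move: hx; rewrite ltr_norml => /andP[? _]; lra.
    move=> hN1; rewrite [in leRHS]gE (powRM _ (ltW rp)); last by lra.
    by rewrite ler_wpM2l ?powR_ge0//; exact: Hr.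
  apply: bmeas_integrable; apply: bmeasM; first exact: bmeas_cst.
  have bhr : bmeas (fun x => h x / ri) by apply: bmeasM => //; exact: bmeas_cst.
  apply: bmeasD; first apply: bmeasD; first exact: bmeas_cst.
    by apply: bmeasM => //; exact: bmeas_cst.
  by apply: bmeasM; [exact: bmeas_cst|exact: bmeasX].
have Q : w * \int[dx]_x (h x ^+ 2) <= kform dx Wsub g g.
  rewrite (kform_fluctuation W_per W_even W_cont W_mean0 gd).
  apply: (kform_Wsub_ge W_per W_even W_cont) => //; first exact: ltW.
  - by move=> l; exact: minimising_mode_cos_coef k_min.
  - by apply: bmeas_integrable; exact: bmeasX.
have m1 : 0 < m - 1 by lra.
have c0 : 0 <= beta^-1 / (m - 1) by rewrite divr_ge0 ?invr_ge0// ltW.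
have := ler_wpM2l c0 I.
have -> : beta^-1 / (m - 1) * (ri `^ m * L%:num ^+ d + ri `^ (m - 2) * (q * A) * \int[dx]_x (h x ^+ 2)) =
  beta^-1 / (m - 1) * (ri `^ m * L%:num ^+ d) +
  2^-1 * (q * (m * ri `^ (m - 2) / beta)) * \int[dx]_x (h x ^+ 2).
  rewrite /A; have bN0 := lt0r_neq0 b0; have mN0 := lt0r_neq0 m1.
  by field; rewrite ?bN0 ?mN0.
rewrite (density_energy_uniform W_per W_even W_cont W_mean0 m beta) {1}/density_energy.
rewrite -/h /density_energy; lra.
Qed.

(** For the square the second order expansion is exact, so that the bound is global. *)
Lemma quadratic_energy_ge beta rho g : 0 < beta -> has_density L rho g -> (forall x, 0 <= g x) ->
  dx.-integrable setT (EFin \o (fun x => g x `^ 2)) ->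
  dx.-integrable setT (EFin \o (fun x => (g x - ri) ^+ 2)) /\
  energy 2 beta (fun=> ri) + (beta^-1 + w / 2) * \int[dx]_x ((g x - ri) ^+ 2) <=
  energy 2 beta g.
Proof.
move=> b0 gd g0 ig2; have [ih ih0] := fluctuation gd.
pose h x := g x - ri.
have p2 x : g x `^ 2 = g x ^+ 2 by rewrite powR_mulrn.
have ih2 : dx.-integrable setT (EFin \o (fun x => h x ^+ 2)).
  have i1 := integrableZl measurableT (2 * ri) gd.1.
  have i2 := integrableB measurableT ig2 i1.
  have i3 := integrableD measurableT i2 (bmeas_integrable dx (bmeas_cst _ (ri ^+ 2))).
  apply: (eq_integrable measurableT _ _ _ i3) => x _ /=.
  by congr EFin; rewrite p2 /h; ring.
split=> //.
have I : \int[dx]_x (g x `^ 2) = ri ^+ 2 * L%:num ^+ d + \int[dx]_x (h x ^+ 2).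
  have -> : \int[dx]_x (g x `^ 2) = \int[dx]_x (ri ^+ 2 + (2 * ri * h x + h x ^+ 2)).
    by apply: eq_Rintegral => x _; rewrite p2 /h; ring.
  have i2 : dx.-integrable setT (EFin \o (fun x => 2 * ri * h x)).
    exact: (integrableZl measurableT (2 * ri) ih).
  rewrite RintegralD//; last 2 first.
  - exact: bmeas_integrable (bmeas_cst _ _).
  - exact: (integrableD measurableT i2 ih2).
  by rewrite RintegralD// RintegralZl// ih0 mulr0 add0r Rintegral_torus_cst.
have Q : w * \int[dx]_x (h x ^+ 2) <= kform dx Wsub g g.
  rewrite (kform_fluctuation W_per W_even W_cont W_mean0 gd).
  apply: (kform_Wsub_ge W_per W_even W_cont) => //; first exact: ltW.
  by move=> l; exact: minimising_mode_cos_coef k_min.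
rewrite (density_energy_uniform W_per W_even W_cont W_mean0 2 beta) /density_energy I.
rewrite (powR_mulrn 2 (ltW ri0)); have -> : (2 : R) - 1 = 1 by ring.
rewrite divr1 -/h; lra.
Qed.

Lemma quadratic_energy_perturbed beta a : 0 <= a -> a * mode_scale L k <= ri ->
  energy 2 beta (perturbed a) = energy 2 beta (fun=> ri) + a ^+ 2 * (beta^-1 + w / 2).
Proof.
move=> a0 ar; have p0 := perturbed_ge0 a0 ar.
rewrite (density_energy_uniform W_per W_even W_cont W_mean0 2 beta) /density_energy.
rewrite kform_perturbed (powR_mulrn 2 (ltW ri0)).
have -> : \int[dx]_x (perturbed a x `^ 2) = ri ^+ 2 * L%:num ^+ d + a ^+ 2.
  have -> : \int[dx]_x (perturbed a x `^ 2) =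
      \int[dx]_x (ri ^+ 2 + (2 * ri * a * mode x + a ^+ 2 * mode x ^+ 2)).
    by apply: eq_Rintegral => x _; rewrite powR_mulrn// /perturbed; ring.
  have b1 c : bmeas (fun x => c * mode x) by apply: bmeasM => //; exact: bmeas_cst.
  have b2 c : bmeas (fun x => c * mode x ^+ 2).
    by apply: bmeasM; [exact: bmeas_cst|exact: bmeasX].
  rewrite RintegralD//; last 2 first.
  - exact: bmeas_integrable (bmeas_cst _ _).
  - by apply: bmeas_integrable; exact: bmeasD.
  rewrite RintegralD//; try exact: bmeas_integrable.
  rewrite (Rintegral_scale _ bmode) (Rintegral_scale _ bmode2).
  by rewrite Rintegral_torus_cst Rintegral_mode// Rintegral_mode2// mulr0 add0r mulr1.
have -> : (2 : R) - 1 = 1 by ring.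
by rewrite divr1; set B := beta^-1; field.
Qed.
End estimates.

(** * Transition points *)

Section Linfty.
Context (R : realType) (L : {posnum R}) (d : nat).
Local Notation dx := (torus_measure L%:num d).
Local Notation point := (d.-tuple R).
Implicit Types (rho mu : probability point R) (g h : point -> R).

Lemma Linfty_distP rho mu (r : R) :
  (Linfty_dist L rho mu <= r%:E)%E <->
  {ae dx, forall x, `|density L rho x - density L mu x| <= r}.
Proof.
have dx0 : (0 < dx setT)%E.
  have -> : dx setT = (L%:num ^+ d)%:E by exact: torus_measureT.
  by rewrite lte_fin exprn_gt0.
rewrite /Linfty_dist unlock dx0.
split=> [/ess_supP|] H; last apply/ess_supP.
  by apply: filterS H => x /=; rewrite lee_fin.
by apply: filterS H => x /=; rewrite lee_fin.
Qed.

(** Truncation changes the density on a null set only. *)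
Lemma Linfty_uniform_density rho (r : R) : 0 <= r -> rho `<< dx ->
  (Linfty_dist L rho (uniform L d) <= r%:E)%E ->
  exists g, [/\ has_density L rho g, bmeas g & forall x, `|g x - rho_infty L d| <= r].
Proof.
move=> r0 rdx /Linfty_distP H; set ri := rho_infty L d.
have fd := has_density_density rdx.
have ud := has_density_uniform L d.
have uE := has_density_ae (has_density_density (has_density_dominates ud)) ud.
have mf := integrable_measurable fd.1.
pose g x := Num.max (ri - r) (Num.min (density L rho x) (ri + r)).
have mg : measurable_fun setT g.
  apply: measurable_maxr; first exact: measurable_cst.
  by apply: measurable_minr => //; exact: measurable_cst.
have gr x : `|g x - ri| <= r.
  rewrite ler_norml /g; apply/andP; split.
    by rewrite lerBrDr [_ + ri]addrC le_max lexx.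
  rewrite lerBlDr [_ + ri]addrC ge_max ge_min lexx orbT andbT; lra.
exists g; split => //.
- apply: (has_density_eq fd mg).
  apply: filterS2 H uE => x /= H1 H2 Tx; have := H2 Tx => E; move: H1.
  rewrite E ler_norml => /andP[h1 h2]; rewrite /g min_l; last by rewrite -/ri in h1 h2; lra.
  by rewrite max_r//; rewrite -/ri in h1 h2; lra.
- split=> //; exists (r + `|ri|) => x.
  by rewrite -[g x](subrK ri) (le_trans (ler_normD _ _))// lerD2r.
Qed.

End Linfty.

Section main.
Context (R : realType) (L : {posnum R}) (d : nat) (W : 'rV[R]_d -> R).
Hypothesis W_per : periodic_along_axes L W.
Hypothesis W_even : even_along_axes W.
Hypothesis W_cont : continuous W.
Hypothesis W_mean0 : mean_zero L W.
Hypothesis W_nstable : ~ H_stable L W.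
Variable k : 'rV[int]_d.
Hypothesis k_min : minimising_mode L W k.
Local Notation dx := (torus_measure L%:num d).
Local Notation point := (d.-tuple R).
Local Notation ri := (rho_infty L d).
Local Notation energy := (@density_energy R L d W).
Local Notation mode := (fourier_mode L k).
Local Notation w := (cos_coef L W k).
Local Notation unif := (uniform L d).
Local Notation pert := (@perturbed R L d k).
Implicit Types (rho mu : probability point R) (g h : point -> R) (m beta a : R).

Let ri0 : 0 < ri := rho_infty_gt0 L d.
Let nat_k : natural_modes k. Proof. by have [] := k_min. Qed.
Let s0 : 0 < mode_scale L k := mode_scale_gt0 L k.

Lemma uniform_torus : is_torus_probability L unif.
Proof. exact: has_density_torus (has_density_uniform L d). Qed.

Lemma free_energy_perturbed m beta a rho : 0 <= m -> 0 <= a ->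
  a * mode_scale L k <= ri -> has_density L rho (pert a) ->
  free_energy L W m beta rho = (energy m beta (pert a))%:E.
Proof.
move=> m0 a0 ar rd; apply: (free_energyE W_per W_even W_cont) => //.
apply: bmeas_integrable; apply: bmeas_powR => //; first exact: bmeas_perturbed.
exact: (perturbed_ge0 k_min).
Qed.

(** The squared norm of the difference of the densities is [(a - b)^2]. *)
Lemma perturbed_inj a b rho mu : has_density L rho (pert a) ->
  has_density L mu (pert b) -> same_measure rho mu -> a = b.
Proof.
move=> rd [ib mE] rm.
have rd' : has_density L rho (pert b) by split=> // A mA; rewrite rm// mE.
have ab := has_density_ae rd rd'.
have bm : bmeas (fun x => (a - b) ^+ 2 * mode x ^+ 2).
  by apply: bmeasM; [exact: bmeas_cst|apply: bmeasX; exact: bmeas_mode].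
have : \int[dx]_x ((a - b) ^+ 2 * mode x ^+ 2) = \int[dx]_x (0 : R).
  apply: Rintegral_ae; [exact: bm.1|exact: measurable_cst|].
  apply: filterS ab => x /= H Tx; have := H Tx; rewrite /perturbed => /addrI E.
  by rewrite -exprMn mulrBl E subrr expr0n.
rewrite Rintegral_torus_cst mul0r (Rintegral_scale L _ (bmeasX 2 (bmeas_mode L k))).
rewrite Rintegral_mode2// mulr1 => /eqP; rewrite sqrf_eq0 subr_eq0 => /eqP.
exact.
Qed.

Lemma has_density_uniform_perturbed : has_density L unif (pert 0).
Proof.
rewrite (_ : pert 0 = fun=> ri); first exact: has_density_uniform.
by apply/funext => x; rewrite /perturbed mul0r addr0.
Qed.

Lemma second_variation_le0 m beta : 0 < m -> 0 < beta ->
  beta_sharp L W m <= beta -> m * ri `^ (m - 2) / beta + w <= 0.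
Proof.
move=> m0 b0 bb; rewrite leNgt -(lt_beta_sharp W_per W_even W_cont W_nstable k_min)//.
by rewrite -leNgt.
Qed.

Lemma second_variation_lt0 m beta : 0 < m -> 0 < beta ->
  beta_sharp L W m < beta -> m * ri `^ (m - 2) / beta + w < 0.
Proof.
move=> m0 b0 bb; have bs0 := beta_sharp_gt0 W_per W_even W_cont W_nstable k_min m0.
apply: lt_le_trans (second_variation_le0 m0 bs0 (lexx _)).
rewrite ltrD2r ltr_pM2l; last by rewrite mulr_gt0// powR_gt0.
by rewrite ltf_pV2.
Qed.

Let amp := ri / 2 / mode_scale L k.

Lemma amp_gt0 : 0 < amp.
Proof. by rewrite /amp !divr_gt0. Qed.

Lemma amp_scale : amp * mode_scale L k = ri / 2.
Proof. by rewrite /amp divfK// gt_eqF. Qed.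

Lemma transition_le_beta_sharp m beta_c : 2 <= m <= 3 ->
  0 < beta_c -> is_minimiser L W m beta_c unif -> beta_c <= beta_sharp L W m.
Proof.
move=> m23 b0 [_ umin]; have /andP[m2 m3] := m23; rewrite leNgt; apply/negP => bb.
have m0 : 0 < m by lra.
have rp : 0 < ri by exact: ri0.
have a0 := amp_gt0; have as_ := amp_scale.
have ar : amp * mode_scale L k <= ri by rewrite as_; lra.
have [rho rd] := exists_perturbed k_min (ltW a0) ar.
have := umin rho (has_density_torus rd).
rewrite (free_energy_uniform W_per W_even W_cont).
rewrite (free_energy_perturbed _ (ltW m0) (ltW a0) ar rd) lee_fin.
have as2 : amp * mode_scale L k <= ri / 2 by rewrite as_.
have := energy_perturbed_le W_per W_even W_cont W_mean0 k_min m23 b0 (ltW a0) as2.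
have sv := second_variation_lt0 m0 b0 bb.
have a2 : 0 < amp ^+ 2 / 2 by rewrite divr_gt0// exprn_gt0.
have : amp ^+ 2 / 2 * (m * ri `^ (m - 2) / beta_c + w) < 0 by rewrite pmulr_rlt0.
lra.
Qed.

(** The second variation vanishes at [beta_sharp], so that a small perturbation along
    the mode does not raise the energy. *)
Lemma not_unique_at_beta_sharp m : 2 <= m <= 3 ->
  ~ is_unique_minimiser L W m (beta_sharp L W m) unif.
Proof.
move=> m23 [[ut umin] uuniq]; have /andP[m2 m3] := m23.
have m0 : 0 < m by lra.
have rp : 0 < ri by exact: ri0.
have b0 := beta_sharp_gt0 W_per W_even W_cont W_nstable k_min m0.
have a0 := amp_gt0; have as_ := amp_scale.
have ar : amp * mode_scale L k <= ri by rewrite as_; lra.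
have [rho rd] := exists_perturbed k_min (ltW a0) ar.
have as2 : amp * mode_scale L k <= ri / 2 by rewrite as_.
have E := energy_perturbed_le W_per W_even W_cont W_mean0 k_min m23 b0 (ltW a0) as2.
have sv := second_variation_le0 m0 b0 (lexx _).
have rmin : is_minimiser L W m (beta_sharp L W m) rho.
  split; first exact: has_density_torus rd.
  move=> mu mt; apply: le_trans (umin mu mt).
  rewrite (free_energy_uniform W_per W_even W_cont).
  rewrite (free_energy_perturbed _ (ltW m0) (ltW a0) ar rd) lee_fin.
  apply: (le_trans E); rewrite gerDl mulr_ge0_le0//.
  by rewrite divr_ge0// exprn_ge0// ltW.
have := perturbed_inj rd has_density_uniform_perturbed (uuniq _ rmin).
by move=> aE; move: a0; rewrite aE ltxx.
Qed.

(** A factor [q < 1] close enough to one keeps the second variation positive at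
    [beta0], and for smaller [beta] it is larger. *)
Lemma minimiser_near_uniform m beta0 : 2 <= m -> 0 < beta0 < beta_sharp L W m ->
  exists2 r, 0 < r & forall beta rho, 0 < beta <= beta0 ->
    is_minimiser L W m beta rho -> (Linfty_dist L rho unif <= r%:E)%E ->
    same_measure rho unif.
Proof.
move=> m2 /andP[b00 b0s].
have m0 : 0 < m by lra.
move: b0s; rewrite (lt_beta_sharp W_per W_even W_cont W_nstable k_min)//.
set X := m * ri `^ (m - 2) => sv.
have X0 : 0 < X by rewrite mulr_gt0// powR_gt0.
have wl0 := minimising_mode_lt0 W_per W_even W_cont W_nstable k_min.
have XB : 0 < X / beta0 by rewrite divr_gt0.
(* the midpoint of [- w / (X / beta0)] and 1 *)
pose q := (1 + - w / (X / beta0)) / 2.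
have qw : - w / (X / beta0) < 1 by rewrite ltr_pdivrMr// mul1r; lra.
have qw0 : 0 < - w / (X / beta0) by rewrite divr_gt0// oppr_gt0.
have q01 : 0 < q < 1 by apply/andP; split; rewrite /q; lra.
have qX : 0 < q * (X / beta0) + w.
  have : - w / (X / beta0) < q by rewrite /q; lra.
  by rewrite ltr_pdivrMr//; lra.
have [r /andP[r0 r1] Hr] := energy_near_ge W_per W_even W_cont W_mean0 W_nstable k_min m2 q01.
exists (r * ri); first by rewrite mulr_gt0.
move=> beta rho /andP[b0 bb] [rt rmin] rdist.
have fu := free_energy_uniform W_per W_even W_cont m beta.
have le_u := rmin _ uniform_torus; rewrite fu in le_u.
have [g0 [g0d _ _]] := free_energy_lty (le_lt_trans le_u (ltry _)).
have [g [gd bg gr]] := Linfty_uniform_density (ltW (mulr_gt0 r0 ri0))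
  (has_density_dominates g0d) rdist.
have gp x : 0 <= g x.
  have := gr x; rewrite ler_norml => /andP[+ _].
  have : r * ri <= ri by rewrite ger_pMl// ltW.
  lra.
have igm := bmeas_integrable dx (bmeas_powR (ltW m0) bg gp).
have := Hr beta rho g b0 gd bg gr; rewrite -/X.
move: le_u; rewrite (free_energyE W_per W_even W_cont _ gd igm) lee_fin => le_u le_g.
have qXb : 0 < q * (X / beta) + w.
  apply: (lt_le_trans qX); rewrite lerD2r ler_pM2l; last by case/andP: q01.
  by rewrite ler_pM2l// lef_pV2.
apply: (same_measure_uniform gd).
  by apply: bmeas_integrable; apply: bmeasX; apply: bmeasB => //; exact: bmeas_cst.
have : 2^-1 * (q * (X / beta) + w) * \int[dx]_x ((g x - ri) ^+ 2) <= 0 by lra.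
by rewrite pmulr_rle0// mulr_gt0.
Qed.

Lemma discontinuous_transition m beta_c : 2 <= m <= 3 -> transition_point L W m beta_c ->
  discontinuous_transition_point L W m beta_c.
Proof.
move=> m23 tp; split=> // -[_ uuniq lim0].
have /andP[m2 m3] := m23; have [b0 below umin above] := tp.
have := transition_le_beta_sharp m23 b0 umin.
rewrite le_eqVlt => /predU1P[bE|bs].
  by apply: (not_unique_at_beta_sharp m23); rewrite -bE.
have [beta0 bb0 b0s] : exists2 beta0, beta_c < beta0 & beta0 < beta_sharp L W m.
  exists ((beta_c + beta_sharp L W m) / 2); lra.
have b00 : 0 < beta0 by lra.
have b0bs : 0 < beta0 < beta_sharp L W m by rewrite b00.
have [r r0 Hr] := minimiser_near_uniform m2 b0bs.
have [rho rhoP] : exists rho : R -> probability point R, forall beta, beta_c < beta ->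
    is_minimiser L W m beta (rho beta) /\ ~ same_measure (rho beta) unif.
  have : forall beta, exists rho : probability point R, beta_c < beta ->
    is_minimiser L W m beta rho /\ ~ same_measure rho unif.
    move=> beta; have [/above[rho rm rn]|nb] := pselect (beta_c < beta).
      by exists rho.
    by exists unif => /nb.
  by move=> /choice[rho rhoP]; exists rho.
have := lim0 rho (fun beta bb => (rhoP beta bb).1).
move=> L0; have : (limf_esup (fun beta => Linfty_dist L (rho beta) unif) beta_c^'+ < r%:E)%E.
  by rewrite L0 lte_fin.
rewrite /limf_esup => /ereal_inf_lt[_ [V VF <-]] supV.
have [beta [[Vb bb] bb0']] : exists beta, (V beta /\ beta_c < beta) /\ beta < beta0.
  apply: (@filter_ex _ beta_c^'+).
  near=> b; split; [split|]; near: b => //; [exact: nbhs_right_gt|exact: nbhs_right_lt].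
have [rm rn] := rhoP beta bb; apply: rn.
apply: (Hr beta) => //; first by apply/andP; split; lra.
apply: le_trans (ltW supV); apply: ereal_sup_ubound.
by exists beta.
Unshelve. all: by end_near. Qed.

Lemma quadratic_minimiser_below beta rho : 0 < beta < beta_sharp L W 2 ->
  is_minimiser L W 2 beta rho -> same_measure rho unif.
Proof.
move=> /andP[b0 bs] [rt rmin].
move: bs; rewrite (lt_beta_sharp W_per W_even W_cont W_nstable k_min)//.
rewrite subrr powRr0 mulr1 => sv.
have fu := free_energy_uniform W_per W_even W_cont 2 beta.
have le_u := rmin _ uniform_torus; rewrite fu in le_u.
have [g [gd gp igm]] := free_energy_lty (le_lt_trans le_u (ltry _)).
have [ih2] := quadratic_energy_ge W_per W_even W_cont W_mean0 W_nstable k_min b0 gd gp igm.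
move: le_u; rewrite (free_energyE W_per W_even W_cont _ gd igm) lee_fin => le_u le_g.
apply: (same_measure_uniform gd ih2).
have c0 : 0 < beta^-1 + w / 2 by lra.
have : (beta^-1 + w / 2) * \int[dx]_x ((g x - ri) ^+ 2) <= 0 by lra.
by rewrite pmulr_rle0.
Qed.

Lemma quadratic_transition beta_c : transition_point L W 2 beta_c -> beta_c = beta_sharp L W 2.
Proof.
move=> [b0 below umin above]; apply/eqP; rewrite eq_le.
rewrite transition_le_beta_sharp//=; last by apply/andP; split; lra.
rewrite leNgt; apply/negP => bs.
have [beta bb0 b0s] : exists2 beta0, beta_c < beta0 & beta0 < beta_sharp L W 2.
  exists ((beta_c + beta_sharp L W 2) / 2); lra.
have [rho rm rn] := above beta bb0; apply: rn.
by apply: quadratic_minimiser_below rm; apply/andP; split; lra.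
Qed.

Lemma max_amplitude_scale : max_amplitude L k * mode_scale L k = ri.
Proof.
have T0 := lt0r_neq0 (Theta_gt0 R k).
have Ld0 : 0 <= L%:num ^+ d by rewrite exprn_ge0.
have E : (L%:num ^+ d) `^ (- 2^-1) = ri `^ 2^-1.
  by rewrite -[ri]powR_inv1// -powRrM mulN1r.
rewrite /max_amplitude E /mode_scale -sqrt_rho_infty.
have -> : ri `^ 2^-1 * (Theta R k)^-1 * (ri `^ 2^-1 * Theta R k) =
   ri `^ 2^-1 * ri `^ 2^-1 by field.
by rewrite -powRD ?(gt_eqF ri0) ?implybT// -[2^-1]div1r -splitr powRr1// ltW.
Qed.

Lemma max_amplitude_perturbed a : 0 <= a <= max_amplitude L k ->
  0 <= a /\ a * mode_scale L k <= ri.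
Proof.
by move=> /andP[a0 am]; split=> //; rewrite -max_amplitude_scale ler_pM2r.
Qed.

(** The energy is exactly constant along the minimising mode, as its second variation
    vanishes. *)
Lemma quadratic_minimiser_perturbed a rho : is_minimiser L W 2 (beta_sharp L W 2) unif ->
  0 <= a <= max_amplitude L k -> has_density L rho (pert a) ->
  is_minimiser L W 2 (beta_sharp L W 2) rho.
Proof.
move=> [_ umin] /max_amplitude_perturbed[a0 ar] rd.
split; first exact: has_density_torus rd.
move=> mu mt; apply: le_trans (umin mu mt).
rewrite (free_energy_uniform W_per W_even W_cont).
rewrite (free_energy_perturbed _ _ a0 ar rd)// lee_fin.
rewrite (quadratic_energy_perturbed W_per W_even W_cont W_mean0 k_min _ a0 ar) gerDl.
rewrite mulr_ge0_le0 ?sqr_ge0//.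
have := second_variation_le0 (ltr0n R 2) (beta_sharp_gt0 W_per W_even W_cont W_nstable k_min (ltr0n R 2)) (lexx _).
rewrite subrr powRr0 mulr1; lra.
Qed.

Lemma perturbed_Linfty a b rho mu : has_density L rho (pert a) ->
  has_density L mu (pert b) ->
  (Linfty_dist L rho mu <= (`|a - b| * mode_scale L k)%:E)%E.
Proof.
move=> rd md; apply/Linfty_distP.
have rE := has_density_ae (has_density_density (has_density_dominates rd)) rd.
have mE := has_density_ae (has_density_density (has_density_dominates md)) md.
apply: filterS2 rE mE => x /= H1 H2; rewrite (H1 I) (H2 I) /perturbed.
have -> : ri + a * mode x - (ri + b * mode x) = (a - b) * mode x by ring.
by rewrite normrM ler_wpM2l// mode_le.
Qed.

Lemma exists_minimiser_family : is_minimiser L W 2 (beta_sharp L W 2) unif ->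
  exists rho : R -> probability (d.-tuple R) R,
    [/\ one_parameter_family L `[0, max_amplitude L k] rho,
      forall a, 0 <= a <= max_amplitude L k ->
        is_minimiser L W 2 (beta_sharp L W 2) (rho a)
      & same_measure (rho 0) unif].
Proof.
move=> umin; set M := max_amplitude L k.
have M0 : 0 <= M by rewrite /M /max_amplitude mulr_ge0 ?powR_ge0// invr_ge0 ltW// Theta_gt0.
have /choice[rho rhoP] : forall a, exists rho : probability point R,
    0 <= a <= M -> has_density L rho (pert a).
  move=> a; have [aM|na] := pselect (0 <= a <= M); last by exists unif => /na.
  by have [a0 /(exists_perturbed k_min a0)[rho rd]] := max_amplitude_perturbed aM; exists rho.
have IE a : `[0, M]%classic a -> 0 <= a <= M by rewrite /= in_itv.
exists rho; split.
- split=> [a b /IE/rhoP ra /IE/rhoP rb|a /IE aM]; first exact: perturbed_inj ra rb.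
  apply: (@squeeze_cvge _ _ _ _ (fun=> 0%E) _ (fun b => (`|b - a| * mode_scale L k)%:E)).
  + near=> b; apply/andP; split; first exact: Lnorm_ge0.
    apply: perturbed_Linfty; apply: rhoP => //; apply: IE; near: b.
    exact: withinT.
  + exact: cvg_cst.
  + apply: cvg_EFin; first by near=> b.
    have C : `|b - a| * mode_scale L k @[b --> a] --> `|a - a| * mode_scale L k.
      apply: cvgM; last exact: cvg_cst.
      by apply: cvg_norm; apply: cvgB; [exact: cvg_id|exact: cvg_cst].
    rewrite subrr normr0 mul0r in C; exact: cvg_within_filter C.
- by move=> a aM; apply: quadratic_minimiser_perturbed (rhoP a aM).
- apply: (has_density_same _ has_density_uniform_perturbed).
  by apply: rhoP; rewrite lexx.
Unshelve. all: by end_near. Qed.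

End main.

Theorem proposition5p22 (R : realType) (L : {posnum R}) (d : nat)
    (d_gt0 : (0 < d)%N) (W : 'rV[R]_d -> R)
    (W_per : periodic_along_axes L W) (W_C2 : of_class_C2 W)
    (W_even : even_along_axes W) (W_mean0 : mean_zero L W)
    (W_nstable : ~ H_stable L W)
    (m : R) (m_gt1 : 1 < m)
    (beta_c : R) (beta_cP : transition_point L W m beta_c) :
  (2 <= m <= 3 -> discontinuous_transition_point L W m beta_c) /\
  (m = 2 ->
    [/\ beta_c = beta_sharp L W 2,
        exists k_sharp, minimising_mode L W k_sharp
      & forall k_sharp, minimising_mode L W k_sharp ->
        exists rho : R -> probability (d.-tuple R) R,
          [/\ one_parameter_family L `[0, max_amplitude L k_sharp] rho,
              forall a, 0 <= a <= max_amplitude L k_sharp ->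
                is_minimiser L W 2 (beta_sharp L W 2) (rho a)
            & same_measure (rho 0) (uniform L d)]]).
Proof.
have [W_cont _ _] := W_C2.
have [k k_min] := exists_minimising_mode W_per W_even W_cont W_nstable.
split=> [m23|m2].
  exact: (discontinuous_transition W_per W_even W_cont W_mean0 W_nstable k_min m23 beta_cP).
move: beta_cP; rewrite m2 => tp.
have bE := quadratic_transition W_per W_even W_cont W_mean0 W_nstable k_min tp.
split=> [//||l l_min]; first by exists k.
apply: (exists_minimiser_family W_per W_even W_cont W_mean0 W_nstable l_min).
by rewrite -bE; have [] := tp.
Qed.
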